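(* Let $\gamma=(\gamma_t)_{0\leqslant t\leqslant 1}$, $\gamma_t=(x_t,y_t)$, be a weakly geometric rough path over $\mathbb{R}^2$ satisfying $x_0=y_0=0$ and $x_1=1$. Suppose that $\log S(\gamma)$ has infinite radius of convergence. Then $$S_m^\gamma(a_1,\cdots,a_m)=0$$ for all $m\geqslant1$ and all non-degenerate sequences $(a_1,\cdots,a_m)$ satisfying $a_j\in2\pi i\mathbb{Z}$ for each $j$.
   Context: A finite sequence of numbers $(a_1,\cdots,a_m)$ is non-degenerate if $a_j+a_{j+1}+\cdots+a_k\neq0$ for all $1\leqslant j\leqslant k\leqslant m$. For $m\geqslant 1$ and $a_1,\cdots,a_m\in\mathbb{C}$, let $B:[0,1]\to\mathbb{C}^m$ be the path $B_t=\sum_{j=1}^m\big(\int_0^te^{a_jx_s}dy_s\big)\mathrm{e}_j$, where $\{\mathrm{e}_1,\cdots,\mathrm{e}_m\}$ is the standard basis of $\mathbb{C}^m$. Then $S_m^\gamma(a_1,\cdots,a_m)$ denotes the coefficient of $\log S(B)$ with respect to the tensor $\mathrm{e}_1\otimes\cdots\otimes\mathrm{e}_m$. $T((V))=\prod_{n\geqslant 0}V^{\otimes n}$ is the algebra of formal tensor series with product $(\xi\otimes\eta)_n=\sum_{k=0}^n\xi_k\otimes\eta_{n-k}$. For $\xi$ with $\xi_0=1$, $\log\xi=\sum_{n\geqslant1}\frac{(-1)^{n-1}}{n}(\xi-\mathbf{1})^{\otimes n}$. Each $V^{\otimes n}$ carries the projective tensor norm. The radius of convergence of $\xi\in T((V))$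 is that of the power series $\sum_{n\geqslant0}\|\xi_n\|z^n$. A $p$-rough path over $V$ ($p\geqslant1$) is a continuous map $\mathbf{X}=(1,X^1,\dots,X^{[p]})$ on $\{0\leqslant s\leqslant t\leqslant 1\}$ with values in the tensor algebra truncated at level $[p]$, such that $\mathbf{X}_{s,u}=\mathbf{X}_{s,t}\otimes\mathbf{X}_{t,u}$ and $\sum_{i=1}^{[p]}\sup_{\mathcal P}\sum_{t_l\in\mathcal P}\|X^i_{t_{l-1},t_l}\|^{p/i}<\infty$. It is weakly geometric if it takes values in the truncated group of group-like elements (exponentials of Lie polynomials). By Lyons' extension theorem it extends uniquely to a multiplicative functional $S(\mathbf{X})_{\cdot,\cdot}$ in $T((V))$ whose truncations have finite $p$-variation; $S(\mathbf{X})_{0,1}$ is the signature and its logarithm the logarithmic signature. ''A rough path $\gamma$'' refers to the path $\gamma$ which is the first level component of a rough path $\mathbf{X}$, and $S(\gamma)=S(\mathbf{X})_{0,1}$. When $p=1$, $\gamma$ is a continuous path of bounded variation and $S(\gamma)$ is the sequence of its iterated Lebesgue-Stieltjes integrals. (Iterated) integrals along $\gamma$, in particular the path $B$ and its signature, are understood in the rough path sense with respect to the underlying rough path (Lebesgue-Stieltjes in the bounded variation case). *)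

(* Defs.v *)
From HB Require Import structures.
From mathcomp Require Import all_boot all_order all_algebra.
From mathcomp Require Import all_classical all_reals all_analysis.
From mathcomp Require Export complex.

Set Implicit Arguments.
Unset Strict Implicit.
Unset Printing Implicit Defensive.

Import Order.TTheory GRing.Theory Num.Theory.
Import numFieldNormedType.Exports.

Local Open Scope classical_set_scope.
Local Open Scope ring_scope.
Local Open Scope complex_scope.

(* T((K^d)): an element is given by its coefficients on the tensors
   e_{i_1} (x) ... (x) e_{i_n}, indexed by the words i_1 ... i_n; level n
   consists of the coefficients on words of size n. An element of the tensor
   algebra truncated at level N is given by a series of which only the
   coefficients on words of size at most N matter. *)
Definition tseries (d : nat) (K : Type) := seq 'I_d -> K.

Definition tone (d : nat) (K : numFieldType) : tseries d K :=
  fun w => if w is [::] then 1 else 0.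

Definition tletter (d : nat) (K : numFieldType) (i : 'I_d) : tseries d K :=
  fun w => if w == [:: i] then 1 else 0.

Definition tlin (d : nat) (K : numFieldType) (c : K) (xi eta : tseries d K) :
  tseries d K := fun w => c * xi w + eta w.

Definition tmul (d : nat) (K : numFieldType) (xi eta : tseries d K) :
  tseries d K :=
  fun w => \sum_(k < (size w).+1) xi (take k w) * eta (drop k w).

Definition tpow (d : nat) (K : numFieldType) (xi : tseries d K) (n : nat) :
  tseries d K := iter n (tmul xi) (@tone d K).

(* For xi_0 = 0 the power xi^n vanishes on words of size less than n, so the
   sums below are the full series; the same applies to xi - 1 when xi_0 = 1. *)
Definition texp (d : nat) (K : numFieldType) (xi : tseries d K) :
  tseries d K :=
  fun w => \sum_(0 <= n < (size w).+1) (n`!)%:R^-1 * tpow xi n w.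

Definition tlog (d : nat) (K : numFieldType) (xi : tseries d K) :
  tseries d K :=
  fun w => \sum_(1 <= n < (size w).+1)
    ((-1) ^+ n.-1 / n%:R) * tpow (tlin (-1) (@tone d K) xi) n w.

Inductive lie_poly (d : nat) (K : numFieldType) : tseries d K -> Prop :=
| lie_letter i : lie_poly (tletter K i)
| lie_lin c xi eta : lie_poly xi -> lie_poly eta -> lie_poly (tlin c xi eta)
| lie_bracket xi eta : lie_poly xi -> lie_poly eta ->
    lie_poly (tlin (-1) (tmul eta xi) (tmul xi eta)).

(* The scalars K are R or R[i]; abs is the corresponding real-valued absolute
   value, normr or cabs. *)
Definition cabs (R : realType) (z : R[i]) : R := ComplexField.Normc.normc z.

Definition enorm (R : realType) (K : numFieldType) (abs : K -> R) (d : nat)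
  (v : 'rV[K]_d) : R := Num.sqrt (\sum_(i < d) abs (v 0 i) ^+ 2).

(* Projective norm of the component of degree n, K^d being given its Euclidean
   norm. The scalars c r are redundant for n > 0; for n = 0 they make the norm
   the absolute value on K. *)
Definition pnorm (R : realType) (K : numFieldType) (abs : K -> R) (d : nat)
  (n : nat) (xi : tseries d K) : R :=
  inf [set x : R | exists (k : nat) (c : 'I_k -> K) (v : 'I_k -> 'I_n -> 'rV[K]_d),
    (forall w : n.-tuple 'I_d,
       xi w = \sum_(r < k) c r * \prod_(l < n) v r l 0 (tnth w l)) /\
    x = \sum_(r < k) abs (c r) * \prod_(l < n) enorm abs (v r l)].

Definition radius_of_convergence (R : realType) (K : numFieldType)
  (abs : K -> R) (d : nat) (xi : tseries d K) : \bar R :=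
  ereal_sup [set r%:E | r in [set r : R | 0 <= r /\
    cvgn (series (fun n => pnorm abs n xi * r ^+ n))]].

Definition simplex (R : realType) : set (R * R) :=
  [set st | 0 <= st.1 /\ st.1 <= st.2 /\ st.2 <= 1].

Definition level_pvar (R : realType) (K : numFieldType) (abs : K -> R)
  (d : nat) (p : R) (n : nat) (X : R -> R -> tseries d K) : \bar R :=
  ereal_sup [set (\sum_(0 <= l < size P)
      pnorm abs n (X (nth 1 (0 :: P) l) (nth 1 P l)) `^ (p / n%:R))%:E
    | P in [set P : seq R | itv_partition 0 1 P]].

(* Multiplicative functional of degree N with finite p-variation. *)
Definition mult_functional (R : realType) (K : numFieldType) (abs : K -> R)
  (d : nat) (p : R) (N : nat) (X : R -> R -> tseries d K) : Prop :=
  [/\ forall s t, simplex (s, t) -> X s t [::] = 1,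
      forall w, (size w <= N)%N ->
        {within @simplex R, continuous (fun st : R * R => X st.1 st.2 w : K^o)},
      forall s t u w, 0 <= s -> s <= t -> t <= u -> u <= 1 ->
        (size w <= N)%N -> X s u w = tmul (X s t) (X t u) w
    & (\sum_(1 <= n < N.+1) level_pvar abs p n X < +oo)%E].

Definition rough_path (R : realType) (K : numFieldType) (abs : K -> R)
  (d : nat) (p : R) (X : R -> R -> tseries d K) : Prop :=
  mult_functional abs p (Num.truncn p) X.

Definition weakly_geometric (R : realType) (K : numFieldType) (d : nat) (p : R)
  (X : R -> R -> tseries d K) : Prop :=
  forall s t, simplex (s, t) -> exists2 L, lie_poly L &
    forall w, (size w <= Num.truncn p)%N -> X s t w = texp L w.

Definition lyons_extension (R : realType) (K : numFieldType) (abs : K -> R)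
  (d : nat) (p : R) (X S : R -> R -> tseries d K) : Prop :=
  (forall N, mult_functional abs p N S) /\
  (forall s t w, simplex (s, t) -> (size w <= Num.truncn p)%N ->
     S s t w = X s t w).

Definition is_signature (R : realType) (K : numFieldType) (abs : K -> R)
  (d : nat) (p : R) (X : R -> R -> tseries d K) (g : tseries d K) : Prop :=
  exists2 S, lyons_extension abs p X S & g = S 0 1.

Definition first_level (R : realType) (d : nat) (X : R -> R -> tseries d R)
  (gamma : R -> 'rV[R]_d) : Prop :=
  forall s t i, simplex (s, t) -> X s t [:: i] = gamma t 0 i - gamma s 0 i.

(* List, with multiplicity, of the shuffles of two words. *)
Fixpoint shuffle (T : Type) (u : seq T) : seq T -> seq (seq T) :=
  if u is a :: u' then
    fix shuffle_u (v : seq T) : seq (seq T) :=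
      if v is b :: v' then
        map (cons a) (shuffle u' v) ++ map (cons b) (shuffle_u v')
      else [:: u]
  else fun v => [:: v].

(* Ordered shuffles of nonempty words w_1, ..., w_n: the shuffles in which the
   last letters of w_1, ..., w_n appear in this order. *)
Definition oshuffle (T : Type) (ws : seq (seq T)) : seq (seq T) :=
  foldl (fun acc w => if w is a :: w' then
           [seq rcons v (last a w') | v <- flatten
              [seq shuffle u (belast a w') | u <- acc]]
         else acc) [:: [::]] ws.

Fixpoint pderive (R : realType) (d : nat) (u : seq 'I_d.+1)
  (f : 'rV[R]_d.+1 -> R) : 'rV[R]_d.+1 -> R :=
  if u is i :: u' then pderive u' ('D_(delta_mx 0 i) f) else f.

Definition cpderive (R : realType) (d : nat) (u : seq 'I_d.+1)
  (f : 'rV[R]_d.+1 -> R[i]) : 'rV[R]_d.+1 -> R[i] := fun z =>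
  pderive u (fun z' => complex.Re (f z')) z +i*
  pderive u (fun z' => complex.Im (f z')) z.

(* F z i j is the j-th coordinate of F(z)(e_i), for a one-form
   F : R^d -> L(R^d, C^m). *)
Definition one_form (R : realType) (d m : nat) :=
  'rV[R]_d -> 'I_d -> 'I_m -> R[i].

(* The j-th coordinate of D^(k-1) F(z) on e_{i_1} (x) ... (x) e_{i_k}, where
   w = i_1 ... i_k; the last letter is the argument of the one-form. *)
Definition jet (R : realType) (d m : nat) (F : one_form R d.+1 m)
  (z : 'rV[R]_d.+1) (w : seq 'I_d.+1) (j : 'I_m) : R[i] :=
  if w is i :: w' then cpderive (belast i w') (fun z' => F z' (last i w') j) z
  else 0.

(* Lyons' almost multiplicative functional for the integral of F along X: its
   n-th level is
     sum over l_1, ..., l_n >= 1 with l_1 + ... + l_n <= [p] of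
     D^(l_1 - 1) F(gamma_s) (x) ... (x) D^(l_n - 1) F(gamma_s)
       applied to  sum_(pi in OS(l_1, ..., l_n)) pi^-1 X^(l_1 + ... + l_n)_(s,t)
   with OS the ordered shuffles. *)
Definition local_integral (R : realType) (d m : nat) (p : R)
  (X : R -> R -> tseries d.+1 R) (gamma : R -> 'rV[R]_d.+1)
  (F : one_form R d.+1 m) (s t : R) : tseries m R[i] :=
  fun js => \sum_(ws : (size js).-tuple ((Num.truncn p).-bseq 'I_d.+1) |
                 all (fun w => 0 < size w)%N (map val ws) &&
                 (sumn (map size (map val ws)) <= Num.truncn p)%N)
    (\prod_(wj <- zip (map val ws) js) jet F (gamma s) wj.1 wj.2) *
    (\sum_(w <- oshuffle (map val ws)) X s t w)%:C.

Definition control (R : realType) (omega : R -> R -> R) : Prop :=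
  [/\ forall s t, simplex (s, t) -> 0 <= omega s t,
      {within @simplex R, continuous (fun st : R * R => omega st.1 st.2)}
    & forall s t u, 0 <= s -> s <= t -> t <= u -> u <= 1 ->
        omega s t + omega t u <= omega s u].

(* B is the rough path integral of F along X: the unique p-rough path close to
   the almost multiplicative functional above. *)
Definition is_rough_integral (R : realType) (d m : nat) (p : R)
  (X : R -> R -> tseries d.+1 R) (gamma : R -> 'rV[R]_d.+1)
  (F : one_form R d.+1 m) (B : R -> R -> tseries m R[i]) : Prop :=
  rough_path (@cabs R) p B /\
  exists omega theta, [/\ control omega, 1 < theta &
    forall n s t, (0 < n <= Num.truncn p)%N -> simplex (s, t) ->
      pnorm (@cabs R) n
        (tlin (-1) (local_integral p X gamma F s t) (B s t))
      <= omega s t `^ theta].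

Definition cexp (R : realType) (z : R[i]) : R[i] :=
  (expR (complex.Re z))%:C * (cos (complex.Im z) +i* sin (complex.Im z)).

(* The one-form sum_j e^{a_j x} dy e_j on R^2. *)
Definition exp_form (R : realType) (m : nat) (a : 'I_m -> R[i]) :
  one_form R 2 m :=
  fun z i j => if i == 1 then cexp (a j * (z 0 0)%:C) else 0.

(* c = S_m^gamma(a_1, ..., a_m). Tensors over C^m are complex tensors. *)
Definition is_S_coef (R : realType) (p : R) (X : R -> R -> tseries 2 R)
  (gamma : R -> 'rV[R]_2) (m : nat) (a : 'I_m -> R[i]) (c : R[i]) : Prop :=
  exists B SB, [/\ is_rough_integral p X gamma (exp_form a) B,
    is_signature (@cabs R) p B SB & c = tlog SB (enum 'I_m)].

Definition non_degenerate (R : realType) (m : nat) (a : 'I_m -> R[i]) : Prop :=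
  forall j k : 'I_m, (j <= k)%N ->
    \sum_(i < m | (j <= i)%N && (i <= k)%N) a i != 0.

(* Main.v *)
(* Take the representation of the tensor algebra on C^(m+1) sending e_1 to the
   diagonal matrix D with entries d_j = -(a_1 + ... + a_j) and e_2 to the shift N
   with entries 1 above the diagonal.  Let M(s, t) be the image of S(X)_{s,t}.
   The matrices e^{D x_s} M(s, t) e^{-D x_t} are unitriangular and multiplicative
   in (s, t), and by the shuffle relations their entries agree, up to a summable
   error, with Lyons' local approximations of the integrals of e^{a_j x} dy; hence
   their entry (j, k) is the coefficient of S(B)_{s,t} on e_{j+1} ... e_k.
   If the logarithmic signature has infinite radius of convergence, it has an
   image L, which commutes with M(0, 1).  The diagonal of L is (d_j), whose
   entries are distinct by non-degeneracy, while M(0, 1) is upper triangular with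
   diagonal e^{d_j} = 1; so M(0, 1) = 1.  Therefore S(B) vanishes on all words
   e_{j+1} ... e_k, and so does its logarithm on e_1 ... e_m.
   The series M(s, t) converges because the levels of the Lyons extension decay
   faster than any geometric sequence; this follows from dyadic subdivisions after
   a time change that turns the p-variation bounds into 1/p-Hoelder bounds. *)
Require Import Defs.
From mathcomp Require Import all_boot all_order all_algebra.
From mathcomp Require Import all_classical all_reals all_analysis.
From mathcomp Require Import ring lra.

Set Implicit Arguments.
Unset Strict Implicit.
Unset Printing Implicit Defensive.

Import Order.TTheory GRing.Theory Num.Theory.
Import numFieldNormedType.Exports.

Local Open Scope classical_set_scope.
Local Open Scope ring_scope.
Local Open Scope complex_scope.

(** * Tensor series, words and shuffles *)

Arguments tpow : simpl never.

(** Matrices are indexed by the row j and the distance r to the diagonal, so triangularity is built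
    in and the comparisons are inductions on r. Group-likeness is given only up to level P = [p];
    the shuffle relations are not extended to higher levels, except on the words e_1^n. This
    suffices, because the conjugated matrices and the local integrals need to agree only up to
    errors whose sums over dyadic subdivisions tend to 0. The uniqueness principle behind this is
    [additive_eq0]: two multiplicative families that agree on the lower off-diagonals differ on the
    next one by an additive function, and an additive function whose dyadic sums tend to 0 is zero.
    It identifies S(B) from its local approximations alone. The dyadic estimates need a bound that
    halves with the interval, which p-variation does not give; hence the time change. Since the a_j
    are imaginary, the factors e^(d_j x) have modulus 1 and preserve all error bounds. *)

Definition lquot (d : nat) (T : Type) (i : 'I_d) (a : tseries d T) :
  tseries d T := fun w => a (i :: w).

Section TensorSeries.
Variables (d : nat) (K : numFieldType).
Implicit Types (a b c : tseries d K) (w : seq 'I_d) (i l : 'I_d).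

Definition tscale (x : K) a : tseries d K := fun w => x * a w.

Definition tadd a b : tseries d K := fun w => a w + b w.

Lemma tlinE x a b : tlin x a b = tadd (tscale x a) b.
Proof. by []. Qed.

Lemma tmul_nil a b : tmul a b [::] = a [::] * b [::].
Proof. by rewrite /tmul big_ord1. Qed.

Lemma tmul_cons a b i w :
  tmul a b (i :: w) = a [::] * b (i :: w) + tmul (lquot i a) b w.
Proof. by rewrite /tmul big_ord_recl. Qed.

Lemma tmulDl a b c : tmul (tadd a b) c = tadd (tmul a c) (tmul b c).
Proof.
apply/funext => w; rewrite /tadd /tmul -big_split /=.
by apply: eq_bigr => k _; rewrite mulrDl.
Qed.

Lemma tmulDr a b c : tmul a (tadd b c) = tadd (tmul a b) (tmul a c).
Proof.
apply/funext => w; rewrite /tadd /tmul -big_split /=.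
by apply: eq_bigr => k _; rewrite mulrDr.
Qed.

Lemma tmulZl x a b : tmul (tscale x a) b = tscale x (tmul a b).
Proof.
apply/funext => w; rewrite /tscale /tmul mulr_sumr.
by apply: eq_bigr => k _; rewrite mulrA.
Qed.

Lemma tmulZr x a b : tmul a (tscale x b) = tscale x (tmul a b).
Proof.
apply/funext => w; rewrite /tscale /tmul mulr_sumr.
by apply: eq_bigr => k _; rewrite mulrCA.
Qed.

Lemma tmul1l a : tmul (@tone d K) a = a.
Proof.
apply/funext; case=> [|i w]; first by rewrite tmul_nil mul1r.
rewrite tmul_cons mul1r /tmul big1 ?addr0 // => k _.
by rewrite /lquot /= mul0r.
Qed.

Lemma tmul1r a : tmul a (@tone d K) = a.
Proof.
apply/funext=> w; elim: w a => [|i w IH] a; first by rewrite tmul_nil mulr1.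
by rewrite tmul_cons /= mulr0 add0r IH.
Qed.

Lemma lquot_mul i a b :
  lquot i (tmul a b) = tadd (tscale (a [::]) (lquot i b)) (tmul (lquot i a) b).
Proof. by apply/funext => w; rewrite /lquot tmul_cons. Qed.

Lemma tmulA a b c : tmul a (tmul b c) = tmul (tmul a b) c.
Proof.
apply/funext => w; elim: w a b => [|i w IH] a b.
  by rewrite !tmul_nil mulrA.
rewrite !tmul_cons lquot_mul tmulDl tmulZl /tadd /tscale IH tmul_nil.
by rewrite mulrDr addrA mulrA.
Qed.

Lemma tpowS a n : tpow a n.+1 = tmul a (tpow a n).
Proof. by []. Qed.

Lemma tpowSr a n : tpow a n.+1 = tmul (tpow a n) a.
Proof.
elim: n => [|n IH]; first by rewrite tpowS /tpow /= tmul1l tmul1r.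
by rewrite tpowS {1}IH tmulA -tpowS.
Qed.

Lemma tpow_small a n w : a [::] = 0 -> (size w < n)%N -> tpow a n w = 0.
Proof.
move=> a0; elim: n w => [|n IH] w //; rewrite ltnS => le_wn.
rewrite tpowS /tmul big1 // => -[k /= lt_k] _.
case: k lt_k => [|k] lt_k; first by rewrite take0 a0 mul0r.
rewrite IH ?mulr0 // size_drop; move: lt_k le_wn; rewrite ltnS.
by case: (size w) => // s _; rewrite subSS; apply: leq_ltn_trans; exact: leq_subr.
Qed.

End TensorSeries.

Lemma sum_ends (V : zmodType) (F : nat -> V) n :
  \sum_(i < n.+2) F i = F 0%N + \sum_(i < n) F i.+1 + F n.+1.
Proof. by rewrite big_ord_recl big_ord_recr /= addrA. Qed.

Section WordSums.
Variables (d : nat) (V : zmodType).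

(** Recursion on the first letter makes splitting off letters definitional; [wsum_tuple] returns to
    sums over tuples. *)
Fixpoint wsum n (F : seq 'I_d -> V) : V :=
  if n is n'.+1 then \sum_i wsum n' (fun w => F (i :: w)) else F [::].

Lemma eq_wsum n F G : (forall w, size w = n -> F w = G w) ->
  wsum n F = wsum n G.
Proof.
elim: n F G => [|n IH] F G eqFG /=; first exact: eqFG.
by apply: eq_bigr => i _; apply: IH => w sw; rewrite eqFG //= sw.
Qed.

Lemma wsum_cat k n F :
  wsum (k + n) F = wsum k (fun u => wsum n (fun v => F (u ++ v))).
Proof. by elim: k F => [|k IH] F //=; apply: eq_bigr => i _; rewrite IH. Qed.

Lemma wsumD n F G : wsum n (fun w => F w + G w) = wsum n F + wsum n G.
Proof.
by elim: n F G => [|n IH] F G //=; rewrite -big_split /=; apply: eq_bigr => i _.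
Qed.

Lemma wsum0 n : wsum n (fun=> 0) = 0.
Proof. by elim: n => [|n IH] //=; rewrite big1. Qed.

Lemma wsum_sum n (I : Type) (r : seq I) (P : pred I) (F : I -> seq 'I_d -> V) :
  wsum n (fun w => \sum_(i <- r | P i) F i w) = \sum_(i <- r | P i) wsum n (F i).
Proof.
elim: n F => [|n IH] F //=; rewrite exchange_big /=.
by apply: eq_bigr => j _; rewrite IH.
Qed.

Lemma wsum_tuple n F : wsum n F = \sum_(w : n.-tuple 'I_d) F w.
Proof.
elim: n F => [|n IH] F /=.
  rewrite (big_pred1 [tuple]) // => w; apply/esym/eqP; exact: tuple0.
under eq_bigr do rewrite IH.
rewrite pair_big /= (reindex (fun p : 'I_d * n.-tuple 'I_d => [tuple of p.1 :: p.2])) //=.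
exists (fun w => (thead w, [tuple of behead w])) => [[i w] _ | w _] /=.
  by congr pair; apply: val_inj.
by rewrite [RHS]tuple_eta; apply: val_inj.
Qed.

End WordSums.

Section WordSumsRing.
Variables (d : nat) (K : numFieldType).
Implicit Types (F G : seq 'I_d -> K).

Lemma wsumZ n (x : K) F : wsum n (fun w => x * F w) = x * wsum n F.
Proof.
by elim: n F => [|n IH] F //=; rewrite mulr_sumr; apply: eq_bigr => i _.
Qed.

Lemma wsumZr n (x : K) F : wsum n (fun w => F w * x) = wsum n F * x.
Proof. by rewrite mulrC -wsumZ; apply: eq_wsum => w _; rewrite mulrC. Qed.

(** Summing over words and a cutting point is summing over pairs of words; G k records how the
    weight H splits at the cut. *)
Lemma wsum_tmul n (G : nat -> seq 'I_d -> seq 'I_d -> K) (a b : tseries d K)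
    (H : seq 'I_d -> K) :
  (forall k w, (k <= n)%N -> size w = n ->
     H w = G k (take k w) (drop k w)) ->
  wsum n (fun w => H w * tmul a b w) =
  \sum_(k < n.+1) wsum k (fun u => wsum (n - k) (fun v => G k u v * (a u * b v))).
Proof.
move=> HG; transitivity (wsum n (fun w => \sum_(k < n.+1)
    G k (take k w) (drop k w) * (a (take k w) * b (drop k w)))).
  apply: eq_wsum => w sw; rewrite /tmul mulr_sumr sw; apply: eq_bigr => k _.
  by rewrite -HG // -ltnS.
rewrite wsum_sum; apply: eq_bigr => k _.
have kn : (k <= n)%N by rewrite -ltnS.
rewrite -{1}(subnKC kn) wsum_cat; apply: eq_wsum => u su; apply: eq_wsum => v _.
by rewrite take_size_cat // drop_size_cat.
Qed.

End WordSumsRing.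

(** * Shuffles with the powers of one letter *)

Section Shuffles.
Variables (d : nat) (K : numFieldType) (l : 'I_d).
Implicit Types (F : tseries d K).

(** The pairing of F with the shuffle of w and the word l^n. *)
Definition shsum n F : tseries d K :=
  fun w => \sum_(v <- shuffle w (nseq n l)) F v.

Lemma shsum_nil n F : shsum n F [::] = F (nseq n l).
Proof. by rewrite /shsum big_seq1. Qed.

Lemma shsum0 F : shsum 0 F = F.
Proof. by apply/funext => -[|i w]; rewrite /shsum big_seq1. Qed.

Lemma shsumS_cons n F i w :
  shsum n.+1 F (i :: w) = shsum n.+1 (lquot i F) w + shsum n (lquot l F) (i :: w).
Proof. by rewrite /shsum /= big_cat !big_map. Qed.

Lemma shsum_cons n F i w :
  shsum n F (i :: w) = shsum n (lquot i F) w +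
    (if n is n'.+1 then shsum n' (lquot l F) (i :: w) else 0).
Proof.
by case: n => [|n]; rewrite ?shsumS_cons // !shsum0 addr0.
Qed.

Lemma shsumD n F G : shsum n (tadd F G) = tadd (shsum n F) (shsum n G).
Proof. by apply/funext => w; rewrite /tadd /shsum big_split. Qed.

Lemma shsumZ n x F : shsum n (tscale x F) = tscale x (shsum n F).
Proof. by apply/funext => w; rewrite /tscale /shsum mulr_sumr. Qed.

Fixpoint ins_rec (w : seq 'I_d) F : K :=
  F (l :: w) + if w is i :: w' then ins_rec w' (lquot i F) else 0.

(* A derivation of the tensor product (ins_mul), dual to the shuffle product with
   the letter l. *)
Definition ins F : tseries d K := fun w => ins_rec w F.

Arguments ins : simpl never.

Lemma ins_nil F : ins F [::] = F [:: l].
Proof. by rewrite /ins /= addr0. Qed.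

Lemma ins_cons F i w : ins F (i :: w) = F [:: l, i & w] + ins (lquot i F) w.
Proof. by []. Qed.

Lemma lquot_ins F i : lquot i (ins F) = tadd (lquot i (lquot l F)) (ins (lquot i F)).
Proof. by []. Qed.

Lemma insD F G : ins (tadd F G) = tadd (ins F) (ins G).
Proof.
apply/funext => w; elim: w F G => [|i w IH] F G; first by rewrite /tadd !ins_nil.
rewrite /tadd !ins_cons addrACA; congr (_ + _).
exact: (IH (lquot i F) (lquot i G)).
Qed.

Lemma insZ x F : ins (tscale x F) = tscale x (ins F).
Proof.
apply/funext => w; elim: w F => [|i w IH] F; first by rewrite /tscale !ins_nil.
rewrite /tscale !ins_cons mulrDr; congr (_ + _).
exact: (IH (lquot i F)).
Qed.

Lemma ins_sum (I : Type) (r : seq I) (P : pred I) (F : I -> tseries d K) w :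
  ins (fun w => \sum_(i <- r | P i) F i w) w = \sum_(i <- r | P i) ins (F i) w.
Proof.
elim: w F => [|j w IH] F; first by rewrite !ins_nil; apply: eq_bigr => i _; rewrite ins_nil.
rewrite ins_cons (IH (fun i => lquot j (F i))) -big_split /=.
by apply: eq_bigr => i _; rewrite ins_cons.
Qed.

Lemma eq_ins F G w : (forall u, size u = (size w).+1 -> F u = G u) ->
  ins F w = ins G w.
Proof.
elim: w F G => [|j w IH] F G eqFG; first by rewrite !ins_nil; apply: eqFG.
rewrite !ins_cons eqFG //=; congr (_ + _).
by apply: IH => u su; rewrite /lquot eqFG //= su.
Qed.

Lemma ins_one : ins (@tone d K) = fun=> 0.
Proof.
apply/funext => w; elim: w => [|i w IH]; first by rewrite ins_nil.
rewrite ins_cons add0r; move: IH.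
have -> : lquot i (@tone d K) = fun=> 0 by [].
move=> _; elim: w => [|j w IH]; first by rewrite ins_nil.
by rewrite ins_cons add0r.
Qed.

Lemma ins_mul a b : ins (tmul a b) = tadd (tmul (ins a) b) (tmul a (ins b)).
Proof.
apply/funext => w; elim: w a b => [|i w IH] a b.
  rewrite /tadd ins_nil tmul_cons !tmul_nil !ins_nil.
  by rewrite addrC.
rewrite ins_cons lquot_mul insD insZ /tadd /tscale IH /tadd.
rewrite !tmul_cons ins_nil lquot_ins tmulDl /tadd.
rewrite ins_cons /lquot.
ring.
Qed.

(** The shuffle of l with l^n is n + 1 times the word l^(n+1), and the shuffle product is
    associative: inserting l into the shuffles of w with l^n meets each shuffle of w with l^(n+1)
    exactly n + 1 times. *)
Lemma shsum_ins n F w : n.+1%:R * shsum n.+1 F w = shsum n (ins F) w.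
Proof.
elim: w n F => [|i w IHw] n F.
  rewrite !shsum_nil; elim: n F => [|n IHn] F; first by rewrite mul1r ins_nil.
  have := IHn (lquot l F); rewrite /lquot => {}IHn.
  transitivity (ins F (l :: nseq n l)); last by [].
  by rewrite ins_cons -IHn -[n.+2]add1n natrD mulrDl mul1r.
elim: n F => [|n IHn] F.
  by rewrite mul1r shsumS_cons !shsum0 ins_cons -[ins (lquot i F)]shsum0 -IHw mul1r addrC.
have E : n.+2%:R = n.+1%:R + 1 :> K by rewrite natr1.
rewrite shsumS_cons mulrDr IHw E mulrDl mul1r IHn.
rewrite [RHS]shsumS_cons !lquot_ins !shsumD /tadd [shsum n.+1 (lquot l F) _]shsumS_cons.
ring.
Qed.

End Shuffles.

Arguments ins : simpl never.

Section LiePolynomials.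
Variables (d : nat) (K : numFieldType) (l : 'I_d).
Implicit Types (L : tseries d K).

Lemma lie_nil L : lie_poly L -> L [::] = 0.
Proof.
elim=> [i|c a b _ a0 _ b0|a b _ a0 _ b0] //=.
  by rewrite /tlin a0 b0 mulr0 addr0.
by rewrite /tlin !tmul_nil a0 b0 !mulr0 addr0.
Qed.

Lemma ins_zero : ins l (fun=> 0 : K) = fun=> 0.
Proof.
apply/funext => w; elim: w => [|i w IH]; first by rewrite ins_nil.
by rewrite ins_cons add0r; apply: IH.
Qed.

(** The derivation [ins l] takes scalar values on letters. Scalars are central, so it kills
    brackets: Lie polynomials are orthogonal to proper shuffles with a letter. *)
Lemma ins_lie L : lie_poly L -> ins l L = tscale (L [:: l]) (@tone d K).
Proof.
elim=> [i|c a b _ IHa _ IHb|a b la IHa lb IHb].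
- apply/funext => -[|j w]; first by rewrite ins_nil /tscale mulr1.
  rewrite ins_cons /tscale /= mulr0 /tletter eqseq_cons /= andbF add0r.
  case: (i =P j) => [<-|/eqP/negPf ij].
    have -> : lquot i (@tletter d K i) = @tone d K.
      by apply/funext => -[|k u]; rewrite /lquot /tletter eqseq_cons eqxx.
    by rewrite ins_one.
  have -> : lquot j (@tletter d K i) = fun=> 0.
    by apply/funext => u; rewrite /lquot /tletter eqseq_cons eq_sym ij.
  by rewrite ins_zero.
- rewrite tlinE insD insZ IHa IHb; apply/funext => w.
  by rewrite /tadd /tscale /tlin mulrDl mulrA.
rewrite tlinE insD insZ !ins_mul IHa IHb; apply/funext => w.
rewrite !tmulZl !tmulZr tmul1l !tmul1r tmul1l /tadd /tscale !tmul_cons.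
rewrite /tmul !big_ord1 /= /lquot !(lie_nil la) !(lie_nil lb).
ring.
Qed.

Lemma ins_tpow L n : lie_poly L ->
  ins l (tpow L n) = tscale (n%:R * L [:: l]) (tpow L n.-1).
Proof.
move=> lL; elim: n => [|n IH].
  by rewrite /tpow /= ins_one; apply/funext => w; rewrite /tscale !mul0r.
rewrite tpowS ins_mul IH ins_lie // tmulZr tmulZl tmul1l /=.
apply/funext => w; rewrite /tadd /tscale.
case: n {IH} => [|n]; first by rewrite !mul0r addr0 mul1r.
by rewrite -tpowS /= -addn1 [(n.+1 + 1)%:R]natrD; ring.
Qed.

Lemma ins_texp L : lie_poly L ->
  ins l (texp L) = tscale (L [:: l]) (texp L).
Proof.
move=> lL; apply/funext => w; rewrite /tscale /texp.
pose F (n : nat) : tseries d K := tscale (n`!%:R^-1) (tpow L n).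
(* [ins] evaluates its argument on words one letter longer, so the exponential is summed one term
   further. *)
transitivity (ins l (fun u => \sum_(0 <= n < (size w).+2) F n u) w).
  by apply: eq_ins => u ->.
rewrite ins_sum big_nat_recl //= /F insZ ins_tpow // /tscale !mul0r mulr0 add0r.
rewrite mulr_sumr; apply: eq_bigr => n _.
rewrite insZ ins_tpow // /tscale /= factS natrM invfM.
have [x0 y0] : n.+1%:R != 0 :> K /\ n`!%:R != 0 :> K.
  by split; rewrite pnatr_eq0 // -lt0n fact_gt0.
by move: n.+1%:R n`!%:R x0 y0 => x y x0 y0; field; rewrite x0 y0.
Qed.

Lemma texp_nil L : texp L [::] = 1.
Proof. by rewrite /texp big_nat1 /= fact0 invr1 mulr1. Qed.

Lemma texp1 L : L [::] = 0 -> texp L [:: l] = L [:: l].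
Proof.
move=> L0; rewrite /texp big_nat_recl // big_nat1 /= mulr0 add0r invr1 mul1r.
by rewrite /tpow /= tmul1r.
Qed.

(** The shuffle relation of a group-like element between an arbitrary word and l^n, obtained by
    iterating [ins_texp]. *)
Lemma shsum_texp L n : lie_poly L ->
  shsum l n (texp L) = tscale ((L [:: l]) ^+ n / n`!%:R) (texp L).
Proof.
move=> lL; elim: n => [|n IH].
  by rewrite shsum0; apply/funext => w; rewrite /tscale expr0 fact0 invr1 !mul1r.
apply/funext => w.
have n0 : n.+1%:R != 0 :> K by rewrite pnatr_eq0.
apply: (mulfI n0); rewrite shsum_ins ins_texp // shsumZ IH /tscale.
rewrite factS natrM invfM exprS.
have y0 : n`!%:R != 0 :> K by rewrite pnatr_eq0 -lt0n fact_gt0.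
by move: n.+1%:R n`!%:R n0 y0 => x y x0 y0; field; rewrite x0 y0.
Qed.

Lemma texp_nseq L n : lie_poly L ->
  texp L (nseq n l) = (texp L [:: l]) ^+ n / n`!%:R.
Proof.
move=> lL; rewrite -shsum_nil shsum_texp // /tscale texp_nil mulr1 texp1 //.
exact: lie_nil.
Qed.

End LiePolynomials.

(** * The triangular representation and shifts of its diagonal *)

Section Weights.
Variable K : numFieldType.
Implicit Types (dg : nat -> K) (F : tseries 2 K).

(* Entry (j, j + r) of the image of a word under the representation sending the
   first letter to the diagonal matrix dg and the second one to the shift
   (entries 1 above the diagonal). *)
Fixpoint psi dg (j r : nat) (w : seq 'I_2) : K :=
  if w is i :: w' then
    if i == 0 then dg j * psi dg j r w'
    else if r is r'.+1 then psi dg j.+1 r' w' else 0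
  else (r == 0%N)%:R.

Lemma sum2 (V : zmodType) (F : 'I_2 -> V) : \sum_i F i = F 0 + F 1.
Proof.
rewrite big_ord_recl big_ord1; congr (F _ + F _); exact: val_inj.
Qed.

(** Multiplication of upper triangular matrices, in the coordinates row and distance to the
    diagonal. *)
Lemma psi_cat dg j r u v :
  psi dg j r (u ++ v) =
  \sum_(i < r.+1) psi dg j i u * psi dg (j + i) (r - i) v.
Proof.
elim: u j r => [|x u IH] j r /=.
  rewrite big_ord_recl /= mul1r addn0 subn0 big1 ?addr0 // => i _.
  by rewrite /= mul0r.
case: ifP => x0.
  by rewrite IH mulr_sumr; apply: eq_bigr => i _; rewrite mulrA.
case: r => [|r]; first by rewrite big_ord1 /= mul0r.
rewrite IH [RHS]big_ord_recl mul0r add0r; apply: eq_bigr => i _.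
by rewrite /= /bump add1n subSS addSnnS.
Qed.

Lemma psi_gt_size dg j r w : (size w < r)%N -> psi dg j r w = 0.
Proof.
elim: w j r => [|x w IH] j [|r] //= wr.
case: ifP => _; first by rewrite IH ?mulr0 // ltnW.
by rewrite IH.
Qed.

Lemma psi_cons0 dg j r w : psi dg j r (0 :: w) = dg j * psi dg j r w.
Proof. by []. Qed.

Lemma psi_cons1 dg j r w :
  psi dg j r (1 :: w) = if r is r'.+1 then psi dg j.+1 r' w else 0.
Proof. by []. Qed.

Lemma wsumS (V : zmodType) n (F : seq 'I_2 -> V) :
  wsum n.+1 F = wsum n (lquot 0 F) + wsum n (lquot 1 F).
Proof. by rewrite /= sum2. Qed.

Lemma wsum_psi0 dg j n F :
  wsum n (fun w => psi dg j 0 w * F w) = dg j ^+ n * F (nseq n 0).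
Proof.
elim: n F => [|n IH] F //; rewrite wsumS.
have -> : lquot 1 (fun w => psi dg j 0 w * F w) = fun=> 0.
  by apply/funext => w; rewrite /lquot psi_cons1 mul0r.
rewrite wsum0 addr0 exprS -mulrA.
rewrite -(IH (lquot 0 F)) -wsumZ; apply: eq_wsum => w _.
by rewrite /lquot psi_cons0 mulrA.
Qed.

Definition dshift dg (c : K) : nat -> K := fun j => dg j + c.

(** Expand each factor dg + c carried by a letter 0. The n letters for which c is chosen form the
    word 0^n, the other letters form a word weighted by dg, and the original word is a shuffle of
    the two. *)
Lemma psi_shift dg c j r N F :
  wsum N (fun w => psi (dshift dg c) j r w * F w) =
  \sum_(n < N.+1) c ^+ n * wsum (N - n) (fun w => psi dg j r w * shsum 0 n F w).
Proof.
elim: N j r F => [|N IH] j r F.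
  by rewrite big_ord1 /= expr0 mul1r shsum0.
(* The shuffles are sorted by their first letter: a 0 of the weighted word gives the factor dg j, a
   1 gives P1, and a 0 of the word 0^n gives P2. *)
pose P1 (n : nat) : K := if r is r'.+1 then
     wsum (N - n) (fun w => psi dg j.+1 r' w * shsum 0 n (lquot 1 F) w) else 0.
pose P2 (n : nat) : K := if n is n'.+1 then
     wsum (N - n') (fun w => psi dg j r w * shsum 0 n' (lquot 0 F) w) else 0.
have E n : (n <= N)%N ->
  wsum (N.+1 - n) (fun w => psi dg j r w * shsum 0 n F w) =
  dg j * wsum (N - n) (fun w => psi dg j r w * shsum 0 n (lquot 0 F) w) +
  P1 n + P2 n.
  move=> nN; rewrite subSn // wsumS.
  have -> : lquot 0 (fun w => psi dg j r w * shsum 0 n F w) =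
     (fun w => dg j * (psi dg j r w * shsum 0 n (lquot 0 F) w) +
       psi dg j r (0 :: w) *
        (if n is n'.+1 then shsum 0 n' (lquot 0 F) (0 :: w) else 0)).
    by apply/funext => w; rewrite /lquot shsum_cons mulrDr psi_cons0 !mulrA.
  have -> : lquot 1 (fun w => psi dg j r w * shsum 0 n F w) =
     (fun w => psi dg j r (1 :: w) * shsum 0 n (lquot 1 F) w +
       psi dg j r (1 :: w) *
        (if n is n'.+1 then shsum 0 n' (lquot 0 F) (1 :: w) else 0)).
    by apply/funext => w; rewrite /lquot shsum_cons mulrDr.
  rewrite !wsumD wsumZ addrACA; congr (_ + _ + _).
    rewrite /P1; case: (r) => [|r']; last by [].
    by under eq_wsum do rewrite psi_cons1 mul0r; exact: wsum0.
  case: n nN => [|n] nN; rewrite /P2.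
    by rewrite -wsumD -[RHS](@wsum0 2 _ (N - 0)); apply: eq_wsum => w _; rewrite !mulr0 addr0.
  by rewrite -(subnSK nN) wsumS.
have E1 : \sum_(n < N.+1) c ^+ n * P1 n = wsum N (lquot 1 (fun w =>
    psi (dshift dg c) j r w * F w)).
  rewrite /P1; case: (r) => [|r'].
    rewrite big1 => [|n _]; last by rewrite mulr0.
    by rewrite -[LHS](@wsum0 2 _ N); apply: eq_wsum => w _; rewrite /lquot psi_cons1 mul0r.
  by rewrite -(IH j.+1 r' (lquot 1 F)).
have E2 : \sum_(n < N.+2) c ^+ n * P2 n =
    c * wsum N (fun w => psi (dshift dg c) j r w * lquot 0 F w).
  rewrite IH big_ord_recl mulr0 add0r mulr_sumr.
  by apply: eq_bigr => n _; rewrite /= exprS mulrA.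
have E3 : P2 N.+1 = psi dg j r [::] * F (nseq N.+1 0).
  by rewrite /P2 subnn /= shsum_nil.
clearbody P1 P2; rewrite wsumS -E1.
have -> : wsum N (lquot 0 (fun w => psi (dshift dg c) j r w * F w)) =
   dg j * wsum N (fun w => psi (dshift dg c) j r w * lquot 0 F w) +
   c * wsum N (fun w => psi (dshift dg c) j r w * lquot 0 F w).
  rewrite -mulrDl -wsumZ; apply: eq_wsum => w _.
  by rewrite /lquot psi_cons0 mulrA.
rewrite -E2 IH [X in _ + X + _]big_ord_recr [RHS]big_ord_recr /=.
rewrite subnn E3 /= shsum_nil.
under [in RHS]eq_bigr => n _ do rewrite E -1?ltnS // !mulrDr.
rewrite !big_split /= mulr_sumr.
under [X in X + _ + _ = _]eq_bigr => n _ do rewrite mulrCA.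
by ring.
Qed.

End Weights.

Section Levels.
Variable K : numFieldType.
Implicit Types (dg : nat -> K) (a b F : tseries 2 K).

(** The part of degree n of the entry (j, j + r) of the image of [a]. The entry itself is the sum
    over n, when this converges. *)
Definition lev dg j r n a : K := wsum n (fun w => psi dg j r w * a w).

Lemma lev_tmul dg j r n a b :
  lev dg j r n (tmul a b) = \sum_(k < n.+1) \sum_(i < r.+1)
    lev dg j i k a * lev dg (j + i) (r - i) (n - k) b.
Proof.
rewrite /lev (@wsum_tmul _ _ _ (fun k u v => \sum_(i < r.+1)
   psi dg j i u * psi dg (j + i) (r - i) v)); last first.
  by move=> k w _ _; rewrite -psi_cat cat_take_drop.
apply: eq_bigr => k _.
under eq_wsum => u _.
  rewrite (_ : wsum _ _ = \sum_(i < r.+1) psi dg j i u * a u *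
     wsum (n - k) (fun v => psi dg (j + i) (r - i) v * b v)); last first.
    under [RHS]eq_bigr do rewrite -wsumZ.
    rewrite -wsum_sum; apply: eq_wsum => v _; rewrite mulr_suml.
    by apply: eq_bigr => i _; ring.
  over.
by rewrite wsum_sum; apply: eq_bigr => i _; rewrite wsumZr.
Qed.

Lemma lev0 dg j n a : lev dg j 0 n a = dg j ^+ n * a (nseq n 0).
Proof. exact: wsum_psi0. Qed.

Lemma lev_small dg j r n a : (n < r)%N -> lev dg j r n a = 0.
Proof.
move=> nr; rewrite /lev -[RHS](@wsum0 2 _ n); apply: eq_wsum => w sw.
by rewrite psi_gt_size ?mul0r ?sw.
Qed.

Lemma eq_lev dg dg' j r n a b : dg =1 dg' ->
  (forall w, size w = n -> a w = b w) -> lev dg j r n a = lev dg' j r n b.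
Proof.
move=> /funext -> ab; apply: eq_wsum => w sw; by rewrite ab.
Qed.

Lemma lev_shift dg c j r N a :
  lev (dshift dg c) j r N a =
  \sum_(n < N.+1) c ^+ n * lev dg j r (N - n) (shsum 0 n a).
Proof. exact: psi_shift. Qed.

Lemma psi_rcons0 dg j r w :
  psi dg j r (rcons w 0) = psi dg j r w * dg (j + r)%N.
Proof.
rewrite -cats1 psi_cat big_ord_recr /= subnn eqxx mulr1 big1 ?add0r // => i _.
by rewrite subn_eq0 leqNgt ltn_ord !mulr0.
Qed.

Lemma psi_rcons1 dg j r w :
  psi dg j r (rcons w 1) = if r is r'.+1 then psi dg j r' w else 0.
Proof.
rewrite -cats1 psi_cat big_ord_recr /= subnn mulr0 addr0.
case: r => [|r]; first by rewrite big_ord0.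
rewrite big_ord_recr /= subSnn mulr1 big1 ?add0r // => i _ /=.
by rewrite subSn ?(ltnW (ltn_ord i)) //= subn_eq0 leqNgt ltn_ord mulr0.
Qed.

Lemma wsumSr (V : zmodType) n (F : seq 'I_2 -> V) :
  wsum n.+1 F = wsum n (fun w => F (rcons w 0)) + wsum n (fun w => F (rcons w 1)).
Proof.
rewrite -[n.+1]addn1 wsum_cat -wsumD; apply: eq_wsum => w _.
by rewrite /= sum2 !cats1.
Qed.

(** A word ending in 0 carries the factor dg (j + r). Where that vanishes only words ending in 1
    remain, as in the ordered shuffles for integrals against dy. *)
Lemma lev_rcons dg j r n F : dg (j + r)%N = 0 ->
  lev dg j r n.+1 F =
  if r is r'.+1 then lev dg j r' n (fun w => F (rcons w 1)) else 0.
Proof.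
move=> d0; rewrite /lev wsumSr.
rewrite (_ : wsum _ _ = 0) ?add0r; last first.
  rewrite -[RHS](@wsum0 2 _ n); apply: eq_wsum => w _.
  by rewrite psi_rcons0 d0 mulr0 mul0r.
case: r d0 => [|r] d0; last by apply: eq_wsum => w _; rewrite psi_rcons1.
by rewrite -[RHS](@wsum0 2 _ n); apply: eq_wsum => w _; rewrite psi_rcons1 mul0r.
Qed.

Lemma sum_triangle N (G : nat -> nat -> K) :
  \sum_(n < N) \sum_(k < n.+1) G k (n - k)%N = \sum_(k < N) \sum_(l < N - k) G k l.
Proof.
elim: N => [|N IH]; first by rewrite !big_ord0.
rewrite big_ord_recr /= IH [RHS]big_ord_recr /= subSnn big_ord1.
rewrite big_ord_recr /= subnn addrA; congr (_ + _).
rewrite -big_split /=; apply: eq_bigr => k _.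
by rewrite subSn ?(ltnW (ltn_ord k)) // big_ord_recr.
Qed.

End Levels.

(** * The logarithm: commutation, and its values on powers of a letter *)

Section Logarithm.
Variables (d : nat) (K : numFieldType).
Implicit Types (S : tseries d K).

Let sub1 S := tlin (-1) (@tone d K) S.

Lemma tlogE S w N : S [::] = 1 -> (size w <= N)%N ->
  tlog S w = \sum_(1 <= n < N.+1) ((-1) ^+ n.-1 / n%:R) * tpow (sub1 S) n w.
Proof.
move=> S1 wN; rewrite /tlog [RHS](@big_cat_nat _ _ _ (size w).+1) //=.
rewrite [X in _ = _ + X]big1_seq ?addr0 // => n; rewrite mem_index_iota => /andP[_ /andP[wn _]].
by rewrite tpow_small ?mulr0 // /sub1 /tlin /= S1 mulr1 addNr.
Qed.

Lemma tlog_comm S : S [::] = 1 -> tmul S (tlog S) = tmul (tlog S) S.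
Proof.
move=> S1; apply/funext => w.
pose c n : K := (-1) ^+ n.-1 / n%:R.
have SE : S = tadd (@tone d K) (sub1 S).
  by apply/funext => u; rewrite /tadd /sub1 /tlin mulN1r addrA subrr add0r.
transitivity (\sum_(1 <= n < (size w).+1) c n * tmul S (tpow (sub1 S) n) w).
  rewrite {1}/tmul; under eq_bigr => k _.
    rewrite (@tlogE _ _ (size w)) // ?size_drop ?leq_subr // mulr_sumr; over.
  rewrite exchange_big /=; apply: eq_bigr => n _; rewrite mulr_sumr.
  by apply: eq_bigr => k _; rewrite mulrCA.
transitivity (\sum_(1 <= n < (size w).+1) c n * tmul (tpow (sub1 S) n) S w).
  apply: eq_bigr => n _; congr (_ * _); rewrite {1 4}SE tmulDl tmulDr.
  by rewrite tmul1l tmul1r -tpowS tpowSr.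
rewrite {2}/tmul; under [RHS]eq_bigr => k _.
  rewrite (@tlogE _ _ (size w)) // ?size_take_min ?geq_minr // mulr_suml; over.
rewrite exchange_big /=; apply: eq_bigr => n _; rewrite mulr_sumr.
by apply: eq_bigr => k _; rewrite mulrA.
Qed.

End Logarithm.

Section LogExp.
Variables (K : numFieldType).
Implicit Types (a : tseries 1 K).

Lemma ord1_nseq (w : seq 'I_1) : w = nseq (size w) 0.
Proof. by elim: w => //= i w {1}->; rewrite ord1. Qed.

Lemma ins_nseq d (l : 'I_d) (F : tseries d K) n :
  ins l F (nseq n l) = n.+1%:R * F (nseq n.+1 l).
Proof. by rewrite -shsum_nil -shsum_ins shsum_nil. Qed.

(** Over a one-letter alphabet [ins] is differentiation of power series; the hypothesis a' = 1 + a
    is the equation of e^z - 1. *)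
Lemma ins_tpow_exp a n : ins 0 a = tadd (@tone 1 K) a ->
  ins 0 (tpow a n.+1) = tscale n.+1%:R (tadd (tpow a n) (tpow a n.+1)).
Proof.
move=> ha; elim: n => [|n IH]; first by rewrite /tpow /= tmul1r ha; apply/funext=> w; rewrite /tscale mul1r.
rewrite tpowS ins_mul IH ha tmulZr tmulDl tmul1l tmulDr -!tpowS.
apply/funext => w; rewrite /tadd /tscale.
have -> : n.+2%:R = n.+1%:R + 1 :> K by rewrite natr1.
ring.
Qed.

(** This is log(e^z) = z, proved by differentiation: since a' = 1 + a, the k-th term becomes
    (-1)^(k-1) (a^(k-1) + a^k), and the sum telescopes. *)
Lemma tlog_exp1 a n : ins 0 a = tadd (@tone 1 K) a -> a [::] = 0 ->
  \sum_(1 <= k < n.+1) ((-1) ^+ k.-1 / k%:R) * tpow a k (nseq n 0) = (n == 1%N)%:R.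
Proof.
move=> ha a0; case: n => [|n]; first by rewrite big_nil.
have n0 : n.+1%:R != 0 :> K by rewrite pnatr_eq0.
apply: (mulfI n0); rewrite mulr_sumr.
transitivity (\sum_(1 <= k < n.+2) (-1) ^+ k.-1 *
    (tpow a k.-1 (nseq n 0) + tpow a k (nseq n 0))).
  rewrite [LHS]big_seq [RHS]big_seq; apply: eq_bigr => -[|k]; rewrite mem_index_iota //= => _.
  rewrite mulrCA -ins_nseq ins_tpow_exp // /tscale /tadd mulrA.
  by rewrite divfK ?pnatr_eq0.
rewrite big_add1 /=.
have -> m : \sum_(0 <= k < m.+1) (-1) ^+ k * (tpow a k (nseq n 0) + tpow a k.+1 (nseq n 0))
   = tpow a 0 (nseq n 0) + (-1) ^+ m * tpow a m.+1 (nseq n 0).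
  elim: m => [|m IH]; first by rewrite big_nat1 !mul1r.
  by rewrite big_nat_recr //= IH exprS; ring.
rewrite (@tpow_small _ _ _ n.+1) ?size_nseq // mulr0 addr0 /tpow /=.
by case: n n0 => [|n] _; rewrite /= ?mulr1 ?mulr0.
Qed.

(** All factors of l^n are powers of l, so these coefficients only see a power series in one
    variable. *)
Lemma tpow_nseq d (l : 'I_d) (b : tseries d K) k n :
  tpow b k (nseq n l) = tpow (fun u : seq 'I_1 => b (nseq (size u) l)) k (nseq n 0).
Proof.
elim: k n => [|k IH] n; first by case: n.
rewrite !tpowS /tmul !size_nseq; apply: eq_bigr => -[i /= ilt] _.
have il : (i <= n)%N by rewrite -ltnS.
rewrite !drop_nseq !take_nseq // IH size_nseq; by [].
Qed.

Lemma tlog_nseq d (l : 'I_d) (S : tseries d K) n :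
  (forall n, S (nseq n l) = n`!%:R^-1) -> tlog S (nseq n l) = (n == 1%N)%:R.
Proof.
move=> hS; rewrite /tlog size_nseq.
under eq_bigr do rewrite tpow_nseq.
rewrite tlog_exp1 //; last by rewrite /tlin /= (hS 0%N) fact0 invr1 mulr1 addNr.
apply/funext => w; rewrite (ord1_nseq w) ins_nseq size_nseq; move: (size w) => k.
rewrite /tadd /tlin !size_nseq !hS /= mulr0 add0r factS natrM invfM mulrA.
rewrite mulfV ?pnatr_eq0 // mul1r.
by case: k => [|k]; rewrite /= ?mulr1 ?mulr0 ?add0r ?addrA ?subrr ?add0r.
Qed.

End LogExp.

(** * Ordered shuffles and the local approximation of the integral *)

Section OrderedShuffles.
Variables (K : numFieldType) (T : eqType) (P : nat).
Variables (J : seq 'I_2 -> T -> K) (c e : T -> K).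
Hypothesis J1 : forall n i, J (rcons (nseq n 0) 1) i = c i ^+ n * e i.
Hypothesis J0 : forall (w : seq 'I_2) i, (forall n, w <> rcons (nseq n 0) 1) -> J w i = 0.
Implicit Types (dg : nat -> K) (F : tseries 2 K) (js : seq T).

Lemma size_shuffle (A : eqType) (u v w : seq A) :
  w \in shuffle u v -> size w = (size u + size v)%N.
Proof.
elim: u v w => [|a u IHu] v w; first by rewrite inE => /eqP ->.
elim: v w => [|b v IHv] w; first by rewrite inE addn0 => /eqP ->.
rewrite mem_cat => /orP[] /mapP[w' w'uv ->] /=.
  by rewrite (IHu (b :: v)) // addSn.
have := IHv _ w'uv; rewrite /= => ->; by rewrite addnS addSn.
Qed.

Lemma oshuffle_rcons (A : Type) (ws : seq (seq A)) v x :
  oshuffle (rcons ws (rcons v x)) =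
  [seq rcons u x | u <- flatten [seq shuffle u v | u <- oshuffle ws]].
Proof.
by rewrite /oshuffle foldl_rcons; case: v => [|a v] //=; rewrite belast_rcons last_rcons.
Qed.

(** The sum of [local_integral] with abstract jets J and no constraint on the lengths of the
    words. *)
Definition osum r js F : K := \sum_(ws : r.-tuple (P.-bseq 'I_2))
  (\prod_(wj <- zip (map val ws) js) J wj.1 wj.2) *
  (\sum_(w <- oshuffle (map val ws)) F w).

Lemma sum_bseq (G : seq 'I_2 -> K) :
  (forall w : seq 'I_2, (forall n, w <> rcons (nseq n 0) 1) -> G w = 0) ->
  \sum_(w : P.-bseq 'I_2) G w = \sum_(n < P) G (rcons (nseq n 0) 1).
Proof.
move=> G0.
transitivity (\sum_(w : P.-bseq 'I_2) \sum_(n < P | val w == rcons (nseq n 0) 1) G w).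
  apply: eq_bigr => w _.
  have [[n wn]|nw] := pselect (exists n, val w = rcons (nseq n 0) 1); last first.
    rewrite G0; last by move=> n wn; apply: nw; exists n.
    by rewrite big1.
  have nP : (n < P)%N by have := size_bseq w; rewrite wn size_rcons size_nseq.
  rewrite (big_pred1 (Ordinal nP)) // => k /=; rewrite wn; apply/eqP/eqP => [|->] //.
  move/(congr1 size); rewrite !size_rcons !size_nseq => -[kn].
  exact: val_inj.
rewrite (exchange_big_dep xpredT) //=; apply: eq_bigr => n _.
have sn : (size (rcons (nseq n 0%R) (1%R : 'I_2)) <= P)%N by rewrite size_rcons size_nseq.
by rewrite (big_pred1 (Bseq sn)).
Qed.

Lemma osum_rcons r js i F : size js = r ->
  osum r.+1 (rcons js i) F = \sum_(n < P) c i ^+ n * e i *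
    osum r js (shsum 0 n (fun v => F (rcons v 1))).
Proof.
move=> sj; rewrite /osum.
pose h (p : (P.-bseq 'I_2) * r.-tuple (P.-bseq 'I_2)) := [tuple of rcons p.2 p.1].
pose g (t : r.+1.-tuple (P.-bseq 'I_2)) :=
  (last (thead t) (behead t), [tuple of belast (thead t) (behead t)]).
rewrite (reindex h); last first.
  exists g => [[w ws] _|t _].
    rewrite /g /h; case: ws => ws sws /=; rewrite /thead (tnth_nth w) /=.
    case: ws sws => [|x ws] sws /=.
      by congr pair; apply: val_inj.
    by rewrite last_rcons; congr pair; apply: val_inj; rewrite /= belast_rcons.
  by apply: val_inj; rewrite /= -lastI; case: t => -[|x t] st //=; rewrite /thead (tnth_nth x).
rewrite -(pair_bigA _ (fun (w : P.-bseq 'I_2) (ws : r.-tuple (P.-bseq 'I_2)) =>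
  (\prod_(wj <- zip (map val (rcons ws w)) (rcons js i)) J wj.1 wj.2) *
  (\sum_(w <- oshuffle (map val (rcons ws w))) F w))) /=.
pose G (w : seq 'I_2) := \sum_(ws : r.-tuple (P.-bseq 'I_2))
  (\prod_(wj <- rcons (zip (map val ws) js) (w, i)) J wj.1 wj.2) *
  (\sum_(w <- oshuffle (rcons (map val ws) w)) F w).
transitivity (\sum_(w : P.-bseq 'I_2) G w).
  apply: eq_bigr => w _; apply: eq_bigr => ws _; rewrite map_rcons zip_rcons //.
  by rewrite size_map size_tuple sj.
rewrite sum_bseq => [|w wn]; last first.
  by rewrite /G big1 // => ws _; rewrite big_rcons /= J0 // mulr0 mul0r.
apply: eq_bigr => n _; rewrite /G mulr_sumr; apply: eq_bigr => ws _.
rewrite big_rcons /= J1 oshuffle_rcons big_map big_flatten /= big_map.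
by rewrite [_ * (_ * _)]mulrC -!mulrA.
Qed.

(** The weights c are differences of consecutive diagonal entries. Hence shuffling in a last word
    0^n 1 with weight c^n, summed over n, moves the normalisation of the diagonal: instead of its
    entry j + size js, the next one becomes 0. *)
Lemma osumE dg j js F : 
  (forall w, (P < size w)%N -> F w = 0) ->
  (forall i0 k, (k < size js)%N -> c (nth i0 js k) = dg (j + k)%N - dg (j + k).+1) ->
  osum (size js) js F = (\prod_(i <- js) e i) *
    \sum_(N < P.+1) lev (dshift dg (- dg (j + size js)%N)) j (size js) N F.
Proof.
elim/last_ind: js F => [|js i IH] F F0 cE.
  rewrite /osum (big_pred1 [tuple]); last by move=> t; apply/esym/eqP/tuple0.
  rewrite /= !big_nil big_seq1 !mul1r big_ord_recl big1 ?addr0.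
    by rewrite lev0 expr0 mul1r.
  by move=> k _; rewrite lev0 /dshift addn0 subrr exprS !mul0r.
rewrite size_rcons osum_rcons //.
have ci : c i = dg (j + size js)%N - dg (j + size js).+1.
  by rewrite -(cE i) ?size_rcons // nth_rcons ltnn eqxx.
pose F' : tseries 2 K := fun v => F (rcons v 1).
have F'0 w : (P <= size w)%N -> F' w = 0 by move=> Pw; rewrite /F' F0 // size_rcons.
have sh0 n w : (P <= size w + n)%N -> shsum 0 n F' w = 0.
  move=> Pw; rewrite /shsum big1_seq // => v /andP[_ vs]; rewrite F'0 //.
  by rewrite (size_shuffle vs) size_nseq.
under [LHS]eq_bigr => n _.
  rewrite IH; first over.
    by move=> w Pw; rewrite sh0 // (leq_trans (ltnW Pw)) // leq_addr.
  by move=> i0 k kj; rewrite -(cE i0) ?size_rcons ?nth_rcons ?kj // ltnW.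
rewrite big_rcons /=.
pose X n N := lev (dshift dg (- dg (j + size js)%N)) j (size js) N (shsum 0 n F').
(* The shifted diagonal vanishes at its last entry, so [lev_rcons] strips the final 1; the remaining
   shift by c i is expanded by [lev_shift]. *)
have -> : \sum_(N < P.+1) lev (dshift dg (- dg (j + (size js).+1)%N)) j (size js).+1 N F
  = \sum_(M < P) \sum_(n < M.+1) c i ^+ n * X n (M - n)%N.
  rewrite big_ord_recl lev_small // add0r; apply: eq_bigr => M _ /=.
  rewrite lev_rcons; last by rewrite /dshift addnS subrr.
  rewrite -[RHS]lev_shift; apply: eq_lev => // k; rewrite /dshift ci addnS; ring.
rewrite (sum_triangle _ (fun n N => c i ^+ n * X n N)).
rewrite mulr_sumr; apply: eq_bigr => n _.
(* Shuffling with 0^n and appending 1 turns length N into N + n + 1, where F vanishes once N >= P -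
   n. *)
have -> : \sum_(N < P.+1) X n N = \sum_(N < P - n) X n N.
  rewrite [RHS](big_ord_widen P.+1 (X n)); last exact: leq_trans (leq_subr _ _) (leqnSn _).
  rewrite [RHS]big_mkcond /=; apply: eq_bigr => N _; case: ifP => // /negbT; rewrite -leqNgt => nN.
  rewrite /X /lev -[RHS](@wsum0 2 _ N); apply: eq_wsum => w sw.
  by rewrite sh0 ?mulr0 // sw addnC -leq_subLR.
rewrite -mulr_sumr; ring.
Qed.

End OrderedShuffles.

(** * Projective norms and p-variation *)

(** Treats real and complex scalars together, with real-valued absolute values. *)
Record absolute_value (R : realType) (K : numFieldType) (abs : K -> R) : Prop :=
  AbsoluteValue {
    abs_ge0 : forall x, 0 <= abs x;
    abs0 : abs 0 = 0;
    abs1 : abs 1 = 1;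
    absD : forall x y, abs (x + y) <= abs x + abs y;
    absM : forall x y, abs (x * y) = abs x * abs y
  }.

Section AbsoluteValue.
Variables (R : realType) (K : numFieldType) (abs : K -> R).
Hypothesis absP : absolute_value abs.

Lemma abs_sum (I : Type) (r : seq I) (P : pred I) (F : I -> K) :
  abs (\sum_(i <- r | P i) F i) <= \sum_(i <- r | P i) abs (F i).
Proof.
elim/big_rec2: _ => [|i y x _ yx]; first by rewrite (abs0 absP).
by apply: le_trans (absD absP _ _) _; rewrite lerD2l.
Qed.

Lemma abs_prod (I : Type) (r : seq I) (P : pred I) (F : I -> K) :
  abs (\prod_(i <- r | P i) F i) = \prod_(i <- r | P i) abs (F i).
Proof.
elim/big_rec2: _ => [|i y x _ yx]; first by rewrite (abs1 absP).
by rewrite (absM absP) yx.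
Qed.

Lemma abs_wsum d n (F : seq 'I_d -> K) :
  abs (wsum n F) <= wsum n (fun w => abs (F w)).
Proof.
elim: n F => [|n IH] F //=; apply: le_trans (abs_sum _ _ _) _.
by apply: ler_sum => i _; apply: IH.
Qed.

Lemma abs_le_enorm d (v : 'rV[K]_d) i : abs (v 0 i) <= enorm abs v.
Proof.
rewrite /enorm -[leLHS]ger0_norm ?(abs_ge0 absP) // -sqrtr_sqr.
rewrite ler_wsqrtr // (bigD1 i) //= lerDl sumr_ge0 // => j _.
exact: sqr_ge0.
Qed.

Lemma abs_le_pnorm d n (xi : tseries d K) (w : seq 'I_d) :
  size w = n -> abs (xi w) <= pnorm abs n xi.
Proof.
move=> /eqP sw; rewrite -[w]/(val (Tuple sw)); move: (Tuple sw) => {sw}w.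
apply: lb_le_inf.
  (* The bound from below by an infimum needs a nonempty set: the expansion in basis tensors is one
     admissible decomposition. *)
  pose k := #|{: n.-tuple 'I_d}|.
  pose c (r : 'I_k) : K := xi (enum_val r).
  pose v (r : 'I_k) (l : 'I_n) : 'rV[K]_d := delta_mx 0 (tnth (enum_val r) l).
  eexists; exists k, c, v; split; last reflexivity.
  move=> u; rewrite -(@big_enum_val _ _ _ _ {: n.-tuple 'I_d}
    (fun t => xi t * \prod_(l < n) (delta_mx 0 (tnth t l) : 'rV[K]_d) 0 (tnth u l))).
  rewrite (bigD1 u) //= [X in xi u * X]big1 => [|l _]; last by rewrite mxE !eqxx.
  rewrite mulr1 big1 ?addr0 // => t tu.
  suff [l tul] : exists l, tnth t l != tnth u l.
    by rewrite (bigD1 l) //= mxE eqxx eq_sym (negPf tul) mul0r mulr0.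
  apply/existsP; apply: contraT; rewrite negb_exists => /forallP tue.
  case/eqP: tu; apply: eq_from_tnth => l.
  by apply/eqP; move: (tue l); rewrite negbK.
move=> _ [k [c [v [xiE ->]]]]; rewrite xiE.
apply: le_trans (abs_sum _ _ _) _; apply: ler_sum => r _.
rewrite (absM absP) abs_prod ler_wpM2l ?(abs_ge0 absP) //.
apply: ler_prod => l _; rewrite (abs_ge0 absP) /=; exact: abs_le_enorm.
Qed.

Lemma pnorm_ge0 d n (xi : tseries d K) : 0 <= pnorm abs n xi.
Proof.
rewrite /pnorm; set E := (X in inf X).
have [->|/set0P E0] := eqVneq E set0; first by rewrite inf0.
apply: lb_le_inf => // _ [k [c [v [_ ->]]]].
apply: sumr_ge0 => r _; rewrite mulr_ge0 ?(abs_ge0 absP) //.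
by apply: prodr_ge0 => l _; apply: sqrtr_ge0.
Qed.

Lemma wsum_le_pnorm d n (xi : tseries d K) :
  wsum n (fun w => abs (xi w)) <= d%:R ^+ n * pnorm abs n xi.
Proof.
rewrite wsum_tuple; apply: le_trans (ler_sum (G := fun=> pnorm abs n xi) _ _) _.
  by move=> w _; apply: abs_le_pnorm; rewrite size_tuple.
by rewrite sumr_const card_tuple card_ord -[_ *+ (d ^ n)]mulr_natl natrX.
Qed.

End AbsoluteValue.

Lemma normr_absolute_value (R : realType) : absolute_value (@Num.norm R R).
Proof.
split; [exact: normr_ge0|exact: normr0|exact: normr1|exact: ler_normD|exact: normrM].
Qed.

Lemma cabs_absolute_value (R : realType) : absolute_value (@cabs R).
Proof.
split.
- by case=> a b; rewrite /cabs /= sqrtr_ge0.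
- by rewrite /cabs ComplexField.Normc.normc0.
- by rewrite /cabs ComplexField.Normc.normc1.
- by move=> x y; exact: le_normcD.
- exact: Normc.normcM.
Qed.

Section Variation.
Variable R : realType.
Implicit Types (g : R -> R -> R) (P : seq R).

Definition psum g P : R := \sum_(0 <= l < size P) g (nth 1 (0 :: P) l) (nth 1 P l).

Lemma psum_rcons g P t : psum g (rcons P t) = psum g P + g (last 0 P) t.
Proof.
rewrite /psum size_rcons big_nat_recr //= nth_rcons ltnn eqxx; congr (_ + g _ _).
  apply: eq_big_nat => l /andP[_ lP]; rewrite nth_rcons lP; congr (g _ _).
  by case: l lP => [|l] lP //=; rewrite nth_rcons (ltnW lP).
by rewrite -rcons_cons nth_rcons /= ltnSn (last_nth 1).
Qed.

Lemma itv_partition_rcons (s t : R) P :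
  itv_partition 0 s P -> s < t -> itv_partition 0 t (rcons P t).
Proof.
move=> [pP /eqP lP] st; split; last by rewrite last_rcons.
by rewrite rcons_path pP lP.
Qed.

(** W t is the supremum of the sums over partitions of [0, t]: appending t to a partition of [0, s]
    adds the term g s t. *)
Lemma variation_function g C :
  (forall s t, 0 <= g s t) ->
  (forall P, itv_partition 0 1 P -> psum g P <= C) ->
  exists W : R -> R, forall s t, 0 <= s -> s < t -> t <= 1 -> g s t <= W t - W s.
Proof.
move=> g0 gC.
pose E t := [set x | exists2 P, itv_partition 0 t P & x = psum g P].
have Eub t : t <= 1 -> forall x, E t x -> x <= C.
  rewrite le_eqVlt => /orP[/eqP-> x [P P1 ->]|t1 x [P Pt ->]]; first exact: gC.
  apply: le_trans (gC _ (itv_partition_rcons Pt t1)).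
  by rewrite psum_rcons lerDl.
exists (fun t => sup (E t)) => s t s0 st t1.
rewrite lerBrDl -lerBrDr; apply: ge_sup.
  have [s_eq0|s_neq0] := eqVneq s 0.
    by exists (psum g [::]), [::] => //; split => //=; rewrite s_eq0.
  exists (psum g [:: s]), [:: s] => //; split => /=; last by [].
  by rewrite andbT lt0r s_neq0.
move=> _ [P Ps ->]; rewrite lerBrDr; apply: ub_le_sup.
  by exists C => x; apply: Eub.
exists (rcons P t); first exact: itv_partition_rcons Ps st.
by rewrite psum_rcons; case: Ps => _ /eqP ->.
Qed.

Lemma level_pvar_function (K : numFieldType) (abs : K -> R) d p n
    (X : R -> R -> tseries d K) :
  (level_pvar abs p n X < +oo)%E ->
  exists W : R -> R, forall s t, 0 <= s -> s < t -> t <= 1 ->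
    pnorm abs n (X s t) `^ (p / n%:R) <= W t - W s.
Proof.
move=> fin; pose g s t := pnorm abs n (X s t) `^ (p / n%:R).
have H P : itv_partition 0 1 P -> ((psum g P)%:E <= level_pvar abs p n X)%E.
  by move=> PP; apply: ereal_sup_ubound; exists P.
apply: (@variation_function g (fine (level_pvar abs p n X))) => [s t|P PP].
  exact: powR_ge0.
rewrite -lee_fin fineK ?H // fin_real // fin andbT.
by apply: lt_le_trans (H _ PP); rewrite ltNyr.
Qed.

Lemma level_pvar_ge0 (K : numFieldType) (abs : K -> R) d p n
    (X : R -> R -> tseries d K) : (0 <= level_pvar abs p n X)%E.
Proof.
have P1 : itv_partition (0 : R) 1 [:: 1] by split => //=; rewrite ltr01.
apply: (@le_trans _ _ (psum (fun s t => pnorm abs n (X s t) `^ (p / n%:R)) [:: 1])%:E).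
  by rewrite lee_fin sumr_ge0 // => l _; exact: powR_ge0.
by apply: ereal_sup_ubound; exists [:: 1].
Qed.

Lemma mult_functional_level (K : numFieldType) (abs : K -> R) d p N n
    (X : R -> R -> tseries d K) :
  mult_functional abs p N X -> (0 < n <= N)%N -> (level_pvar abs p n X < +oo)%E.
Proof.
move=> [_ _ _ fin] nN; apply: le_lt_trans fin.
rewrite (bigD1_seq n) ?iota_uniq ?mem_index_iota //=.
by rewrite leeDl // sume_ge0 // => k _; exact: level_pvar_ge0.
Qed.

(** Compactness of [0, 1] makes continuity at the points of the diagonal uniform. *)
Lemma diagonal_small (K : numFieldType) (f : R * R -> K^o) :
  {within @simplex R, continuous f} ->
  (forall s : R, 0 <= s <= 1 -> f (s, s) = 0) ->
  forall e : K, 0 < e -> exists2 del : R, 0 < del &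
    forall s t : R, 0 <= s -> s <= t -> t <= 1 -> t - s < del -> `|f (s, t)| < e.
Proof.
move=> /subspace_continuousP cf f0 e e0.
have /compact_near_coveringP near01 := @segment_compact R 0 1.
have H (x : R) : `[0, 1]%classic x -> \forall x' \near x & del \near 0^'+,
    forall t, 0 <= x' -> x' <= t -> t <= 1 -> t - x' < del -> `|f (x', t)| < e.
  rewrite /= in_itv /= => /andP[x0 x1].
  have sx : @simplex R (x, x) by rewrite /simplex /= x0 x1.
  have /cvgrPdist_lt/(_ e e0) := cf _ sx.
  rewrite /from_subspace f0 ?x0 //; rewrite near_withinE => /nbhs_ballP[r /= r0 rf].
  have r20 : 0 < r / 2 by rewrite divr_gt0.
  exists (ball x (r / 2), [set del | del < r / 2]).
    split; first exact: nbhsx_ballx.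
    exact: nbhs_right_lt.
  move=> [x' del] [/= xx' dr] t x'0 x't t1 td.
  have := rf (x', t); rewrite sub0r normrN; apply; last first.
    by rewrite /simplex /= x'0 x't.
  move: xx'; rewrite /ball /= /ball_ => xx'.
  split => /=; first by rewrite /ball /= (lt_trans xx') // ltr_pdivrMr // ltr_pMr // ltr1n.
  rewrite /ball /= (_ : x - t = (x - x') - (t - x')); last by ring.
  apply: le_lt_trans (ler_normB _ _) _; rewrite (splitr r) ltrD //.
  by rewrite ger0_norm ?subr_ge0 // (lt_trans td).
near (0 : R)^'+ => del; exists del => // s t s0 st t1.
have s1 : s <= 1 := le_trans st t1.
have sI : `[0, 1]%classic s by rewrite /= in_itv /= s0.
move: t s0 st t1; apply: (near (near01 R 0^'+ _ _ H) del _ s sI).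
by [].

Unshelve. all: by end_near. Qed.

End Variation.

Section MultiplicativeFunctionals.
Variables (R : realType) (K : numFieldType) (abs : K -> R) (d : nat) (p : R).
Hypothesis absP : absolute_value abs.
Hypothesis p1 : 1 <= p.

(** X s s is its own square and has constant term 1. Once the shorter nonempty words are known to
    vanish, the product leaves X s s w = 2 X s s w. *)
Lemma mult_functional_diag N (X : R -> R -> tseries d K) s w :
  mult_functional abs p N X -> 0 <= s <= 1 -> w != [::] -> (size w <= N)%N ->
  X s s w = 0.
Proof.
move=> [X1 _ XM _] /andP[s0 s1]; elim: {w}(size w) {-2}w (leqnn (size w)) => [|n IH] w.
  by rewrite leqn0 size_eq0 => ->.
move=> wn w0 wN.
have X1s : X s s [::] = 1 by apply: X1; rewrite /simplex /= s0 s1.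
have := XM s s s w s0 (lexx s) (lexx s) s1 wN.
have w_gt0 : (0 < size w)%N by rewrite lt0n size_eq0.
rewrite /tmul big_ord_recl /= take0 drop0 X1s mul1r.
rewrite -{1}[X s s w]addr0 => /addrI/esym.
rewrite -(prednK w_gt0) big_ord_recr /= /bump add1n prednK // take_size drop_size X1s mulr1.
rewrite big1 ?add0r // => i _.
rewrite /bump add1n; have iw : (i.+1 < size w)%N by rewrite -ltn_predRL ltn_ord.
have tw : size (take i.+1 w) = i.+1 by rewrite size_takel // ltnW.
rewrite [X s s (take _ _)]IH ?mul0r //.
- by rewrite tw -ltnS (leq_trans iw).
- by rewrite -size_eq0 tw.
by rewrite tw (leq_trans (ltnW iw)).
Qed.

Lemma powR_root_bound (a D : R) n : 0 <= a -> 0 <= D -> (0 < n)%N ->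
  a `^ (p / n%:R) <= D -> a <= (D `^ p^-1) ^+ n.
Proof.
move=> a0 D0 n0 aD.
have p0 : 0 < p by apply: lt_le_trans p1.
have nn0 : 0 < n%:R :> R by rewrite ltr0n.
rewrite -[leLHS](@powRr1 R) // -powR_mulrn ?powR_ge0 // -powRrM.
have -> : a `^ 1 = (a `^ (p / n%:R)) `^ (p^-1 * n%:R).
  by rewrite -powRrM; congr (_ `^ _); field; rewrite !gt_eqF.
rewrite ge0_ler_powR ?nnegrE ?powR_ge0 //.
by rewrite mulr_ge0 // ?invr_ge0 ltW.
Qed.

Lemma variation_bound N (X : R -> R -> tseries d K) :
  mult_functional abs p N X ->
  exists V : R -> R, forall s t, 0 <= s -> s < t -> t <= 1 ->
    t - s <= V t - V s /\
    forall w, (0 < size w <= N)%N -> abs (X s t w) <= ((V t - V s) `^ p^-1) ^+ size w.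
Proof.
move=> mX.
have Wex n : exists W : R -> R, (0 < n <= N)%N -> forall s t, 0 <= s -> s < t -> t <= 1 ->
    pnorm abs n (X s t) `^ (p / n%:R) <= W t - W s.
  have [nN|nN] := boolP (0 < n <= N)%N; last by exists id.
  by have [W HW] := level_pvar_function (mult_functional_level mX nN); exists W.
have [W HW] := choice Wex.
(* The summand t gives V slope at least 1, which makes its generalised inverse 1-Lipschitz. *)
pose V t := \sum_(1 <= n < N.+1) W n t + t.
have VE s t : V t - V s = \sum_(1 <= n < N.+1) (W n t - W n s) + (t - s).
  by rewrite sumrB /V opprD addrACA.
have HV n s t : (0 < n <= N)%N -> 0 <= s -> s < t -> t <= 1 ->
    W n t - W n s + (t - s) <= V t - V s.
  move=> nN s0 st t1; rewrite VE lerD2r.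
  rewrite (bigD1_seq n) ?iota_uniq ?mem_index_iota //= lerDl big_seq_cond.
  apply: sumr_ge0 => k; rewrite mem_index_iota => /andP[kN _].
  by apply: le_trans (HW k kN s t s0 st t1); exact: powR_ge0.
exists V => s t s0 st t1; split.
  rewrite VE lerDr big_seq.
  apply: sumr_ge0 => k; rewrite mem_index_iota => kN.
  by apply: le_trans (HW k kN s t s0 st t1); exact: powR_ge0.
move=> w wN; apply: le_trans (abs_le_pnorm absP (X s t) erefl) _.
have bd := HW _ wN s t s0 st t1.
have bd2 := HV _ _ _ wN s0 st t1.
have st0 : 0 <= t - s by rewrite subr_ge0 ltW.
have h : pnorm abs (size w) (X s t) `^ (p / (size w)%:R) <= V t - V s.
  apply: le_trans bd _; apply: le_trans bd2; by rewrite lerDl.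
apply: powR_root_bound => //; first exact: pnorm_ge0.
- by apply: le_trans h; exact: powR_ge0.
- by case/andP: wN.
Qed.

End MultiplicativeFunctionals.

Section TimeChange.
Variable R : realType.

(* tau is the generalised inverse of V - V 0, hence well defined and continuous
   although V may jump. *)
Lemma time_change (V : R -> R) :
  (forall s t, 0 <= s -> s < t -> t <= 1 -> t - s <= V t - V s) ->
  exists T tau, [/\ 0 <= T, tau 0 = 0, tau T = 1,
    forall v w, 0 <= v -> v <= w -> w <= T ->
      [/\ 0 <= tau v, tau v <= tau w, tau w <= 1 & tau w - tau v <= w - v] &
    forall v w e, 0 <= v -> v <= w -> w <= T -> tau v < tau w -> 0 < e ->
      exists s t, [/\ tau v < s <= tau v + e, s < t, tau w - e <= t <= tau w &
        V t - V s <= w - v]].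
Proof.
move=> HV.
pose E v := [set t : R | 0 <= t <= 1 /\ V t - V 0 <= v].
pose tau v := sup (E v); pose T := V 1 - V 0.
have T0 : 0 <= T by apply: le_trans (HV 0 1 _ _ _); rewrite ?subr0.
have Eub v : has_ubound (E v) by exists 1 => t [/andP[_ ->]].
have E0 v : 0 <= v -> E v 0 by move=> v0; split; rewrite ?lexx ?ler01 ?subrr.
have tau1 v : 0 <= v -> tau v <= 1.
  by move=> v0; apply: ge_sup; [exists 0; exact: E0|move=> t [/andP[_ ->]]].
have tau0 v : 0 <= v -> 0 <= tau v by move=> v0; apply: ub_le_sup (E0 _ v0).
have tau_mono v w : 0 <= v -> v <= w -> tau v <= tau w.
  move=> v0 vw; apply: ge_sup; first by exists 0; exact: E0.
  move=> t [t01 tv]; apply: ub_le_sup; [exact: Eub|split => //].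
  exact: le_trans vw.
have appr v w e : 0 <= v -> v <= w -> tau v < tau w -> 0 < e ->
      exists s t, [/\ tau v < s <= tau v + e, s < t, tau w - e <= t <= tau w &
        V t - V s <= w - v].
  move=> v0 vw tvw e0.
  (* At s = tau v + h the increment of V from 0 exceeds v, while at some t within h of tau w it is
     at most w. Since h is at most half the gap between tau v and tau w, s < t. *)
  pose h := Num.min e ((tau w - tau v) / 2).
  have h0 : 0 < h by rewrite lt_min e0 divr_gt0 ?subr_gt0.
  have he : h <= e by rewrite ge_min lexx.
  have hh : h + h <= tau w - tau v.
    by rewrite [leRHS]splitr lerD // ge_min lexx orbT.
  have w0 : 0 <= w := le_trans v0 vw.
  have [t [/andP[t0 t1] Vt] tw] := @sup_adherent _ (E w) h h0
    (conj (ex_intro _ 0 (E0 _ w0)) (Eub w)).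
  have ttau : t <= tau w by apply: ub_le_sup => //; split; rewrite ?t0.
  have st : tau v + h < t by rewrite /tau in hh *; lra.
  exists (tau v + h), t; split => //.
  - by rewrite ltrDl h0 lerD2l.
  - by rewrite ttau andbT; rewrite /tau in tw *; lra.
  have tv0 := tau0 _ v0.
  have Vs : v < V (tau v + h) - V 0.
    rewrite ltNge; apply/negP => Vs.
    have : tau v + h <= tau v.
      apply: ub_le_sup => //; split => //.
      by rewrite (le_trans (ltW st)) // andbT; lra.
    by lra.
  lra.
have lip v w : 0 <= v -> v <= w -> tau w - tau v <= w - v.
  move=> v0 vw; have := tau_mono _ _ v0 vw; rewrite le_eqVlt => /orP[/eqP->|tvw].
    by rewrite subrr subr_ge0.
  apply/ler_addgt0Pr => e e0; have e20 : 0 < e / 2 by rewrite divr_gt0.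
  have [s [t [/andP[s1 s2] st /andP[t1 t2] Vts]]] := appr v w _ v0 vw tvw e20.
  have tv0 := tau0 _ v0.
  have tw1 := tau1 _ (le_trans v0 vw).
  have := HV s t _ st _ => /(_ _ _) H.
  have {}H : t - s <= V t - V s by apply: H; lra.
  lra.
exists T, tau; split => //.
- apply/eqP; rewrite eq_le tau0 // andbT; apply: ge_sup; first by exists 0; exact: E0.
  move=> t [/andP[t0 t1] Vt]; rewrite leNgt; apply/negP => t_gt0.
  have := HV 0 t (lexx _) t_gt0 t1; lra.
- apply/eqP; rewrite eq_le tau1 //=; apply: ub_le_sup => //.
  by split; rewrite ?lexx ?ler01.
- move=> v w v0 vw wT; split; [exact: tau0|exact: tau_mono|exact: tau1 (le_trans v0 vw)|exact: lip].
- by move=> v w e v0 vw wT; exact: appr.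
Qed.

End TimeChange.

(** * Dyadic sums and the decay of the Lyons extension *)

Section DyadicSums.
Variables (R : realType) (T : R).
Implicit Types (f g : R -> R -> R) (v w : R).

Fixpoint dsum N f v w : R :=
  if N is N'.+1 then dsum N' f v ((v + w) / 2) + dsum N' f ((v + w) / 2) w
  else f v w.

Lemma midpoint_le v w : v <= w -> v <= (v + w) / 2 /\ (v + w) / 2 <= w.
Proof. by move=> vw; split; lra. Qed.

Lemma dsum_le N f g h v w :
  (forall v w, 0 <= v -> v <= w -> w <= T -> w - v <= h -> f v w <= g v w) ->
  0 <= v -> v <= w -> w <= T -> w - v <= h * 2 ^+ N -> dsum N f v w <= dsum N g v w.
Proof.
move=> fg; elim: N v w => [|N IH] v w v0 vw wT; first by rewrite mulr1; apply: fg.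
rewrite exprS mulrCA => wvh.
have [vm mw] := midpoint_le vw.
by rewrite lerD // IH //; lra.
Qed.

Lemma dsum_additive N (W : R -> R) v w :
  dsum N (fun v w => W w - W v) v w = W w - W v.
Proof. by elim: N v w => [|N IH] v w //=; rewrite !IH addrC addrA subrK. Qed.

Lemma dsumD N f g v w :
  dsum N (fun v w => f v w + g v w) v w = dsum N f v w + dsum N g v w.
Proof. by elim: N v w => [|N IH] v w //=; rewrite !IH addrACA. Qed.

Lemma dsumZ N c f v w : dsum N (fun v w => c * f v w) v w = c * dsum N f v w.
Proof. by elim: N v w => [|N IH] v w //=; rewrite !IH mulrDr. Qed.

(** The errors that are negligible in the limit of dyadic subdivisions; only an upper bound is asked
    for. *)
Definition vanishing f := forall v w e, 0 <= v -> v <= w -> w <= T -> 0 < e ->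
  exists N0, forall N, (N0 <= N)%N -> dsum N f v w <= e.

Lemma vanishing_le f g :
  (forall v w, 0 <= v -> v <= w -> w <= T -> f v w <= g v w) ->
  vanishing g -> vanishing f.
Proof.
move=> fg ng v w e v0 vw wT e0; have [N0 HN] := ng v w e v0 vw wT e0.
exists N0 => N N0N; apply: le_trans (HN N N0N).
apply: (@dsum_le _ _ _ (w - v)) => //; first by move=> *; exact: fg.
by rewrite ler_peMr ?subr_ge0 // exprn_ege1 // ler1n.
Qed.

Lemma vanishingD f g :
  vanishing f -> vanishing g -> vanishing (fun v w => f v w + g v w).
Proof.
move=> nf ng v w e v0 vw wT e0; have e20 : 0 < e / 2 by rewrite divr_gt0.
have [N1 H1] := nf v w _ v0 vw wT e20; have [N2 H2] := ng v w _ v0 vw wT e20.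
exists (maxn N1 N2) => N; rewrite geq_max => /andP[n1 n2].
by rewrite dsumD [e]splitr lerD ?H1 ?H2.
Qed.

Lemma vanishing0 : vanishing (fun _ _ => 0).
Proof.
move=> v w e v0 vw wT e0; exists 0%N => N _.
suff -> : dsum N (fun _ _ => 0) v w = 0 by exact: ltW.
by elim: N v w {v0 vw wT} => [|N IH] v w //=; rewrite !IH addr0.
Qed.

Lemma vanishing_wsum d n (F : R -> R -> seq 'I_d -> R) :
  (forall u, size u = n -> vanishing (fun v w => F v w u)) ->
  vanishing (fun v w => wsum n (F v w)).
Proof.
elim: n F => [|n IH] F H; first exact: (H [::]).
rewrite /=; suff: forall r : seq 'I_d, vanishing (fun v w =>
    \sum_(i <- r) wsum n (fun u => F v w (i :: u))) by apply.
elim=> [|i r IHr].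
  by apply: vanishing_le vanishing0 => v w; rewrite big_nil.
apply: (@vanishing_le _ (fun v w => wsum n (fun u => F v w (i :: u)) +
   \sum_(i <- r) wsum n (fun u => F v w (i :: u)))) => [v w _ _ _|].
  by rewrite big_cons.
apply: vanishingD => //; apply: IH => u su; apply: H; by rewrite /= su.
Qed.

Lemma pow2_large (x y : R) : 0 < y -> exists N0, forall N, (N0 <= N)%N -> x <= y * 2 ^+ N.
Proof.
move=> y0; exists (Num.truncn (`|x| / y)).+1 => N HN.
have h : `|x| / y <= N%:R.
  apply: le_trans (ltW (truncnS_gt _)) _; by rewrite ler_nat.
rewrite ler_pdivrMr // in h.
apply: le_trans (ler_norm _) _; apply: le_trans h _; rewrite mulrC ler_pM2l //.
by rewrite -natrX ler_nat ltnW // ltn_expl.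
Qed.

(** On a fine subdivision the bounds telescope to a small multiple of the total increment of W. *)
Lemma vanishing_small f (W : R -> R) :
  (forall e, 0 < e -> exists2 del, 0 < del & forall v w, 0 <= v -> v <= w -> w <= T ->
     w - v < del -> f v w <= e * (W w - W v)) ->
  vanishing f.
Proof.
move=> fW v w e v0 vw wT e0.
pose c := e / (1 + `|W w - W v|).
have d0 : 0 < 1 + `|W w - W v| by rewrite ltr_pwDl.
have c0 : 0 < c by rewrite divr_gt0.
have [del del0 H] := fW c c0.
have [N0 HN] := @pow2_large (w - v) (del / 2) (divr_gt0 del0 (ltr0Sn _ _)).
exists N0 => N /HN hN.
apply: (@le_trans _ _ (dsum N (fun v w => c * (W w - W v)) v w)).
  apply: (@dsum_le _ _ _ (del / 2)) => // v' w' v'0 v'w' w'T h'.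
  by apply: H => //; apply: le_lt_trans h' _; rewrite ltr_pdivrMr // ltr_pMr // ltr1n.
rewrite dsumZ dsum_additive /c mulrAC ler_pdivrMr // ler_pM2l //.
by apply: le_trans (ler_norm _) _; rewrite lerDr.
Qed.

Lemma powR_small (r e : R) : 0 < r -> 0 < e ->
  exists2 del : R, 0 < del & forall x, 0 <= x -> x < del -> x `^ r <= e.
Proof.
move=> r0 e0; exists (e `^ r^-1); first exact: powR_gt0.
move=> x x0 xe; rewrite -[leRHS]powRr1 ?(ltW e0) // -[1](@mulVf _ r) ?gt_eqF // powRrM.
by rewrite ge0_ler_powR ?nnegrE ?powR_ge0 // ltW.
Qed.

(** An additive function is bounded by every dyadic sum of its absolute value. *)
Lemma additive_eq0 (K : numFieldType) (abs : K -> R) (f : R -> R -> K) v w :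
  absolute_value abs ->
  (forall v u w, 0 <= v -> v <= u -> u <= w -> w <= T -> f v w = f v u + f u w) ->
  vanishing (fun v w => abs (f v w)) ->
  0 <= v -> v <= w -> w <= T -> f v w = 0.
Proof.
move=> absP fD nf v0 vw wT.
have H N v' w' : 0 <= v' -> v' <= w' -> w' <= T ->
    abs (f v' w') <= dsum N (fun v w => abs (f v w)) v' w'.
  elim: N v' w' => [|N IH] v' w' v'0 v'w' w'T //=.
  have [vm mw] := midpoint_le v'w'.
  rewrite (fD v' ((v' + w') / 2) w') //; apply: le_trans (absD absP _ _) _.
  by rewrite lerD // IH //; lra.
have abs_eq0 : abs (f v w) = 0.
  apply/eqP; rewrite eq_le (abs_ge0 absP) andbT; apply/ler_addgt0Pr => e e0.
  have [N0 HN] := nf v w e v0 vw wT e0.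
  by rewrite add0r (le_trans (H N0 v w v0 vw wT)) // HN.
apply/eqP; apply/negPn/negP => fn0.
have := absM absP (f v w) (f v w)^-1; rewrite mulfV // (abs1 absP) abs_eq0 mul0r.
by move/eqP; rewrite oner_eq0.
Qed.

(** Each halving replaces one defect C s^n by two of size C q^n s^n, so the accumulated defects form
    a geometric series of ratio 2 q^n. *)
Lemma dyadic_bound (s : R -> R -> R) (q C : R) n f :
  (forall v w, 0 <= v -> v <= w ->
     s v ((v + w) / 2) = q * s v w /\ s ((v + w) / 2) w = q * s v w) ->
  (forall v w, 0 <= s v w) -> 0 <= q -> 0 <= C -> 2 * q ^+ n < 1 ->
  (forall v u w, 0 <= v -> v <= u -> u <= w -> w <= T -> u = (v + w) / 2 ->
     f v w <= f v u + f u w + C * s v w ^+ n) ->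
  vanishing f ->
  forall v w, 0 <= v -> v <= w -> w <= T -> f v w <= C / (1 - 2 * q ^+ n) * s v w ^+ n.
Proof.
move=> sq s0 q0 C0 q1 fD nf v w v0 vw wT.
pose D := C / (1 - 2 * q ^+ n).
(* D is the fixed point of one subdivision step: its own defect plus those of the two halves. *)
have DE : D = C + 2 * q ^+ n * D by rewrite /D; field; rewrite subr_eq0 gt_eqF.
have H N v' w' : 0 <= v' -> v' <= w' -> w' <= T ->
    f v' w' <= dsum N f v' w' + D * (s v' w' ^+ n - (2 * q ^+ n) ^+ N * s v' w' ^+ n).
  elim: N v' w' => [|N IH] v' w' v'0 v'w' w'T /=; first by rewrite expr0; lra.
  have [vm mw] := midpoint_le v'w'.
  have h1 := fD _ _ _ v'0 vm mw w'T erefl.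
  have h2 := IH _ _ v'0 vm (le_trans mw w'T).
  have h3 := IH _ _ (le_trans v'0 vm) mw w'T.
  have [e1 e2] := sq _ _ v'0 v'w'.
  rewrite e1 exprMn in h2; rewrite e2 exprMn in h3.
  apply: le_trans h1 _; rewrite exprS.
  move: h2 h3; set x := s v' w' ^+ n; set y := q ^+ n; set z := (2 * y) ^+ N.
  set a := dsum N f v' _; set b := dsum N f _ w' => h2 h3.
  have hx : D * x = C * x + 2 * y * D * x by rewrite {1}DE mulrDl.
  lra.
apply/ler_addgt0Pr => e e0.
have [N0 HN] := nf v w e v0 vw wT e0.
apply: le_trans (H N0 v w v0 vw wT) _; rewrite addrC lerD ?HN //.
rewrite -/D ler_wpM2l //; first by rewrite divr_ge0 // subr_ge0 ltW.
by rewrite gerBl mulr_ge0 ?exprn_ge0 // mulr_ge0 // exprn_ge0.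
Qed.

End DyadicSums.

Section GeometricSums.
Variable R : realType.

(** The powers x^i decrease, so n x^n is at most the geometric sum over i < n. This absorbs the
    number of terms of a product at level n. *)
Lemma natr_mul_expr_le (x : R) n : 0 <= x -> x < 1 -> n%:R * x ^+ n <= (1 - x)^-1.
Proof.
move=> x0 x1; have x10 : 0 < 1 - x by rewrite subr_gt0.
rewrite -[leRHS]mul1r ler_pdivlMr //.
apply: (@le_trans _ _ (1 - x ^+ n)); last by rewrite gerBl exprn_ge0.
have -> : 1 - x ^+ n = (1 - x) * \sum_(i < n) x ^+ i.
  by rewrite -opprB subrX1 -mulNr opprB.
rewrite [leRHS]mulrC ler_pM2r //.
have -> : n%:R * x ^+ n = \sum_(i < n) x ^+ n by rewrite sumr_const card_ord mulr_natl.
apply: ler_sum => i _.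
by apply: ler_wiXn2l => //; [exact: ltW|exact: ltnW (ltn_ord i)].
Qed.

Lemma expr_small (x e : R) : 0 <= x -> x < 1 -> 0 < e -> exists m, x ^+ m <= e.
Proof.
move=> x0 x1 e0; exists (Num.truncn ((1 - x)^-1 / e)).+1; set m := _.+1.
have m0 : 0 < m%:R :> R by rewrite ltr0n.
rewrite -(ler_pM2l m0); apply: le_trans (natr_mul_expr_le m x0 x1) _.
rewrite -ler_pdivrMr //; apply: ltW; exact: truncnS_gt.
Qed.

End GeometricSums.

Section MultiplicativeBound.
Variables (R : realType) (T p : R) (d : nat).
Variable Z : R -> R -> tseries d R.
Hypothesis p1 : 1 <= p.
Let P := Num.truncn p.
Let s (v w : R) := (w - v) `^ p^-1.
Hypothesis Z1 : forall v w, 0 <= v -> v <= w -> w <= T -> Z v w [::] = 1.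
Hypothesis ZM : forall v u w x, 0 <= v -> v <= u -> u <= w -> w <= T ->
  Z v w x = tmul (Z v u) (Z u w) x.
Hypothesis ZP : forall v w x, 0 <= v -> v <= w -> w <= T -> (0 < size x <= P)%N ->
  `|Z v w x| <= s v w ^+ size x.
Hypothesis Zneg : forall x, (P < size x)%N -> vanishing T (fun v w => `|Z v w x|).

Definition lnorm n (a : tseries d R) := wsum n (fun x => `|a x|).

Lemma lnorm_ge0 n a : 0 <= lnorm n a.
Proof.
rewrite /lnorm wsum_tuple; apply: sumr_ge0 => w _; exact: normr_ge0.
Qed.

Lemma ler_wsum d' n (F G : seq 'I_d' -> R) :
  (forall w, size w = n -> F w <= G w) -> wsum n F <= wsum n G.
Proof.
by move=> FG; rewrite !wsum_tuple; apply: ler_sum => w _; rewrite FG ?size_tuple.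
Qed.

Lemma lnorm_tmul n a b :
  lnorm n (tmul a b) <= \sum_(k < n.+1) lnorm k a * lnorm (n - k) b.
Proof.
apply: (@le_trans _ _ (wsum n (fun x => 1 * tmul (fun u => `|a u|) (fun u => `|b u|) x))).
  apply: ler_wsum => x _; rewrite mul1r /tmul; apply: le_trans (ler_norm_sum _ _ _) _.
  by apply: ler_sum => k _; rewrite normrM.
rewrite (@wsum_tmul _ _ _ (fun _ _ _ => 1)) // le_eqVlt; apply/orP; left; apply/eqP.
apply: eq_bigr => k _; rewrite /lnorm -wsumZr; apply: eq_wsum => u _.
by rewrite -wsumZ; apply: eq_wsum => v _; rewrite mul1r.
Qed.

Let q : R := 2^-1 `^ p^-1.

Let p0 : 0 < p. Proof. exact: lt_le_trans p1. Qed.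

Let q0 : 0 < q. Proof. by apply: powR_gt0; rewrite invr_gt0. Qed.

Lemma scale_half (x : R) : 0 <= x -> (x / 2) `^ p^-1 = q * x `^ p^-1.
Proof. by move=> x0; rewrite mulrC powRM // invr_ge0. Qed.

Let half01 : (0 <= 2^-1 :> R) && (2^-1 < 1 :> R).
Proof. by rewrite invr_ge0 ler0n invf_lt1 ?ltr1n ?ltr0n. Qed.

Lemma half_powR_lt1 (r : R) : 0 < r -> 2^-1 `^ r < 1.
Proof.
move=> r0; have /andP[h0 h1] := half01.
have h : (2^-1 : R) `^ r < 1 `^ r by apply: gt0_ltr_powR => //; rewrite nnegrE.
by rewrite powR1 in h.
Qed.

Let q1 : q < 1. Proof. by apply: half_powR_lt1; rewrite invr_gt0. Qed.

(** With q = 2^(-1/p), lam is 2^(1 - (P+1)/p), which is below 1 because P + 1 > p. *)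
Let lam := 2 * q ^+ P.+1.

Let lam1 : lam < 1.
Proof.
have h0 : 0 <= 2^-1 :> R by case/andP: half01.
have t1 : 0 < p^-1 * P.+1%:R - 1.
  rewrite subr_gt0 mulrC ltr_pdivlMr // mul1r; exact: truncnS_gt.
rewrite /lam /q -powR_mulrn ?powR_ge0 // -powRrM -mulr_powRB1 //; last by lra.
by rewrite mulrA mulfV ?pnatr_eq0 // mul1r half_powR_lt1.
Qed.

Let lam_n n : (P < n)%N -> 2 * q ^+ n <= lam.
Proof.
by move=> Pn; rewrite ler_pM2l //; apply: ler_wiXn2l => //; exact: ltW.
Qed.

Let s0 v w : 0 <= s v w. Proof. exact: powR_ge0. Qed.

Let s_half v w : 0 <= v -> v <= w ->
  s v ((v + w) / 2) = q * s v w /\ s ((v + w) / 2) w = q * s v w.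
Proof.
move=> v0 vw; have wv0 : 0 <= w - v by rewrite subr_ge0.
by split; rewrite -scale_half //; congr (_ `^ _); field.
Qed.

(** At the midpoint u, the middle terms of Z v u times Z u w are n - 1 products of lower levels.
    Each carries the factor q^n, since both halves have scale q s; [dyadic_bound] sums these
    defects. *)
Let lnorm_step kap K n v w : 0 <= kap -> 0 <= K ->  (P < n)%N ->
  (forall k v w, (0 < k < n)%N -> 0 <= v -> v <= w -> w <= T ->
     lnorm k (Z v w) <= kap * K ^+ k * s v w ^+ k) ->
  0 <= v -> v <= w -> w <= T ->
  lnorm n (Z v w) <= n%:R * q ^+ n * (kap ^+ 2 * K ^+ n) / (1 - lam) * s v w ^+ n.
Proof.
move=> kap0 K0; case: n => // n Pn H v0 vw wT.
set C := n.+1%:R * q ^+ n.+1 * (kap ^+ 2 * K ^+ n.+1).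
have C0 : 0 <= C by rewrite !mulr_ge0 ?exprn_ge0 ?sqr_ge0 // ltW.
have qn1 : 2 * q ^+ n.+1 < 1 := le_lt_trans (lam_n Pn) lam1.
apply: (@le_trans _ _ (C / (1 - 2 * q ^+ n.+1) * s v w ^+ n.+1)); last first.
  rewrite ler_wpM2r ?exprn_ge0 // ler_wpM2l // lef_pV2 ?posrE ?subr_gt0 //.
  by rewrite lerD2l lerN2 lam_n.
move: v w v0 vw wT.
apply: (dyadic_bound s_half) => //; first exact: ltW.
  move=> v u w v0 vu uw wT uE.
  have vw := le_trans vu uw; have u0 := le_trans v0 vu.
  have [sv sw] := s_half v0 vw; rewrite -uE in sv sw.
  have -> : lnorm n.+1 (Z v w) = lnorm n.+1 (tmul (Z v u) (Z u w)).
    by apply: eq_wsum => x _; rewrite (ZM x v0 vu uw wT).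
  apply: le_trans (lnorm_tmul _ _ _) _.
  rewrite big_ord_recl /= [lnorm 0 (Z v u)]/lnorm /= Z1 // ?(le_trans uw) // normr1 mul1r subn0.
  rewrite big_ord_recr /= /bump add1n subnn [lnorm 0 (Z u w)]/lnorm /= Z1 // normr1 mulr1.
  set S := \sum_(_ < _) _.
  suff : S <= C * s v w ^+ n.+1 by lra.
  apply: (@le_trans _ _ (\sum_(i < n) kap ^+ 2 * K ^+ n.+1 * (q ^+ n.+1 * s v w ^+ n.+1))).
    apply: ler_sum => i _; rewrite /bump /= add1n subSS.
    have ni : (0 < n - i)%N by rewrite subn_gt0.
    have h1 := H i.+1 v u (ltn_ord i) v0 vu (le_trans uw wT).
    have h2 := H (n - i)%N u w _ u0 uw wT.
    apply: le_trans (ler_pM (lnorm_ge0 _ _) (lnorm_ge0 _ _) h1 (h2 _)) _.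
      by rewrite ni ltnS leq_subr.
    rewrite sv sw (_ : n.+1 = (i.+1 + (n - i))%N); last by rewrite addSn subnKC // ltnW.
    rewrite le_eqVlt; apply/orP; left; apply/eqP.
    by rewrite !exprMn !exprD; ring.
  rewrite sumr_const card_ord -mulr_natl /C.
  set B := (X in n%:R * X).
  have B0 : 0 <= B by rewrite /B !mulr_ge0 ?exprn_ge0 ?sqr_ge0 // ltW.
  rewrite (_ : _ * _ * _ * _ = n.+1%:R * B); last by rewrite /B; ring.
  by rewrite ler_wpM2r // ler_nat.
apply: vanishing_wsum => x sx; apply: Zneg; by rewrite sx.
Qed.

Let lnorm_base n v w : 0 <= v -> v <= w -> w <= T -> (0 < n <= P)%N ->
  lnorm n (Z v w) <= d%:R ^+ n * s v w ^+ n.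
Proof.
move=> v0 vw wT nP; rewrite /lnorm wsum_tuple.
apply: (@le_trans _ _ (\sum_(x : n.-tuple 'I_d) s v w ^+ n)).
  by apply: ler_sum => x _; have := @ZP v w x v0 vw wT; rewrite size_tuple; apply.
by rewrite sumr_const card_tuple card_ord -natrX mulr_natl.
Qed.

Let lnorm_geometric : exists kap K, [/\ 0 < kap, 0 < K & forall n v w,
  (0 < n)%N -> 0 <= v -> v <= w -> w <= T ->
  lnorm n (Z v w) <= kap * K ^+ n * s v w ^+ n].
Proof.
have q10 : 0 < 1 - q by rewrite subr_gt0.
have lam10 : 0 < 1 - lam by rewrite subr_gt0.
(* As n q^n <= 1/(1 - q), the induction step needs kap^2 <= kap (1 - q) (1 - lam), and this kap
   gives equality. K makes kap K^n at least d^n, the number of words; d + 1 keeps it positive. *)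
pose kap := (1 - q) * (1 - lam); pose K := d.+1%:R / kap.
have kap0 : 0 < kap by rewrite mulr_gt0.
have lam0 : 0 <= lam by rewrite mulr_ge0 // exprn_ge0 // ltW.
have kap1 : kap <= 1.
  by apply: mulr_ile1; rewrite ?subr_ge0 ?gerBl //; exact: ltW.
have K0 : 0 < K by rewrite divr_gt0 // ltr0n.
exists kap, K; split => //; elim/ltn_ind => n IH v w n0 v0 vw wT.
have [Pn|nP] := ltnP P n; last first.
  apply: le_trans (lnorm_base v0 vw wT _) _; first by rewrite n0.
  rewrite ler_wpM2r ?exprn_ge0 // /K exprMn mulrCA.
  rewrite -[leLHS]mulr1; apply: ler_pM => //; rewrite ?exprn_ge0 //.
    by rewrite lerXn2r ?nnegrE ?ler0n // ler_nat.
  rewrite exprVn -(prednK n0) exprS invfM mulrA mulfV ?gt_eqF // mul1r.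
  by rewrite invf_ge1 ?exprn_gt0 // exprn_ile1 // ltW.
apply: le_trans (lnorm_step (ltW kap0) (ltW K0) Pn _ v0 vw wT) _.
  by move=> k v' w' /andP[k0 kn]; apply: IH.
rewrite ler_wpM2r ?exprn_ge0 // ler_pdivrMr //.
have := @natr_mul_expr_le _ q n (ltW q0) q1; rewrite -(ler_pM2r (_ : 0 < kap ^+ 2 * K ^+ n)).
  move=> h; apply: le_trans h _; rewrite le_eqVlt; apply/orP; left; apply/eqP.
  by rewrite /kap; field; rewrite gt_eqF.
by rewrite mulr_gt0 ?exprn_gt0.
Qed.

(* The midpoint subdivision gains a factor 2^(-n/p) at level n, which makes the
   geometric rate as small as one likes. *)
Lemma lnorm_decay (K : R) : 0 < K -> exists2 kap, 0 < kap &
  forall n v w, (0 < n)%N -> 0 <= v -> v <= w -> w <= T ->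
  lnorm n (Z v w) <= kap * K ^+ n * s v w ^+ n.
Proof.
move=> K0; have [kap0 [K1 [kap00 K10 H0]]] := lnorm_geometric.
(* In q^n = r^n r^n one factor absorbs n and the other improves the rate K to K r. This is iterated
   m times. *)
pose r := Num.sqrt q.
have r0 : 0 < r by rewrite sqrtr_gt0.
have rr : r ^+ 2 = q by rewrite sqr_sqrtr // ltW.
have r1 : r < 1 by rewrite -(@ltr_pXn2r _ 2%N) ?nnegrE ?ltW // rr expr1n.
have lam10 : 0 < 1 - lam by rewrite subr_gt0.
have Hm m : exists2 kap, 0 < kap &
  forall n v w, (0 < n)%N -> 0 <= v -> v <= w -> w <= T ->
  lnorm n (Z v w) <= kap * (K1 * r ^+ m) ^+ n * s v w ^+ n.
  elim: m => [|m [kap kap_gt0 IH]]; first by exists kap0 => //; rewrite expr0 mulr1.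
  pose L := K1 * r ^+ m.
  have L0 : 0 < L by rewrite mulr_gt0 // exprn_gt0.
  have r10 : 0 < 1 - r by rewrite subr_gt0.
  (* The first summand pays for the levels n <= P, where r^n >= r^P; the second comes from
     [lnorm_step]. *)
  pose kap' := kap / r ^+ P + kap ^+ 2 / ((1 - r) * (1 - lam)).
  have a0 : 0 < kap / r ^+ P by rewrite divr_gt0 // exprn_gt0.
  have b0 : 0 < kap ^+ 2 / ((1 - r) * (1 - lam)).
    by rewrite divr_gt0 ?exprn_gt0 // mulr_gt0.
  exists kap'; first by rewrite addr_gt0.
  move=> n v w n0 v0 vw wT.
  have -> : K1 * r ^+ m.+1 = L * r by rewrite /L exprSr mulrA.
  rewrite [(L * r) ^+ n]exprMn.
  have Lr0 : 0 < L ^+ n * r ^+ n by rewrite mulr_gt0 // exprn_gt0.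
  have [Pn|nP] := ltnP P n; last first.
    apply: le_trans (IH n v w n0 v0 vw wT) _; rewrite ler_wpM2r ?exprn_ge0 //.
    apply: (@le_trans _ _ (kap / r ^+ P * (L ^+ n * r ^+ n))); last first.
      by rewrite ler_pM2r // lerDl ltW.
    rewrite -/L -mulrA ler_pM2l // mulrCA -[leLHS]mulr1 ler_pM2l ?exprn_gt0 //.
    rewrite mulrC ler_pdivlMr ?exprn_gt0 // mul1r.
    by apply: ler_wiXn2l => //; exact: ltW.
  apply: le_trans (lnorm_step (ltW kap_gt0) (ltW L0) Pn _ v0 vw wT) _.
    by move=> k v' w' /andP[k0 kn]; apply: IH.
  rewrite ler_wpM2r ?exprn_ge0 //.
  apply: (@le_trans _ _ (kap ^+ 2 / ((1 - r) * (1 - lam)) * (L ^+ n * r ^+ n))); last first.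
    by rewrite ler_pM2r // lerDr ltW.
  have := @natr_mul_expr_le _ r n (ltW r0) r1.
  rewrite -(ler_pM2r (_ : 0 < r ^+ n * (kap ^+ 2 * L ^+ n) / (1 - lam))); last first.
    by rewrite divr_gt0 // !mulr_gt0 ?exprn_gt0.
  move=> h; apply: le_trans (le_trans h _); rewrite le_eqVlt; apply/orP; left; apply/eqP.
    by rewrite -rr -exprM mul2n -addnn exprD; ring.
  by field; rewrite !gt_eqF.
have Kr : 0 < K / K1 by rewrite divr_gt0.
have [m rm] := expr_small (ltW r0) r1 Kr.
have [kap kap_gt0 H] := Hm m; exists kap => // n v w n0 v0 vw wT.
apply: le_trans (H n v w n0 v0 vw wT) _; rewrite ler_wpM2r ?exprn_ge0 //.
have rmK : K1 * r ^+ m <= K by rewrite mulrC -ler_pdivlMr.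
rewrite ler_pM2l //; apply: lerXn2r; rewrite ?nnegrE //; last exact: ltW.
by rewrite mulr_ge0 ?exprn_ge0 // ltW.
Qed.

End MultiplicativeBound.

(** * Complex series *)

Section ComplexSeries.
Variable R : realType.
Implicit Types (u v : nat -> R[i]) (a b l : R[i]) (e : R).

Let absP := cabs_absolute_value R.

Definition csum u l := forall e, 0 < e ->
  exists N, forall n, (N <= n)%N -> cabs (\sum_(i < n) u i - l) <= e.

Lemma cabs_eq0 a : cabs a = 0 -> a = 0.
Proof. exact: Normc.eq0_normc. Qed.

Lemma cabsN a : cabs (- a) = cabs a.
Proof. by rewrite -mulN1r (absM absP) /cabs /= oppr0 expr0n addr0 sqrrN expr1n sqrtr1 mul1r. Qed.

Lemma cabsB a b : cabs (a - b) = cabs (b - a).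
Proof. by rewrite -cabsN opprB. Qed.

Lemma cabs_real (x : R) : cabs x%:C = `|x|.
Proof. by rewrite /cabs /= expr0n addr0 sqrtr_sqr. Qed.

Lemma cabs_le_ReIm a : cabs a <= `|complex.Re a| + `|complex.Im a|.
Proof.
case: a => x y; rewrite [complex.Re _]/= [complex.Im _]/=.
have {1}-> : (x +i* y) = x%:C + (0 +i* 1) * y%:C by simpc.
apply: le_trans (absD absP _ _) _; rewrite (absM absP) !cabs_real.
by rewrite /cabs /= expr0n add0r expr1n sqrtr1 mul1r.
Qed.

Lemma Re_le_cabs a : `|complex.Re a| <= cabs a.
Proof. by case: a => x y; rewrite /cabs /= -sqrtr_sqr ler_wsqrtr // lerDl sqr_ge0. Qed.

Lemma Im_le_cabs a : `|complex.Im a| <= cabs a.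
Proof. by case: a => x y; rewrite /cabs /= -sqrtr_sqr ler_wsqrtr // lerDr sqr_ge0. Qed.

Lemma csum_unique u a b : csum u a -> csum u b -> a = b.
Proof.
move=> ua ub; apply/eqP; rewrite -subr_eq0; apply/eqP/cabs_eq0.
apply/eqP; rewrite eq_le (abs_ge0 absP) andbT; apply/ler_addgt0Pr => e e0.
have e20 : 0 < e / 2 by rewrite divr_gt0.
have [N1 H1] := ua _ e20; have [N2 H2] := ub _ e20.
pose n := maxn N1 N2.
have h1 := H1 n (leq_maxl _ _); have h2 := H2 n (leq_maxr _ _).
rewrite add0r (_ : a - b = (a - \sum_(i < n) u i) + (\sum_(i < n) u i - b)); last by ring.
by apply: le_trans (absD absP _ _) _; rewrite [e]splitr lerD // cabsB.
Qed.

Lemma csum_finite u N : (forall n, (N <= n)%N -> u n = 0) -> csum u (\sum_(i < N) u i).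
Proof.
move=> u0 e e0; exists N => n Nn.
rewrite -!(big_mkord xpredT) (@big_cat_nat _ _ _ N) //= addrAC subrr add0r.
rewrite big_nat big1 ?(abs0 absP) ?ltW // => i /andP[Ni _]; exact: u0.
Qed.

Lemma csumD u v a b : csum u a -> csum v b -> csum (fun n => u n + v n) (a + b).
Proof.
move=> ua vb e e0; have e20 : 0 < e / 2 by rewrite divr_gt0.
have [N1 H1] := ua _ e20; have [N2 H2] := vb _ e20.
exists (maxn N1 N2) => n; rewrite geq_max => /andP[n1 n2].
rewrite big_split /= opprD addrACA; apply: le_trans (absD absP _ _) _.
by rewrite [e]splitr lerD ?H1 ?H2.
Qed.

Lemma csum_sum m (u : 'I_m -> nat -> R[i]) (l : 'I_m -> R[i]) : (forall i, csum (u i) (l i)) ->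
  csum (fun n => \sum_i u i n) (\sum_i l i).
Proof.
elim: m u l => [|m IH] u l ul.
  have -> : (fun n => \sum_i u i n) = fun=> 0 by apply/funext => n; rewrite big_ord0.
  rewrite big_ord0; have := @csum_finite (fun=> 0) 0%N (fun _ _ => erefl).
  by rewrite big_ord0.
have -> : (fun n => \sum_i u i n) =
    (fun n => u ord0 n + \sum_i u (lift ord0 i) n).
  by apply/funext => n; rewrite big_ord_recl.
by rewrite big_ord_recl; apply: csumD => //; exact: IH.
Qed.

Lemma csum_ReIm u :
  cvgn (series (fun n => complex.Re (u n))) -> cvgn (series (fun n => complex.Im (u n))) ->
  csum u (limn (series (fun n => complex.Re (u n))) +i*
          limn (series (fun n => complex.Im (u n)))).
Proof.
move=> cr ci e e0; have e20 : 0 < e / 2 by rewrite divr_gt0.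
have /cvgrPdist_le/(_ _ e20)[N1 _ H1] := cr.
have /cvgrPdist_le/(_ _ e20)[N2 _ H2] := ci.
exists (maxn N1 N2) => n; rewrite geq_max => /andP[n1 n2].
have RIE : \sum_(i < n) u i = (series (fun n => complex.Re (u n)) n) +i*
    (series (fun n => complex.Im (u n)) n).
  rewrite /series /= !big_mkord; elim: (n) => [|m IH]; first by rewrite !big_ord0.
  by rewrite !big_ord_recr /= IH; case: (u m) => x y; simpc.
rewrite RIE; apply: le_trans (cabs_le_ReIm _) _; rewrite [e]splitr /=.
by rewrite lerD // distrC; [exact: H1|exact: H2].
Qed.

Lemma csum_geometric_ex u k : (forall n, cabs (u n) <= k / 8 ^+ n) ->
  exists l, csum u l.
Proof.
move=> uk.
have cv (f : nat -> R) : (forall n, `|f n| <= k / 8 ^+ n) -> cvgn (series f).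
  move=> fk; apply: normed_cvg.
  apply: (@series_le_cvg _ _ (geometric k (8^-1))) => [n|n|n|].
  - exact: normr_ge0.
  - by rewrite /geometric /= exprVn; apply: le_trans (fk n); exact: normr_ge0.
  - by rewrite /geometric /= exprVn; exact: fk.
  apply: is_cvg_geometric_series.
  by rewrite ger0_norm ?invr_ge0 ?ler0n // invf_lt1 ?ltr1n ?ltr0n.
eexists; apply: csum_ReIm; apply: cv => n; apply: le_trans (uk n).
  exact: Re_le_cabs.
exact: Im_le_cabs.
Qed.

Lemma csum_tail u l N c : csum u l ->
  (forall n, cabs (u (N + n)%N) <= c / 2 ^+ n) ->
  cabs (l - \sum_(i < N) u i) <= 2 * c.
Proof.
move=> ul uc; apply/ler_addgt0Pr => e e0.
have [N1 H1] := ul _ e0.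
pose n := (N + N1)%N; have h := H1 n (leq_addl _ _).
rewrite (_ : l - _ = (l - \sum_(i < n) u i) + (\sum_(i < n) u i - \sum_(i < N) u i)); last by ring.
apply: le_trans (absD absP _ _) _; rewrite addrC lerD //; last by rewrite cabsB.
have -> : \sum_(i < n) u i - \sum_(i < N) u i = \sum_(i < N1) u (N + i)%N.
  by rewrite /n big_split_ord /= addrAC subrr add0r.
apply: le_trans (abs_sum absP _ _ _) _.
have c0 : 0 <= c by have := uc 0%N; rewrite divr1; apply: le_trans; exact: abs_ge0.
suff H m : \sum_(i < m) cabs (u (N + i)%N) <= 2 * c - 2 * c / 2 ^+ m.
  by apply: le_trans (H N1) _; rewrite gerBl divr_ge0 ?mulr_ge0 ?exprn_ge0.
elim: m => [|m IH]; first by rewrite big_ord0 expr0 divr1 subrr.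
rewrite big_ord_recr /=; apply: le_trans (lerD IH (uc m)) _.
rewrite le_eqVlt; apply/orP; left; apply/eqP.
by rewrite exprS; field; rewrite expf_neq0.
Qed.

(** The missing pairs satisfy i + j >= N; there are at most N^2 of them, each contributing at most
    k1 k2 / 8^N. Using N <= 2^N twice leaves 2^(-N), which explains the rate 8 = 2^3. *)
Lemma cauchy_product_defect u v k1 k2 N :
  (forall n, cabs (u n) <= k1 / 8 ^+ n) -> (forall n, cabs (v n) <= k2 / 8 ^+ n) ->
  cabs ((\sum_(i < N) u i) * (\sum_(i < N) v i) -
        \sum_(n < N) \sum_(k < n.+1) u k * v (n - k)%N) <= k1 * k2 / 2 ^+ N.
Proof.
move=> uk vk.
have k10 : 0 <= k1 by have := uk 0%N; rewrite divr1; apply: le_trans; exact: abs_ge0.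
have k20 : 0 <= k2 by have := vk 0%N; rewrite divr1; apply: le_trans; exact: abs_ge0.
rewrite (sum_triangle _ (fun k j => u k * v j)) mulr_suml -sumrB.
apply: le_trans (abs_sum absP _ _ _) _.
apply: (@le_trans _ _ (\sum_(i < N) \sum_(j < N) k1 * k2 / 8 ^+ N)); last first.
  rewrite !sumr_const !card_ord -mulrnA -[_ *+ (N * N)]mulr_natr -mulrA ler_wpM2l ?mulr_ge0 //.
  rewrite mulrC ler_pdivrMr ?exprn_gt0 // mulrC ler_pdivlMr ?exprn_gt0 //.
  rewrite -!natrX -natrM ler_nat.
  have -> : (8 ^ N = 2 ^ N * 2 ^ N * 2 ^ N)%N by rewrite -!expnMn.
  by rewrite leq_mul2r leq_mul ?orbT // ltnW // ltn_expl.
apply: ler_sum => i _; rewrite mulr_sumr.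
rewrite [X in _ - X](big_ord_widen N (fun j => u i * v j)) ?leq_subr // [X in _ - X]big_mkcond /= -sumrB.
apply: le_trans (abs_sum absP _ _ _) _; apply: ler_sum => j _.
case: ltnP => Nij; first by rewrite subrr (abs0 absP) divr_ge0 ?mulr_ge0 ?exprn_ge0.
rewrite subr0 (absM absP); apply: le_trans (ler_pM _ _ (uk i) (vk j)) _.
- exact: abs_ge0.
- exact: abs_ge0.
rewrite mulrACA -invfM -exprD ler_wpM2l ?mulr_ge0 // lef_pV2 ?posrE ?exprn_gt0 //.
by rewrite ler_eXn2l ?ltr1n // -leq_subLR.
Qed.

Lemma csum_cauchy_product u v k1 k2 a b :
  (forall n, cabs (u n) <= k1 / 8 ^+ n) -> (forall n, cabs (v n) <= k2 / 8 ^+ n) ->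
  csum u a -> csum v b ->
  csum (fun n => \sum_(k < n.+1) u k * v (n - k)%N) (a * b).
Proof.
move=> uk vk ua vb e e0.
pose D := cabs a + cabs b + 1.
have D0 : 0 < D by rewrite ltr_wpDl // addr_ge0 ?(abs_ge0 absP).
(* For partial sums A, B within d <= 1 of a, b, the error of A B is at most d (|a| + |b| + d) <= d
   D. *)
pose d := Num.min 1 (e / (2 * D)).
have d0 : 0 < d by rewrite lt_min ltr01 divr_gt0 // mulr_gt0.
have d1 : d <= 1 by rewrite ge_min lexx.
have dD : d * D <= e / 2.
  rewrite -ler_pdivlMr // -mulrA -invfM ge_min lexx orbT //.
have [N1 H1] := ua _ d0; have [N2 H2] := vb _ d0.
have [N3 H3] := @pow2_large R (k1 * k2) (e / 2) (divr_gt0 e0 (ltr0Sn _ _)).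
exists (maxn N1 (maxn N2 N3)) => n; rewrite !geq_max => /and3P[n1 n2 n3].
have h1 := H1 n n1; have h2 := H2 n n2; have h3 := H3 n n3.
have h4 := cauchy_product_defect n uk vk.
move: h1 h2 h4; set A := \sum_(i < n) u i; set B := \sum_(i < n) v i.
set S := \sum_(n' < n) _ => h1 h2 h4.
rewrite (_ : S - a * b = (S - A * B) + ((A - a) * B + a * (B - b))); last by ring.
apply: le_trans (absD absP _ _) _; rewrite [e]splitr lerD //.
  rewrite cabsB; apply: le_trans h4 _; rewrite ler_pdivrMr ?exprn_gt0 //.
apply: le_trans (absD absP _ _) _; rewrite !(absM absP).
have a0 := abs_ge0 absP a.
have Bb : cabs B <= cabs b + d.
  rewrite (_ : B = b + (B - b)); last by ring.
  by apply: le_trans (absD absP _ _) _; rewrite lerD2l.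
have g1 : cabs (A - a) * cabs B <= d * (cabs b + d) by apply: ler_pM; rewrite ?(abs_ge0 absP).
have g2 : cabs a * cabs (B - b) <= cabs a * d by rewrite ler_wpM2l.
apply: le_trans (lerD g1 g2) _; apply: le_trans dD; rewrite /D.
have : d * d <= d * 1 by rewrite ler_pM2l.
lra.
Qed.

End ComplexSeries.

(** * Developments of the signature *)

Section Embedding.
Variable R : realType.
Implicit Types (a b : tseries 2 R) (dg : nat -> R[i]).
Let absP := cabs_absolute_value R.

Definition emb a : tseries 2 R[i] := fun w => (a w)%:C.

Lemma emb_tmul a b : emb (tmul a b) = tmul (emb a) (emb b).
Proof.
apply/funext => w; rewrite /emb /tmul rmorph_sum /=.
by apply: eq_bigr => k _; rewrite rmorphM.
Qed.

Lemma emb_shsum l n a : emb (shsum l n a) = shsum l n (emb a).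
Proof. by apply/funext => w; rewrite /emb /shsum rmorph_sum. Qed.

Lemma cabs_psi dg c j r w : 1 <= c -> (forall j, cabs (dg j) <= c) ->
  cabs (psi dg j r w) <= c ^+ size w.
Proof.
move=> c1 dc; have c0 : 0 <= c by apply: le_trans c1.
elim: w j r => [|i w IH] j r.
  by rewrite /= expr0; case: r => [|r]; rewrite ?(abs1 absP) ?(abs0 absP).
rewrite /= exprS; case: ifP => _.
  by rewrite (absM absP) ler_pM ?(abs_ge0 absP).
case: r => [|r]; first by rewrite (abs0 absP) mulr_ge0 ?exprn_ge0.
by apply: le_trans (IH _ _) _; rewrite ler_peMl ?exprn_ge0.
Qed.

Lemma cabs_lev dg c j r n a : 1 <= c -> (forall j, cabs (dg j) <= c) ->
  cabs (lev dg j r n (emb a)) <= c ^+ n * lnorm n a.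
Proof.
move=> c1 dc; apply: le_trans (abs_wsum absP _ _) _.
rewrite /lnorm -wsumZ; apply: ler_wsum => w sw.
by rewrite (absM absP) cabs_real ler_wpM2r // -sw cabs_psi.
Qed.

Lemma cauchy_coef_bound (u v : nat -> R[i]) k1 k2 y n :
  0 <= k1 -> 0 <= k2 -> 0 <= y ->
  (forall n, cabs (u n) <= k1 * y ^+ n) -> (forall n, cabs (v n) <= k2 * y ^+ n) ->
  cabs (\sum_(k < n.+1) u k * v (n - k)%N) <= n.+1%:R * (k1 * k2 * y ^+ n).
Proof.
move=> k10 k20 y0 uk vk; apply: le_trans (abs_sum absP _ _ _) _.
apply: (@le_trans _ _ (\sum_(k < n.+1) k1 * k2 * y ^+ n)); last first.
  by rewrite sumr_const card_ord mulr_natl.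
apply: ler_sum => k _; rewrite (absM absP).
apply: le_trans (ler_pM (abs_ge0 absP _) (abs_ge0 absP _) (uk k) (vk _)) _.
by rewrite mulrACA -exprD subnKC // -ltnS.
Qed.

Definition cis (y : R) : R[i] := cos y +i* sin y.

Lemma cisD x y : cis (x + y) = cis x * cis y.
Proof. by rewrite /cis cosD sinD; simpc; congr (_ +i* _); ring. Qed.

Lemma cis0 : cis 0 = 1.
Proof. by rewrite /cis cos0 sin0. Qed.

Lemma cabs_cis y : cabs (cis y) = 1.
Proof. by rewrite /cabs /cis /= cos2Dsin2 sqrtr1. Qed.

Lemma iX (y : R) n : (0 +i* y) ^+ n / n`!%:R = cos_coeff y n +i* sin_coeff y n.
Proof.
have E : n`!%:R^-1 = (n`!%:R^-1)%:C :> R[i] by rewrite fmorphV rmorph_nat.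
have H k : (0 +i* y) ^+ k.*2 = ((-1) ^+ k * y ^+ k.*2)%:C.
  elim: k => [|k IH]; first by rewrite !expr0 mulr1.
  by rewrite doubleS !exprS IH; simpc; congr (_ +i* _); ring.
rewrite E /cos_coeff /sin_coeff.
have [k [->|->]] : exists k, n = k.*2 \/ n = k.*2.+1.
  exists n./2; rewrite -{1 3}[n]odd_double_half.
  by case: (odd n); [right|left].
  by rewrite H /= odd_double doubleK; simpc; congr (_ +i* _); ring.
rewrite exprS H /= odd_double doubleK; simpc.
by rewrite [y ^+ k.*2.+1]exprS; congr (_ +i* _); ring.
Qed.

Lemma csum_cis (y : R) : csum (fun n => (0 +i* y) ^+ n / n`!%:R) (cis y).
Proof.
have -> : (fun n => (0 +i* y) ^+ n / n`!%:R) = (fun n => cos_coeff y n +i* sin_coeff y n).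
  by apply/funext => n; exact: iX.
have -> : cis y = limn (series (cos_coeff y)) +i* limn (series (sin_coeff y)).
  by rewrite /cis !unlock.
apply: csum_ReIm; [exact: is_cvg_series_cos_coeff|exact: is_cvg_series_sin_coeff].
Qed.

Lemma cabs_imag (y : R) : cabs (0 +i* y) = `|y|.
Proof. by rewrite /cabs /= expr0n add0r sqrtr_sqr. Qed.

End Embedding.

(** * Matrix developments of the time-changed signature *)

Section Developments.
Variables (R : realType) (T p : R).
Variables (Z : R -> R -> tseries 2 R) (x : R -> R).
Hypothesis p1 : 1 <= p.
Let P := Num.truncn p.
Let s (v w : R) := (w - v) `^ p^-1.
Hypothesis Z1 : forall v w, 0 <= v -> v <= w -> w <= T -> Z v w [::] = 1.
Hypothesis ZM : forall v u w y, 0 <= v -> v <= u -> u <= w -> w <= T ->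
  Z v w y = tmul (Z v u) (Z u w) y.
Hypothesis ZP : forall v w y, 0 <= v -> v <= w -> w <= T -> (0 < size y <= P)%N ->
  `|Z v w y| <= s v w ^+ size y.
Hypothesis Zneg : forall y, (P < size y)%N -> vanishing T (fun v w => `|Z v w y|).
Hypothesis ZL : forall v w, 0 <= v -> v <= w -> w <= T -> exists2 L, lie_poly L &
  forall y, (size y <= P)%N -> Z v w y = texp L y.
Hypothesis Zx : forall v w, 0 <= v -> v <= w -> w <= T -> Z v w [:: 0] = x w - x v.

Let p0 : 0 < p. Proof. exact: lt_le_trans p1. Qed.
Let P1 : (0 < P)%N. Proof. by rewrite truncn_gt0. Qed.
Let absP := cabs_absolute_value R.
Let s0 v w : 0 <= s v w. Proof. exact: powR_ge0. Qed.

(** s v w ^+ n is the length of the interval to the power n/p, and n > P gives n/p > 1. *)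
Lemma vanishing_scale n c : (P < n)%N -> vanishing T (fun v w => c * s v w ^+ n).
Proof.
move=> Pn; apply: (@vanishing_small _ _ _ id) => e e0.
pose t := p^-1 * n%:R - 1.
have t0 : 0 < t.
  rewrite subr_gt0 mulrC ltr_pdivlMr // mul1r.
  by apply: lt_le_trans (truncnS_gt _) _; rewrite ler_nat.
have c0 : 0 < `|c| + 1 by rewrite ltr_wpDl.
have [del del0 H] := powR_small t0 (divr_gt0 e0 c0).
exists del => // v w v0 vw wT wv; rewrite /= in wv *.
have wv0 : 0 <= w - v by rewrite subr_ge0.
have {}H := H _ wv0 wv.
rewrite /s -powR_mulrn ?powR_ge0 // -powRrM -mulr_powRB1 //; last first.
  by rewrite mulr_gt0 ?invr_gt0 // ltr0n (leq_ltn_trans _ Pn).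
apply: (@le_trans _ _ ((`|c| + 1) * ((w - v) * (w - v) `^ t))).
  rewrite ler_wpM2r ?mulr_ge0 ?powR_ge0 //; have := ler_norm c; lra.
by rewrite mulrCA mulrC ler_wpM2r // mulrC -ler_pdivlMr.
Qed.

(** Up to level P this is group-likeness. Above, the difference of the two sides is additive, by
    induction and the binomial theorem, and its dyadic sums vanish. *)
Lemma Z_nseq v w n : 0 <= v -> v <= w -> w <= T ->
  Z v w (nseq n 0) = (x w - x v) ^+ n / n`!%:R.
Proof.
elim/ltn_ind: n v w => n IH v w v0 vw wT.
have [nP|Pn] := leqP n P.
  have [L lL ZE] := ZL v0 vw wT.
  by rewrite ZE ?size_nseq // texp_nseq // -(ZE [:: 0]) // Zx.
case: n IH Pn => // n IH Pn.
apply/eqP; rewrite -subr_eq0; apply/eqP.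
pose f v w := Z v w (nseq n.+1 0) - (x w - x v) ^+ n.+1 / n.+1`!%:R.
apply: (@additive_eq0 _ T R Num.norm f) => //; first exact: normr_absolute_value.
  move=> {v0 vw wT} {}v u {}w v0 vu uw wT.
  have u0 := le_trans v0 vu; have uT := le_trans uw wT.
  rewrite /f; have -> : Z v w (nseq n.+1 0) =
      \sum_(k < n.+2) Z v u (nseq k 0) * Z u w (nseq (n.+1 - k) 0).
    rewrite (ZM _ v0 vu uw wT) /tmul size_nseq; apply: eq_bigr => k _.
    by rewrite take_nseq ?drop_nseq // -ltnS.
  rewrite (_ : x w - x v = (x w - x u) + (x u - x v)); last by ring.
  rewrite exprDn mulr_suml -sumrB.
  rewrite (sum_ends (fun k => Z v u (nseq k 0) * Z u w (nseq (n.+1 - k) 0) -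
    (x w - x u) ^+ (n.+1 - k) * (x u - x v) ^+ k *+ 'C(n.+1, k) / n.+1`!%:R)).
  rewrite Z1 // subn0 expr0 bin0 mulr1n mulr1 mul1r.
  rewrite subnn expr0 binn mulr1n mul1r [Z u w (nseq 0 0)]Z1 // mulr1.
  rewrite big1 ?addr0; first by rewrite addrC.
  move=> i _.
  have iltn : (i < n)%N by [].
  rewrite !IH //; last by rewrite subSS ltnS leq_subr.
  have ib : (i.+1 <= n.+1)%N by rewrite ltnW.
  have FE : n.+1`!%:R = 'C(n.+1, i.+1)%:R * (i.+1`!%:R * (n.+1 - i.+1)`!%:R) :> R.
    by rewrite -!natrM bin_fact.
  rewrite -[_ *+ 'C(n.+1, i.+1)]mulr_natr FE.
  have fact0 m : m`!%:R != 0 :> R by rewrite pnatr_eq0 -lt0n fact_gt0.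
  have bin0 : 'C(n.+1, i.+1)%:R != 0 :> R by rewrite pnatr_eq0 -lt0n bin_gt0.
  have h1 := fact0 i.+1; have h2 := fact0 (n.+1 - i.+1)%N.
  set y1 := i.+1`!%:R in h1 *; set y2 := (_ - _)`!%:R in h2 *; set y3 := 'C(_, _)%:R in bin0 *.
  by clearbody y1 y2 y3; field; rewrite h1 h2 bin0.
have Pn' : (P < size (nseq n.+1 (0%R : 'I_2)))%N by rewrite size_nseq.
apply: vanishing_le (vanishingD (Zneg Pn') (@vanishing_scale n.+1 1 Pn)).
move=> {v0 vw wT} {}v {}w v0 vw wT; rewrite /f mul1r.
apply: le_trans (ler_normB _ _) _; rewrite lerD2l -(Zx v0 vw wT).
rewrite normrM normrX normfV normr_nat ler_pdivrMr ?ltr0n ?fact_gt0 //.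
apply: le_trans (_ : s v w ^+ n.+1 * 1 <= _); last by rewrite ler_wpM2l ?exprn_ge0 // ler1n fact_gt0.
rewrite mulr1; apply: lerXn2r; rewrite ?nnegrE //.
by apply: le_trans (ZP v0 vw wT _) _.
Qed.

Variables (dl : nat -> R) (c : R).
Hypothesis c1 : 1 <= c.
Hypothesis dlc : forall j, `|dl j| <= c.
Let dg j : R[i] := 0 +i* dl j.

Let dgc j : cabs (dg j) <= c. Proof. by rewrite cabs_imag. Qed.
Let dgNc k j : cabs ((fun _ : nat => - dg k) j) <= c. Proof. by rewrite cabsN. Qed.

Let S := 1 + T `^ p^-1.

Let S1 : 1 <= S. Proof. by rewrite lerDl powR_ge0. Qed.

Let sS v w : 0 <= v -> v <= w -> w <= T -> s v w <= S.
Proof.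
move=> v0 vw wT; apply: (@le_trans _ _ (T `^ p^-1)); last by rewrite lerDr.
have p10 : 0 <= p^-1 by rewrite invr_ge0 ltW.
by apply: ge0_ler_powR => //; rewrite ?nnegrE; lra.
Qed.

(* rho is chosen so small that all the series below are dominated by 8^-n. *)
Let bound : exists kap rho, [/\ 0 < kap, 0 < rho, rho * S <= 8^-1 &
  forall dh j r n v w, (forall j, cabs (dh j) <= c) -> 0 <= v -> v <= w -> w <= T ->
    cabs (lev dh j r n (emb (Z v w))) <= kap * (rho * s v w) ^+ n].
Proof.
have c0 : 0 < c by apply: lt_le_trans c1.
have S0 : 0 < S by apply: lt_le_trans S1.
pose K := (8 * S * c)^-1.
have K0 : 0 < K by rewrite invr_gt0 !mulr_gt0.
have [kap kap0 H] := lnorm_decay p1 Z1 ZM ZP Zneg K0.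
exists (1 + kap), (c * K); split => //.
- by rewrite addr_gt0.
- by rewrite mulr_gt0.
- by rewrite /K le_eqVlt; apply/orP; left; apply/eqP; field; rewrite !gt_eqF.
move=> dh j r [|n] v w dhc v0 vw wT.
  rewrite expr0 mulr1; apply: le_trans (cabs_lev _ _ _ _ c1 dhc) _.
  by rewrite /lnorm /= Z1 // normr1 mulr1 expr0 lerDl ltW.
apply: le_trans (cabs_lev _ _ _ _ c1 dhc) _.
have h := H n.+1 v w erefl v0 vw wT.
apply: le_trans (ler_wpM2l (exprn_ge0 _ (ltW c0)) h) _.
rewrite !exprMn [leLHS](_ : _ = kap * (c ^+ n.+1 * K ^+ n.+1 * s v w ^+ n.+1)); last by rewrite /s; ring.
by rewrite ler_wpM2r ?lerDr // !mulr_ge0 ?exprn_ge0 // ltW.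
Qed.

Lemma lev_emb_bound : exists k, forall dh j r n v w, (forall j, cabs (dh j) <= c) ->
   0 <= v -> v <= w -> w <= T -> cabs (lev dh j r n (emb (Z v w))) <= k / 8 ^+ n.
Proof.
have [kap [rho [kap0 rho0 rhoS H]]] := bound.
exists kap => dh j r n v w dhc v0 vw wT; apply: le_trans (H dh j r n v w dhc v0 vw wT) _.
rewrite ler_pM2l // -exprVn; apply: lerXn2r; rewrite ?nnegrE ?invr_ge0 //.
  by rewrite mulr_ge0 // ltW.
by apply: le_trans rhoS; rewrite ler_pM2l // sS.
Qed.

(** The default value 0 of [xget] is not reached for 0 <= v <= w <= T: the series converges by
    [devP], and its sum is unique. *)
Definition dev v w j r : R[i] := xget 0 [set l : R[i] | csum (fun n => lev dg j r n (emb (Z v w))) l].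

Lemma devP v w j r : 0 <= v -> v <= w -> w <= T ->
  csum (fun n => lev dg j r n (emb (Z v w))) (dev v w j r).
Proof.
move=> v0 vw wT; have [k H] := lev_emb_bound.
have [l Hl] := csum_geometric_ex (fun n => H dg j r n v w dgc v0 vw wT).
exact: (xgetPex 0 (ex_intro _ l Hl)).
Qed.

Lemma devM v u w j r : 0 <= v -> v <= u -> u <= w -> w <= T ->
  dev v w j r = \sum_(i < r.+1) dev v u j i * dev u w (j + i) (r - i).
Proof.
move=> v0 vu uw wT; have u0 := le_trans v0 vu; have uT := le_trans uw wT.
apply: csum_unique (devP j r v0 (le_trans vu uw) wT) _.
have -> : (fun n => lev dg j r n (emb (Z v w))) = (fun n => \sum_(i < r.+1)
    \sum_(k < n.+1) lev dg j i k (emb (Z v u)) * lev dg (j + i) (r - i) (n - k) (emb (Z u w))).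
  apply/funext => n; rewrite exchange_big /= -lev_tmul -emb_tmul.
  apply: eq_lev => // y _; by rewrite /emb (ZM _ v0 vu uw wT).
apply: csum_sum => i; have [k H] := lev_emb_bound.
apply: (csum_cauchy_product (u := fun n => lev dg j i n (emb (Z v u)))
  (v := fun n => lev dg (j + i) (r - i) n (emb (Z u w))) (k1 := k) (k2 := k)).
- by move=> n; apply: H.
- by move=> n; apply: H.
- exact: devP.
- exact: devP.
Qed.

Lemma dev0 v w j : 0 <= v -> v <= w -> w <= T ->
  dev v w j 0 = cis (dl j * (x w - x v)).
Proof.
move=> v0 vw wT; apply: csum_unique (devP j 0 v0 vw wT) _.
have := csum_cis (dl j * (x w - x v)).
congr csum; apply/funext => n; rewrite lev0 /emb Z_nseq //.
rewrite rmorphM /= fmorphV rmorph_nat rmorphXn /= mulrA -exprMn.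
by congr (_ ^+ _ / _); rewrite /dg; simpc.
Qed.

Definition hol v w j r : R[i] :=
  cis (dl j * x v) * dev v w j r * cis (- (dl (j + r)%N * x w)).

Lemma holM v u w j r : 0 <= v -> v <= u -> u <= w -> w <= T ->
  hol v w j r = \sum_(i < r.+1) hol v u j i * hol u w (j + i) (r - i).
Proof.
move=> v0 vu uw wT; rewrite /hol (devM _ _ v0 vu uw wT) mulr_sumr mulr_suml.
apply: eq_bigr => i _; rewrite -addnA subnKC; last by rewrite -ltnS.
have E : cis (- (dl (j + i)%N * x u)) * cis (dl (j + i)%N * x u) = 1.
  by rewrite -cisD addNr cis0.
rewrite -[LHS]mulr1 -E; ring.
Qed.

Lemma hol0 v w j : 0 <= v -> v <= w -> w <= T -> hol v w j 0 = 1.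
Proof.
move=> v0 vw wT; rewrite /hol dev0 // addn0 -!cisD -[RHS]cis0; congr cis; ring.
Qed.

(* By the shuffle relations, multiplying dev by cis (- (dl (j + r) * (x w - x v)))
   amounts, up to level P, to shifting the diagonal by - dg (j + r). *)
Definition loc v w j r : R[i] := cis ((dl j - dl (j + r)%N) * x v) *
  \sum_(n < P.+1) lev (dshift dg (- dg (j + r)%N)) j r n (emb (Z v w)).

(** Degree n of the product of [dev v w j r] with e^(-d_(j+r) (x w - x v)). The second factor is the
    image of Z v w under the one-dimensional representation sending e_1 to -d_(j+r), hence a series
    of [lev] terms. *)
Let prod_coef v w j r n : R[i] := \sum_(k < n.+1) lev dg j r k (emb (Z v w)) *
   lev (fun=> - dg (j + r)%N) 0 0 (n - k) (emb (Z v w)).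

(** In degrees up to P, Z v w is group-like: [lev_shift] expands the shifted diagonal into shuffles
    with 0^k, and [shsum_texp] factors each of them. *)
Let prod_coefE v w j r n : 0 <= v -> v <= w -> w <= T -> (n <= P)%N ->
  prod_coef v w j r n = lev (dshift dg (- dg (j + r)%N)) j r n (emb (Z v w)).
Proof.
move=> v0 vw wT nP; have [L lL ZE] := ZL v0 vw wT.
have EZ m dh j' r' : (m <= n)%N -> lev dh j' r' m (emb (Z v w)) = lev dh j' r' m (emb (texp L)).
  by move=> mn; apply: eq_lev => // y sy; rewrite /emb ZE // sy (leq_trans mn).
rewrite EZ // lev_shift /prod_coef (reindex_inj rev_ord_inj) /=.
apply: eq_bigr => k _; rewrite subSS subKn; last by rewrite -ltnS.
rewrite !EZ ?leq_subr //; last by rewrite -ltnS.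
rewrite -emb_shsum shsum_texp // lev0 mulrCA; congr (_ * _).
rewrite [emb (texp L) _]/emb texp_nseq // texp1; last exact: lie_nil.
rewrite mulrC /lev -wsumZ; apply: eq_wsum => y _.
by rewrite /emb /tscale rmorphM /=; ring.
Qed.

(** Up to a phase, the difference is the tail of a product series beyond degree P. Its terms are at
    most (n + 1) kap^2 (rho s)^n with rho s <= 1/8, so s^(P+1) can be taken out of a convergent
    sum. *)
Lemma hol_loc j r : exists C, forall v w, 0 <= v -> v <= w -> w <= T ->
  cabs (hol v w j r - loc v w j r) <= C * s v w ^+ P.+1.
Proof.
have [kap [rho [kap0 rho0 rhoS H]]] := bound.
have [k8 H8] := lev_emb_bound.
exists (2 * (P.+2%:R * (kap * kap))) => v w v0 vw wT.
have dgNc' := dgNc (j + r).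
have cs : csum (prod_coef v w j r) (dev v w j r * cis (- (dl (j + r)%N * (x w - x v)))).
  apply: (csum_cauchy_product (u := fun n => lev dg j r n (emb (Z v w)))
    (v := fun n => lev (fun=> - dg (j + r)%N) 0 0 n (emb (Z v w))) (k1 := k8) (k2 := k8)).
  - by move=> n; apply: H8.
  - by move=> n; apply: H8.
  - exact: devP.
  have := csum_cis (- (dl (j + r)%N * (x w - x v))).
  congr csum; apply/funext => n; rewrite lev0 /emb Z_nseq //.
  rewrite rmorphM /= fmorphV rmorph_nat rmorphXn /= mulrA -exprMn.
  by congr (_ ^+ _ / _); rewrite /dg; simpc; rewrite ?mulNr.
have -> : hol v w j r - loc v w j r = cis ((dl j - dl (j + r)%N) * x v) *
   (dev v w j r * cis (- (dl (j + r)%N * (x w - x v))) - \sum_(n < P.+1) prod_coef v w j r n).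
  rewrite mulrBr /loc; congr (_ - _ * _); last first.
    by apply: eq_bigr => n _; rewrite prod_coefE // -ltnS.
  rewrite /hol (_ : - (dl (j + r)%N * x w) = - (dl (j + r)%N * x v) + - (dl (j + r)%N * (x w - x v))); last by ring.
  rewrite (_ : (dl j - dl (j + r)%N) * x v = dl j * x v + - (dl (j + r)%N * x v)); last by ring.
  by rewrite !cisD; ring.
rewrite (absM absP) cabs_cis mul1r -mulrA; apply: (csum_tail cs) => n.
have y0 : 0 <= rho * s v w by rewrite mulr_ge0 // ltW.
apply: le_trans (@cauchy_coef_bound R (fun n => lev dg j r n (emb (Z v w)))
  (fun n => lev (fun=> - dg (j + r)%N) 0 0 n (emb (Z v w))) _ _ _ _ (ltW kap0) (ltW kap0) y0 _ _) _.
- by move=> m; apply: H.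
- by move=> m; apply: H.
have rho1 : rho <= 1.
  apply: le_trans (_ : rho * S <= _); first by rewrite ler_peMr // ltW.
  by apply: le_trans rhoS _; rewrite invf_le1 ?ltr0n // ler1n.
have y8 : rho * s v w <= 8^-1.
  by apply: le_trans rhoS; rewrite ler_pM2l // sS.
rewrite exprD.
have h1 : (rho * s v w) ^+ P.+1 <= s v w ^+ P.+1.
  by apply: lerXn2r; rewrite ?nnegrE // ler_piMl.
have h2 : (rho * s v w) ^+ n <= 8^-1 ^+ n.
  by apply: lerXn2r; rewrite ?nnegrE ?invr_ge0.
have h3 : (P.+1 + n).+1%:R <= P.+2%:R * 2 ^+ n :> R.
  rewrite -natrX -natrM ler_nat -addSn.
  apply: (@leq_trans (P.+2 * n.+1)); last by rewrite leq_mul2l ltn_expl // orbT.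
  by rewrite mulnS leq_add2l leq_pmull.
apply: (@le_trans _ _ (P.+2%:R * 2 ^+ n * (kap * kap * (s v w ^+ P.+1 * 8^-1 ^+ n)))).
  have kk : 0 <= kap * kap by rewrite mulr_ge0 // ltW.
  apply: ler_pM => //; first by rewrite !mulr_ge0 ?exprn_ge0 // ltW.
  by rewrite ler_wpM2l // ler_pM ?exprn_ge0.
apply: (@le_trans _ _ (P.+2%:R * (kap * kap) * s v w ^+ P.+1 * (2 ^+ n * 8^-1 ^+ n))).
  by rewrite le_eqVlt; apply/orP; left; apply/eqP; ring.
rewrite [leRHS](_ : _ = P.+2%:R * (kap * kap) * s v w ^+ P.+1 * 2^-1 ^+ n); last by rewrite exprVn; ring.
have h4 : 2 ^+ n * 8^-1 ^+ n <= 2^-1 ^+ n :> R.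
  have h5 : 2 * 8^-1 <= 2^-1 :> R.
    by rewrite ler_pdivrMr // mulrC ler_pdivlMr // -natrM ler_nat.
  by rewrite -exprMn; apply: lerXn2r => //; rewrite nnegrE ?mulr_ge0 ?invr_ge0.
by apply: ler_wpM2l h4; rewrite !mulr_ge0 ?exprn_ge0 //; exact: ltW.
Qed.

Lemma loc_large v w j r : (P < r)%N -> loc v w j r = 0.
Proof.
move=> Pr; rewrite /loc big1 ?mulr0 // => n _.
by rewrite lev_small // (leq_trans (ltn_ord n)).
Qed.

(** Induction on r: when the lower off-diagonals agree, all middle terms of the two products cancel,
    and the difference at distance r is additive. Both families are close to [loc], so it is zero by
    [additive_eq0]. *)
Lemma hol_unique m (b : R -> R -> nat -> nat -> R[i]) :
  (forall v w j, 0 <= v -> v <= w -> w <= T -> (j <= m)%N -> b v w j 0 = 1) ->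
  (forall v u w j r, 0 <= v -> v <= u -> u <= w -> w <= T -> (j + r <= m)%N ->
     b v w j r = \sum_(i < r.+1) b v u j i * b u w (j + i)%N (r - i)%N) ->
  (forall j r, (j + r <= m)%N -> (0 < r)%N ->
     vanishing T (fun v w => cabs (b v w j r - loc v w j r))) ->
  forall v w j r, 0 <= v -> v <= w -> w <= T -> (j + r <= m)%N ->
    b v w j r = hol v w j r.
Proof.
move=> b0 bM bn v w j r v0 vw wT; elim/ltn_ind: r j v w v0 vw wT => r IH j v w v0 vw wT jr.
case: r IH jr => [|r] IH jr; first by rewrite b0 ?hol0 // -(addn0 j).
apply/eqP; rewrite -subr_eq0; apply/eqP.
apply: (@additive_eq0 _ T _ (@cabs R) (fun v w => b v w j r.+1 - hol v w j r.+1)) => //.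
  move=> {v0 vw wT} {}v u {}w v0 vu uw wT.
  have u0 := le_trans v0 vu; have uT := le_trans uw wT.
  rewrite (bM _ _ _ _ _ v0 vu uw wT jr) (holM _ _ v0 vu uw wT) -sumrB.
  have jm : (j <= m)%N by apply: leq_trans jr; exact: leq_addr.
  rewrite (sum_ends (fun i => b v u j i * b u w (j + i)%N (r.+1 - i)%N -
    hol v u j i * hol u w (j + i)%N (r.+1 - i)%N)).
  rewrite addn0 subn0 subnn !b0 // !hol0 // !mul1r !mulr1.
  rewrite big1 ?addr0; first by rewrite addrC.
  move=> i _; rewrite subSS.
  have ir : (i < r)%N := ltn_ord i.
  rewrite !IH ?subrr // ?ltnS ?leq_subr //.
    by rewrite -addnA addSn subnKC // ltnW.
  by apply: leq_trans jr; rewrite leq_add2l ltnW.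
have [C HC] := hol_loc j r.+1.
apply: vanishing_le (vanishingD (bn j r.+1 jr erefl) (@vanishing_scale P.+1 C (ltnSn _))).
move=> {v0 vw wT} {}v {}w v0 vw wT.
rewrite (_ : _ - _ = (b v w j r.+1 - loc v w j r.+1) - (hol v w j r.+1 - loc v w j r.+1)); last by ring.
by apply: le_trans (absD absP _ _) _; rewrite lerD2l cabsN HC.
Qed.

End Developments.

(** * The rough integral *)

Section TimeChangedFunctionals.
Variables (R : realType) (p T : R) (tau V : R -> R).
Hypothesis p1 : 1 <= p.
Let P := Num.truncn p.
Hypothesis tauP : forall v w, 0 <= v -> v <= w -> w <= T ->
  [/\ 0 <= tau v, tau v <= tau w, tau w <= 1 & tau w - tau v <= w - v].
Hypothesis tauV : forall v w e, 0 <= v -> v <= w -> w <= T -> tau v < tau w -> 0 < e ->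
  exists s t, [/\ tau v < s <= tau v + e, s < t, tau w - e <= t <= tau w &
    V t - V s <= w - v].

(** Write f = f^(1-q) f^q: the second factor is bounded by increments of W, the first is small on
    short intervals, and tau does not lengthen intervals. *)
Lemma vanishing_powR (f : R -> R -> R) (q : R) (W : R -> R) :
  0 < q -> q < 1 ->
  (forall s t, 0 <= s -> s <= t -> t <= 1 -> 0 <= f s t) ->
  (forall s t, 0 <= s -> s <= t -> t <= 1 -> f s t `^ q <= W t - W s) ->
  (forall e, 0 < e -> exists2 del, 0 < del & forall s t, 0 <= s -> s <= t -> t <= 1 ->
     t - s < del -> f s t < e) ->
  vanishing T (fun v w => f (tau v) (tau w)).
Proof.
move=> q0 q1 f0 fW fs; apply: (@vanishing_small _ _ _ (W \o tau)) => e e0.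
have q10 : 0 < 1 - q by rewrite subr_gt0.
have [e' e'0 He'] := powR_small q10 e0.
have [del del0 H] := fs _ e'0.
exists del => // v w v0 vw wT wv /=.
have [tv tvw tw twv] := tauP v0 vw wT.
have fe := H _ _ tv tvw tw (le_lt_trans twv wv).
have ff := f0 _ _ tv tvw tw.
have {}He' := He' _ ff fe.
rewrite -[leLHS]powRr1 // -[1](subrK q) powRD; last by rewrite subrK oner_eq0.
apply: ler_pM; rewrite ?powR_ge0 //; exact: fW.
Qed.

(** Finite p-variation controls the power p/n of level n, and p/n < 1 above level P, so
    [vanishing_powR] applies. *)
Lemma vanishing_level (K : numFieldType) (abs : K -> R) d N
    (X : R -> R -> tseries d K) (y : seq 'I_d) :
  absolute_value abs ->
  (forall e : R, 0 < e -> exists2 e' : K, 0 < e' & forall a, `|a| < e' -> abs a < e) ->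
  mult_functional abs p N X -> (P < size y <= N)%N ->
  vanishing T (fun v w => abs (X (tau v) (tau w) y)).
Proof.
move=> absP abs_cont mX /andP[Py yN].
have y0 : (0 < size y)%N by apply: leq_ltn_trans Py.
have yn : y != [::] by rewrite -size_eq0 -lt0n.
have [W HW] := level_pvar_function (mult_functional_level mX (n := size y) (introT andP (conj y0 yN))).
have p0 : 0 < p by apply: lt_le_trans p1.
have yp : p < (size y)%:R.
  by apply: lt_le_trans (truncnS_gt _) _; rewrite ler_nat.
have yR : 0 < (size y)%:R :> R by rewrite ltr0n.
have diag s : 0 <= s <= 1 -> X s s y = 0 by move=> s01; apply: (mult_functional_diag mX).
apply: (@vanishing_powR (fun s t => abs (X s t y)) (p / (size y)%:R) W).
- by rewrite divr_gt0.
- by rewrite ltr_pdivrMr // mul1r.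
- by move=> s t _ _ _; apply: abs_ge0.
- move=> s t s0; rewrite le_eqVlt => /orP[/eqP <- s1|st t1].
    rewrite diag ?s0 // (abs0 absP) subrr powR0 //.
    by rewrite mulf_neq0 ?invr_eq0 ?gt_eqF.
  apply: le_trans (HW s t s0 st t1); apply: ge0_ler_powR.
  - by rewrite divr_ge0 // ltW.
  - by rewrite nnegrE; apply: abs_ge0.
  - by rewrite nnegrE; apply: pnorm_ge0.
  - exact: abs_le_pnorm.
move=> e e0; have [e' e'0 He'] := abs_cont e e0.
have [_ Xc _ _] := mX.
have [del del0 H] := diagonal_small (Xc y yN) diag e'0.
by exists del => // s t s0 st t1 ts; apply/He'/H.
Qed.

(** As V may jump, its increment is controlled only at points s < t close to tau v and tau w;
    continuity of X carries the bound to the end points. *)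
Lemma time_changed_bound d (X : R -> R -> tseries d R) (y : seq 'I_d) v w :
  mult_functional (@Num.norm R R) p P X ->
  (forall s t, 0 <= s -> s < t -> t <= 1 ->
    forall y, (0 < size y <= P)%N -> `|X s t y| <= ((V t - V s) `^ p^-1) ^+ size y) ->
  0 <= v -> v <= w -> w <= T -> (0 < size y <= P)%N ->
  (forall s t, 0 <= s -> s < t -> t <= 1 -> 0 <= V t - V s) ->
  `|X (tau v) (tau w) y| <= ((w - v) `^ p^-1) ^+ size y.
Proof.
move=> mX XV v0 vw wT /[dup] yP /andP[y0 yN] V0.
have [tv tvw tw twv] := tauP v0 vw wT.
have yn : y != [::] by rewrite -size_eq0 -lt0n.
move: tvw; rewrite le_eqVlt => /orP[/eqP tE|tvw].
  rewrite tE (mult_functional_diag mX) // ?normr0 ?exprn_ge0 ?powR_ge0 //.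
  by rewrite tw -tE tv.
apply/ler_addgt0Pr => e e0.
have [_ Xc _ _] := mX.
have /subspace_continuousP cf := Xc y yN.
have sx : @simplex R (tau v, tau w) by rewrite /simplex /= tv tw ltW.
have /cvgrPdist_lt/(_ e e0) := cf _ sx.
rewrite /from_subspace near_withinE => /nbhs_ballP[r /= r0 rf].
have r20 : 0 < r / 2 by rewrite divr_gt0.
have [s [t [/andP[s1 s2] st /andP[t1 t2] Vst]]] := tauV v0 vw wT tvw r20.
have s0 : 0 <= s by apply: le_trans tv (ltW s1).
have tle1 : t <= 1 by apply: le_trans tw.
have r2 : r / 2 < r by rewrite ltr_pdivrMr // ltr_pMr // ltr1n.
have h : `|X (tau v) (tau w) y - X s t y| < e.
  have sst : @simplex R (s, t) by rewrite /simplex /= s0 tle1 ltW.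
  have Hb : ball (tau v, tau w) r (s, t).
    by split; rewrite /ball /= ltr_distlC; apply/andP; split; lra.
  exact: rf _ Hb sst.
have Xst := XV s t s0 st tle1 y yP.
have mono : ((V t - V s) `^ p^-1) ^+ size y <= ((w - v) `^ p^-1) ^+ size y.
  apply: lerXn2r; rewrite ?nnegrE ?powR_ge0 //.
  have pV : 0 <= p^-1 by rewrite invr_ge0; apply: le_trans p1.
  apply: ge0_ler_powR => //; rewrite nnegrE ?subr_ge0 //.
  by have := V0 s t s0 st tle1; rewrite subr_ge0.
rewrite -[X in `|X|](subrK (X s t y)).
apply: le_trans (ler_normD _ _) _; rewrite addrC lerD //; last exact: ltW.
exact: le_trans mono.
Qed.

End TimeChangedFunctionals.

(** * Derivatives of the exponential one-form *)

Section Jets.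
Variable R : realType.
Implicit Types (al : R) (k : R[i]) (u : seq (ordinal 2)).

Lemma derive_coord0 (g : R -> R) (z : 'rV[R]_2) :
  'D_(delta_mx 0 0) (fun z : 'rV[R]_2 => g (z 0 0)) z = 'D_1 g (z 0 0).
Proof.
rewrite /derive (_ : (fun h => _) = (fun h : R => h^-1 *: (g (h *: 1 + z 0 0) - g (z 0 0)))) //.
by apply/funext => h /=; rewrite !mxE eqxx mulr1 [h%:A]mulr1.
Qed.

Lemma derive_coord1 (g : R -> R) (z : 'rV[R]_2) :
  'D_(delta_mx 0 1) (fun z : 'rV[R]_2 => g (z 0 0)) z = 0.
Proof.
rewrite /derive (_ : (fun h => _) = cst 0); first exact: lim_cst.
by apply/funext => h /=; rewrite !mxE /= mulr0 add0r subrr scaler0.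
Qed.

Lemma derive_trig al (k1 k2 x : R) :
  'D_1 (fun x => k1 * cos (al * x) - k2 * sin (al * x)) x =
  - (al * k1) * sin (al * x) - al * k2 * cos (al * x).
Proof.
have dm : is_derive x 1 (fun x => al * x) al.
  have -> : (fun x => al * x) = al *: (@id R) by [].
  by rewrite -[X in is_derive _ _ _ X]mulr1; exact: is_deriveZ.
have dc : is_derive x 1 (fun x => cos (al * x)) (- sin (al * x) * al).
  exact: (is_derive1_comp (f := cos) (g := fun x => al * x)).
have ds : is_derive x 1 (fun x => sin (al * x)) (cos (al * x) * al).
  exact: (is_derive1_comp (f := sin) (g := fun x => al * x)).
have H : is_derive x 1 (fun x => k1 * cos (al * x) - k2 * sin (al * x))
   (k1 *: (- sin (al * x) * al) - k2 *: (cos (al * x) * al)).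
  exact: (is_deriveB (is_deriveZ k1 dc) (is_deriveZ k2 ds)).
by rewrite derive_val /GRing.scale /=; ring.
Qed.

(** A family closed under differentiation: d/dx multiplies k by i al. The values k = 1 and k = -i
    give the real and imaginary parts of e^(i al x). *)
Let trig al k (z : 'rV[R]_2) : R := complex.Re (k * cis (al * z 0 0)).

Lemma pderive0 u (z : 'rV[R]_2) : pderive u (fun=> 0 : R) z = 0.
Proof.
elim: u => [|i u IH] //=.
by rewrite (_ : 'D_(delta_mx 0 i) (fun=> 0) = fun=> 0) //; apply/funext => y; rewrite derive_cst.
Qed.

Lemma pderive_trig al k n : pderive (nseq n 0) (trig al k) = trig al (k * (0 +i* al) ^+ n).
Proof.
elim: n k => [|n IH] k; first by rewrite expr0 mulr1.
rewrite /= (_ : 'D_(delta_mx 0 0) (trig al k) = trig al (k * (0 +i* al))); first by rewrite IH exprS mulrA.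
apply/funext => z; case: k => k1 k2.
have -> : trig al (k1 +i* k2) = fun z : 'rV[R]_2 => k1 * cos (al * z 0 0) - k2 * sin (al * z 0 0).
  by apply/funext => y; rewrite /trig /cis; simpc.
rewrite (derive_coord0 (fun x => k1 * cos (al * x) - k2 * sin (al * x))) derive_trig.
by rewrite /trig /cis; simpc => /=; ring.
Qed.

Lemma pderive_trig_eq0 al k u z : 1 \in u -> pderive u (trig al k) z = 0.
Proof.
elim: u k => // i u IH k; rewrite inE /= => h.
have [i0|i1] : i = 0 \/ i = 1.
  by case: i {h} => -[|[|//]] hi; [left|right]; apply: val_inj.
  rewrite i0 (_ : 'D_(delta_mx 0 0) (trig al k) = trig al (k * (0 +i* al) ^+ 1)); last first.
    exact: (pderive_trig al k 1).
  by apply: IH; move: h; rewrite i0.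
rewrite i1 (_ : 'D_(delta_mx 0 1) (trig al k) = fun=> 0); first exact: pderive0.
apply/funext => y; exact: (derive_coord1 (fun x => complex.Re (k * cis (al * x)))).
Qed.

Lemma cexp_imag al (x : R) : cexp ((0 +i* al) * x%:C) = cis (al * x).
Proof.
have -> : (0 +i* al) * x%:C = 0 +i* (al * x) by simpc.
by rewrite /cexp /= expR0 mul1r.
Qed.

Lemma cpderive_cis u al z : cpderive u (fun z => cis (al * z 0 0)) z =
  pderive u (trig al 1) z +i* pderive u (trig al (0 +i* -1)) z.
Proof.
have -> : trig al 1 = fun z : 'rV[R]_2 => complex.Re (cis (al * z 0 0)).
  by apply/funext => y; rewrite /trig mul1r.
have -> : trig al (0 +i* -1) = fun z : 'rV[R]_2 => complex.Im (cis (al * z 0 0)).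
  by apply/funext => y; rewrite /trig /cis /=; ring.
by [].
Qed.

Lemma jet_rcons d m (F : one_form R d.+1 m) z (u : seq 'I_d.+1) l j :
  jet F z (rcons u l) j = cpderive u (fun z => F z l j) z.
Proof. by case: u => [|i u] //=; rewrite belast_rcons last_rcons. Qed.

Variables (m : nat) (a : 'I_m -> R[i]) (th : 'I_m -> R).
Hypothesis aE : forall j, a j = 0 +i* th j.

Let exp_form1 j : (fun z => exp_form a z 1 j) = (fun z => cis (th j * z 0 0)).
Proof. by apply/funext => z; rewrite /exp_form eqxx aE cexp_imag. Qed.

Lemma jet_exp_form z n j :
  jet (exp_form a) z (rcons (nseq n 0) 1) j = a j ^+ n * cis (th j * z 0 0).
Proof.
rewrite jet_rcons exp_form1 cpderive_cis !pderive_trig mul1r -aE.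
rewrite /trig; set x := a j ^+ n; case: x => x y; rewrite /cis; simpc.
by congr (_ +i* _); rewrite /=; ring.
Qed.

(** The form has only a dy component, so the last letter must be 1, and its coefficient depends on x
    alone, so all other letters must be 0. *)
Lemma jet_exp_form_eq0 z w j : (forall n, w <> rcons (nseq n 0) 1) ->
  jet (exp_form a) z w j = 0.
Proof.
case/lastP: w => [|u l] // ul; rewrite jet_rcons.
have [l1|l1] := eqVneq l 1; last first.
  have -> : (fun z => exp_form a z l j) = fun=> 0 by apply/funext => y; rewrite /exp_form (negPf l1).
  by rewrite /cpderive /= !pderive0.
rewrite l1 exp_form1 cpderive_cis.
have [u1|u1] := boolP (1 \in u); first by rewrite !pderive_trig_eq0.
case: (ul (size u)); rewrite l1; congr rcons; apply/all_pred1P/allP => i iu /=.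
apply: contraTT iu => i0; suff -> : i = 1 by [].
by case: i i0 => -[|[|//]] hi // _; apply: val_inj.
Qed.

End Jets.

(** * The local integral as a matrix entry *)

Section LocalIntegral.
Variable R : realType.

Lemma size_oshuffle (A : eqType) (ws : seq (seq A)) w :
  all (fun w => 0 < size w)%N ws -> w \in oshuffle ws ->
  size w = sumn (map size ws).
Proof.
elim/last_ind: ws w => [|ws v IH] w; first by rewrite inE => _ /eqP ->.
rewrite all_rcons => /andP[v0 ws0]; case/lastP: v v0 => // v x _.
rewrite oshuffle_rcons => /mapP[u /flattenP[_ /mapP[u' u'ws ->] uv] ->].
rewrite size_rcons (size_shuffle uv) (IH u') //.
by rewrite map_rcons sumn_rcons size_rcons addnS.
Qed.

(** The word e_(j+1) ... e_(j+r) attached to the entry (j, j + r); [inord] gives the intended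
    letters when j + r <= m.+1. *)
Definition word m j r : seq 'I_m.+1 := map inord (iota j r).

Lemma size_word m j r : size (word m j r) = r.
Proof. by rewrite size_map size_iota. Qed.

Lemma take_word m j r k : (k <= r)%N -> take k (word m j r) = word m j k.
Proof. by move=> kr; rewrite -map_take take_iota (minn_idPl kr). Qed.

Lemma drop_word m j r k : drop k (word m j r) = word m (j + k) (r - k).
Proof. by rewrite -map_drop drop_iota addnC. Qed.

Lemma enum_word m : enum 'I_m.+1 = word m 0 m.+1.
Proof.
rewrite /word -val_enum_ord -map_comp -[LHS]map_id; apply: eq_map => i /=.
by rewrite inord_val.
Qed.

Lemma nth_word m i0 j r k : (k < r)%N -> nth i0 (word m j r) k = inord (j + k).
Proof. by move=> kr; rewrite (nth_map 0%N) ?size_iota // nth_iota. Qed.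

Variables (m : nat) (a : 'I_m.+1 -> R[i]) (th : 'I_m.+1 -> R).
Hypothesis aE : forall j, a j = 0 +i* th j.

Definition angle (j : nat) : R := - \sum_(i < m.+1 | (i < j)%N) th i.

Lemma angleB j r : (j + r <= m.+1)%N ->
  angle j - angle (j + r)%N = \sum_(i < m.+1 | (j <= i)%N && (i < j + r)%N) th i.
Proof.
move=> jr; rewrite /angle opprK addrC (bigID (fun i : 'I_m.+1 => (i < j)%N)) /=.
rewrite (eq_bigl (fun i : 'I_m.+1 => (i < j)%N)) => [|i]; last first.
  by case ij : (i < j)%N; rewrite ?andbF // andbT (leq_trans ij) // leq_addr.
rewrite addrAC subrr add0r; apply: eq_bigl => i.
by rewrite -leqNgt andbC.
Qed.

Lemma angleS j : (j < m.+1)%N -> angle j - angle j.+1 = th (inord j).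
Proof.
move=> jm; rewrite -addn1 angleB ?addn1 //.
rewrite (big_pred1 (inord j)) // => i /=.
by rewrite ltnS -eqn_leq eq_sym -val_eqE /= inordK.
Qed.

Lemma cis_word (x : R) j r : (j + r <= m.+1)%N ->
  \prod_(i <- word m j r) cis (th i * x) = cis ((angle j - angle (j + r)%N) * x).
Proof.
rewrite big_map; elim: r j => [|r IH] j jr /=.
  by rewrite big_nil addn0 subrr mul0r cis0.
rewrite big_cons IH ?addSnnS //.
rewrite -angleS; last by apply: leq_trans jr; rewrite addnS ltnS leq_addr.
by rewrite -cisD; congr cis; ring.
Qed.

(** The jets live on the words 0^n 1, with value a_i^n e^(a_i x), and a_i is the difference of
    consecutive diagonal entries, so [osumE] evaluates the sum. *)
Lemma local_integral_loc p (X : R -> R -> tseries 2 R) (gamma : R -> 'rV[R]_2) t u j r :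
  (j + r <= m.+1)%N ->
  local_integral p X gamma (exp_form a) t u (word m j r) =
  cis ((angle j - angle (j + r)%N) * gamma t 0 0) *
  \sum_(n < (Num.truncn p).+1)
    lev (dshift (fun j => 0 +i* angle j) (- (0 +i* angle (j + r)%N))) j r n (emb (X t u)).
Proof.
move=> jr; set P := Num.truncn p.
pose J (w : seq 'I_2) (i : 'I_m.+1) := jet (exp_form a) (gamma t) w i.
(* Truncating at length P encodes the constraint on the total length; empty words are excluded by
   their vanishing jets. *)
pose F : tseries 2 R[i] := fun w => if (size w <= P)%N then emb (X t u) w else 0.
transitivity (osum P J (size (word m j r)) (word m j r) F).
  rewrite /local_integral /osum -/P big_mkcond /=; apply: eq_bigr => ws _.
  have [all0|] := boolP (all (fun w => 0 < size w)%N (map val ws)); last first.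
    move=> /allPn[w wws w0] /=.
    suff -> : \prod_(wj <- zip [seq val i | i <- ws] (word m j r)) J wj.1 wj.2 = 0 by rewrite mul0r.
    have sz : size [seq val i | i <- ws] = size (word m j r) by rewrite size_map size_tuple.
    have wn : w = [::] by move: w0; rewrite -leqNgt leqn0 size_eq0 => /eqP.
    have /(nthP [::])[k ks wk] := wws.
    rewrite (big_nth ([::], ord0)) big_mkord.
    have kz : (k < size (zip [seq val i | i <- ws] (word m j r)))%N.
      by rewrite size_zip leq_min ks /=; move: ks; rewrite {1}sz.
    by rewrite (bigD1 (Ordinal kz)) //= nth_zip //= wk wn mul0r.
  case: leqP => sP /=.
    congr (_ * _); rewrite rmorph_sum /= big_seq [RHS]big_seq; apply: eq_bigr => w wos.
    by rewrite /F (size_oshuffle all0 wos) sP.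
  rewrite [X in _ * X](_ : _ = 0) ?mulr0 // big_seq big1 // => w wos.
  by rewrite /F (size_oshuffle all0 wos) leqNgt sP.
rewrite (@osumE _ _ P J a (fun i => cis (th i * gamma t 0 0)) _ _ (fun j => 0 +i* angle j) j).
- rewrite size_word cis_word //; congr (_ * _); apply: eq_bigr => n _.
  by apply: eq_lev => // w sw; rewrite /F sw -ltnS ltn_ord.
- by move=> n i; rewrite /J (jet_exp_form aE).
- by move=> w i wn; rewrite /J (jet_exp_form_eq0 aE).
- by move=> w Pw; rewrite /F leqNgt Pw.
move=> i0 k; rewrite size_word => kr; rewrite nth_word // aE.
rewrite -(@angleS (j + k)) ?(leq_trans _ jr) ?ltn_add2l //.
by simpc.
Qed.

End LocalIntegral.

(** * The logarithmic signature *)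

Lemma norm_cabs_small (R : realType) (e : R) : 0 < e ->
  exists2 e' : R[i], 0 < e' & forall a, `|a| < e' -> cabs a < e.
Proof.
move=> e0; exists e%:C; first by rewrite ltcR.
by move=> a; rewrite -ltcR.
Qed.

Lemma radius_infinite_bound (R : realType) d (xi : tseries d R) (r : R) :
  radius_of_convergence (@Num.norm R R) xi = +oo%E -> 0 <= r ->
  exists B, forall n, pnorm (@Num.norm R R) n xi * r ^+ n <= B.
Proof.
move=> rad r0.
have absP := normr_absolute_value R.
have [r' [rr' [r'0 cv]]] : exists r', r < r' /\ 0 <= r' /\
    cvgn (series (fun n => pnorm (@Num.norm R R) n xi * r' ^+ n)).
  apply: contrapT => H.
  have : (radius_of_convergence (@Num.norm R R) xi <= r%:E)%E.
    apply: ge_ereal_sup => _ [r' [r'0 cv] <-].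
    rewrite lee_fin leNgt; apply/negP => rr'; apply: H; by exists r'.
  by rewrite rad leye_eq.
exists (limn (series (fun n => pnorm (@Num.norm R R) n xi * r' ^+ n))) => n.
have t0 k : 0 <= pnorm (@Num.norm R R) k xi * r' ^+ k.
  by rewrite mulr_ge0 ?exprn_ge0 // pnorm_ge0.
apply: (@le_trans _ _ (pnorm (@Num.norm R R) n xi * r' ^+ n)).
  rewrite ler_wpM2l ?(pnorm_ge0 absP) //; apply: lerXn2r; rewrite ?nnegrE //; exact: ltW.
apply: (@le_trans _ _ (series (fun n => pnorm (@Num.norm R R) n xi * r' ^+ n) n.+1)).
  by rewrite /series /= big_nat_recr //= lerDr sumr_ge0.
apply: nondecreasing_cvgn_le cv _; apply/nondecreasing_seqP => k.
by rewrite /series /= big_nat_recr //= lerDl.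
Qed.

(** If M vanishes at distances 1, ..., r - 1, the commutation relation at distance r reduces to (dg
    j - dg (j + r)) M j r = 0. *)
Lemma unitriangular_commutant_eq0 (K : numFieldType) m (M L : nat -> nat -> K)
    (dg : nat -> K) :
  (forall j r, (j + r <= m)%N -> \sum_(i < r.+1) M j i * L (j + i)%N (r - i)%N =
                                 \sum_(i < r.+1) L j i * M (j + i)%N (r - i)%N) ->
  (forall j, M j 0%N = 1) -> (forall j, L j 0%N = dg j) ->
  (forall j r, (0 < r)%N -> (j + r <= m)%N -> dg j != dg (j + r)%N) ->
  forall j r, (0 < r)%N -> (j + r <= m)%N -> M j r = 0.
Proof.
move=> ML M0 L0 dgn j r; elim/ltn_ind: r j => -[//|r] IH j _ jr.
have := ML j r.+1 jr.
rewrite (sum_ends (fun i => M j i * L (j + i)%N (r.+1 - i)%N)).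
rewrite (sum_ends (fun i => L j i * M (j + i)%N (r.+1 - i)%N)).
rewrite !addn0 !subn0 !subnn !M0 !L0 mul1r mulr1.
rewrite big1 => [|i _]; last first.
  rewrite IH ?mul0r // ?ltnS ?ltn_ord //.
  by apply: leq_trans jr; rewrite leq_add2l ltnW // ltnS ltn_ord.
rewrite big1 => [|i _]; last first.
  have ir := ltn_ord i; rewrite subSS IH ?mulr0 ?subn_gt0 // ?ltnS ?leq_subr //.
  by rewrite -addnA addSn subnKC // ltnW.
rewrite !addr0 addrC => /addIr/eqP; rewrite mulrC -subr_eq0 -mulrBl mulf_eq0 => /orP[|/eqP//].
by rewrite subr_eq0 eq_sym (negPf (dgn _ _ _ _)).
Qed.

(** S - 1 vanishes on every prefix of the word, the empty one included, hence so do its positive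
    powers on the word. *)
Lemma tlog_word_eq0 (R : realType) m (S : tseries m.+1 R[i]) :
  S [::] = 1 ->
  (forall r, (0 < r)%N -> (r <= m.+1)%N -> S (word m 0 r) = 0) ->
  tlog S (enum 'I_m.+1) = 0.
Proof.
move=> S1 S0; rewrite enum_word /tlog big1_seq // => -[|n]; rewrite mem_index_iota // => _.
rewrite tpowS /tmul big1 ?mulr0 // => -[k /= km] _.
rewrite ltnS size_word in km; rewrite take_word // /tlin.
case: k km => [|k'] km; first by rewrite /= S1 mulr1 addNr mul0r.
by rewrite S0 // /= mulr0 addr0 mul0r.
Qed.

Lemma cis_2pi_int (R : realType) (z : int) : cis (2 * pi * z%:~R : R) = 1.
Proof.
have c2 : cis (2 * pi : R) = 1 by rewrite /cis mulr_natl cos2pi sin2pi.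
have cn n : cis (2 * pi * n%:R : R) = 1.
  elim: n => [|n IH]; first by rewrite mulr0 cis0.
  by rewrite -[n.+1%:R]natr1 mulrDr mulr1 cisD IH c2 mulr1.
case: z => n; first exact: cn.
rewrite NegzE mulrNz mulrN.
have := cisD (2 * pi * n.+1%:R : R) (- (2 * pi * n.+1%:R)).
by rewrite subrr cis0 cn mul1r => <-.
Qed.

Lemma cis_angle (R : realType) m (th : 'I_m.+1 -> R) j :
  (forall i, exists z : int, th i = 2 * pi * z%:~R) -> cis (angle th j) = 1.
Proof.
move=> thz; rewrite /angle.
have : cis (\sum_(i < m.+1 | (i < j)%N) th i) = 1.
  elim/big_rec: _ => [|i x _ IH]; first exact: cis0.
  by have [z ->] := thz i; rewrite cisD IH cis_2pi_int mulr1.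
have := cisD (\sum_(i < m.+1 | (i < j)%N) th i) (- \sum_(i < m.+1 | (i < j)%N) th i).
by rewrite subrr cis0 => E cE; rewrite cE mul1r in E.
Qed.

(** * The signature and the rough integral after the time change *)

Section MainProof.
Variables (R : realType) (p : R) (X Y : R -> R -> tseries 2 R) (gamma : R -> 'rV[R]_2).
Hypothesis p1 : 1 <= p.
Let P := Num.truncn p.
Hypothesis Xgeo : weakly_geometric p X.
Hypothesis Xgamma : first_level X gamma.
Hypothesis YX : lyons_extension (@Num.norm R R) p X Y.
Variables (T : R) (tau V : R -> R).
Hypothesis V_incr : forall s t, 0 <= s -> s < t -> t <= 1 -> t - s <= V t - V s.
Hypothesis YV : forall s t, 0 <= s -> s < t -> t <= 1 ->
  forall y, (0 < size y <= P)%N -> `|Y s t y| <= ((V t - V s) `^ p^-1) ^+ size y.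
Hypothesis tauP : forall v w, 0 <= v -> v <= w -> w <= T ->
  [/\ 0 <= tau v, tau v <= tau w, tau w <= 1 & tau w - tau v <= w - v].
Hypothesis tauV : forall v w e, 0 <= v -> v <= w -> w <= T -> tau v < tau w -> 0 < e ->
  exists s t, [/\ tau v < s <= tau v + e, s < t, tau w - e <= t <= tau w &
    V t - V s <= w - v].

Let Z v w := Y (tau v) (tau w).
Let x v := gamma (tau v) 0 0.

Let tau_simplex v w : 0 <= v -> v <= w -> w <= T -> simplex (tau v, tau w).
Proof. by move=> v0 vw wT; have [a b c _] := tauP v0 vw wT. Qed.

Lemma Z_nil v w : 0 <= v -> v <= w -> w <= T -> Z v w [::] = 1.
Proof.
by move=> v0 vw wT; have [Y1 _ _ _] := YX.1 0%N; apply: Y1; apply: tau_simplex.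
Qed.

Lemma Z_mul v u w y : 0 <= v -> v <= u -> u <= w -> w <= T ->
  Z v w y = tmul (Z v u) (Z u w) y.
Proof.
move=> v0 vu uw wT; have [_ _ YM _] := YX.1 (size y).
have [a1 a2 a3 _] := tauP v0 vu (le_trans uw wT).
by have [b1 b2 b3 _] := tauP (le_trans v0 vu) uw wT; apply: YM.
Qed.

Lemma Z_bound v w y : 0 <= v -> v <= w -> w <= T -> (0 < size y <= P)%N ->
  `|Z v w y| <= ((w - v) `^ p^-1) ^+ size y.
Proof.
move=> v0 vw wT yP; apply: (time_changed_bound p1 tauP tauV (YX.1 _) YV) => // s t s0 st t1.
by apply: le_trans (V_incr s0 st t1); rewrite subr_ge0 ltW.
Qed.

Lemma Z_vanishing y : (P < size y)%N -> vanishing T (fun v w => `|Z v w y|).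
Proof.
move=> Py; apply: (vanishing_level p1 tauP (normr_absolute_value R) _ (YX.1 (size y))).
  by move=> e e0; exists e.
by rewrite Py leqnn.
Qed.

Lemma Z_exp v w : 0 <= v -> v <= w -> w <= T -> exists2 L, lie_poly L &
  forall y, (size y <= P)%N -> Z v w y = texp L y.
Proof.
move=> v0 vw wT; have sx := tau_simplex v0 vw wT.
have [L lL XL] := Xgeo sx; exists L => // y yP.
by rewrite /Z YX.2 // XL.
Qed.

Lemma Z_letter v w : 0 <= v -> v <= w -> w <= T -> Z v w [:: 0] = x w - x v.
Proof.
move=> v0 vw wT; have sx := tau_simplex v0 vw wT.
rewrite /Z YX.2 //; first exact: Xgamma.
by rewrite truncn_gt0.
Qed.

Section Integral.
Variables (m : nat) (a : 'I_m.+1 -> R[i]) (th : 'I_m.+1 -> R).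
Hypothesis aE : forall j, a j = 0 +i* th j.
Variables (B SB : R -> R -> tseries m.+1 R[i]).
Hypothesis Bint : is_rough_integral p X gamma (exp_form a) B.
Hypothesis SBB : lyons_extension (@cabs R) p B SB.

Let b v w j r := SB (tau v) (tau w) (word m j r).
Let absP := cabs_absolute_value R.

(** Superadditivity bounds omega s t by the increment of omega 0, which is the W of [vanishing_powR]
    with exponent q = 1/theta. *)
Lemma control_vanishing omega theta : control omega -> 1 < theta ->
  vanishing T (fun v w => omega (tau v) (tau w) `^ theta).
Proof.
move=> [om0 omc omD] th1.
have om_diag s : 0 <= s <= 1 -> omega s s = 0.
  move=> /andP[s0 s1]; have sx : @simplex R (s, s) by rewrite /simplex /= s0 s1.
  have := omD s s s s0 (lexx s) (lexx s) s1; have := om0 s s sx; lra.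
have thp : 0 < theta by apply: lt_trans th1.
apply: (@vanishing_powR _ _ _ tauP (fun s t => omega s t `^ theta) theta^-1 (omega 0)).
- by rewrite invr_gt0.
- by rewrite invf_lt1.
- by move=> *; exact: powR_ge0.
- move=> s t s0 st t1; have sx : @simplex R (s, t) by rewrite /simplex /= s0 st t1.
  rewrite -powRrM mulfV ?gt_eqF // powRr1; last exact: om0.
  have := omD 0 s t (lexx _) s0 st t1; lra.
move=> e e0; have e'0 : 0 < e / 2 by rewrite divr_gt0.
have [e1 e10 He1] := powR_small thp e'0.
have [del del0 H] := diagonal_small omc om_diag e10.
exists del => // s t s0 st t1 ts.
have sx : @simplex R (s, t) by rewrite /simplex /= s0 st t1.
have := H s t s0 st t1 ts; rewrite /= ger0_norm ?om0 // => h.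
apply: le_lt_trans (He1 _ (om0 _ _ sx) h) _.
by rewrite ltr_pdivrMr // ltr_pMr // ltr1n.
Qed.

(** For r <= P this is the defining estimate of the rough integral. For r > P the local term is
    zero, and the extension itself has vanishing dyadic sums. *)
Lemma integral_loc_vanishing j r : (j + r <= m.+1)%N -> (0 < r)%N ->
  vanishing T (fun v w => cabs (b v w j r - loc p Z x (angle th) v w j r)).
Proof.
move=> jr r0; have [rP|Pr] := leqP r P.
  have [_ [omega [theta [om th1 HB]]]] := Bint.
  apply: vanishing_le (control_vanishing om th1) => v w v0 vw wT.
  have sx := tau_simplex v0 vw wT.
  apply: le_trans (HB r _ _ _ sx); last by rewrite r0.
  apply: le_trans (abs_le_pnorm absP _ (size_word m j r)).
  rewrite /tlin (local_integral_loc aE) // /b SBB.2 ?size_word // /loc.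
  rewrite (_ : \sum_(n < _) _ = \sum_(n < P.+1) lev (dshift (fun j => 0 +i* angle th j)
    (- (0 +i* angle th (j + r)%N))) j r n (emb (X (tau v) (tau w)))).
    by rewrite addrC mulN1r.
  apply: eq_bigr => n _; apply: eq_lev => // y sy.
  by rewrite /emb /Z YX.2 // sy -ltnS ltn_ord.
have -> : (fun v w => cabs (b v w j r - loc p Z x (angle th) v w j r)) =
  (fun v w => cabs (SB (tau v) (tau w) (word m j r))).
  by apply/funext => v; apply/funext => w; rewrite loc_large // subr0.
apply: (vanishing_level p1 tauP absP _ (SBB.1 r)); first exact: norm_cabs_small.
by rewrite size_word Pr leqnn.
Qed.

Lemma angle_bound : exists2 c, 1 <= c & forall j, `|angle th j| <= c.
Proof.
exists (1 + \sum_i `|th i|) => [|j]; first by rewrite lerDl sumr_ge0.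
rewrite normrN; apply: le_trans (ler_norm_sum _ _ _) _.
rewrite (le_trans _ (_ : \sum_i `|th i| <= _)) ?lerDr // big_mkcond ler_sum // => i _.
by case: ifP.
Qed.

Lemma integral_hol v w j r : 0 <= v -> v <= w -> w <= T -> (j + r <= m.+1)%N ->
  b v w j r = hol Z x (angle th) v w j r.
Proof.
move=> v0 vw wT jr; have [c c1 thc] := angle_bound.
apply: (hol_unique p1 Z_nil Z_mul Z_bound Z_vanishing Z_exp Z_letter c1 thc) jr => //.
- move=> {v0 vw wT} {}v {}w {}j v0 vw wT _.
  by have [SB1 _ _ _] := SBB.1 0%N; apply: SB1; apply: tau_simplex.
- move=> {v0 vw wT} {}v u {}w {}j {}r v0 vu uw wT jr.
  have [_ _ SBM _] := SBB.1 r.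
  have [a1 a2 a3 _] := tauP v0 vu (le_trans uw wT).
  have [b1 b2 b3 _] := tauP (le_trans v0 vu) uw wT.
  rewrite /b (SBM _ (tau u)) ?size_word // /tmul size_word.
  apply: eq_bigr => i _; rewrite take_word ?drop_word //.
  by rewrite -ltnS.
exact: integral_loc_vanishing.
Qed.

End Integral.

Section Logarithm.
Variables (m : nat) (th : 'I_m.+1 -> R).
Hypothesis T0 : 0 <= T.
Hypothesis tau0 : tau 0 = 0.
Hypothesis tau1 : tau T = 1.
Hypothesis gamma0 : gamma 0 0 0 = 0.
Hypothesis gamma1 : gamma 1 0 0 = 1.
Hypothesis log_entire : radius_of_convergence (@Num.norm R R) (tlog (Y 0 1)) = +oo%E.
Hypothesis thz : forall i, exists z : int, th i = 2 * pi * z%:~R.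
Hypothesis th_nd : forall j r, (0 < r)%N -> (j + r <= m.+1)%N ->
  angle th j != angle th (j + r)%N.

(* M and L are the upper triangular images of the signature and of its logarithm
   under a representation. They commute, M has diagonal 1 and the diagonal of L
   consists of distinct numbers, hence M is the identity. *)
Lemma dev_eq0 j r : (0 < r)%N -> (j + r <= m.+1)%N -> dev Z (angle th) 0 T j r = 0.
Proof.
have [c c1 thc] := angle_bound th.
pose dg j : R[i] := 0 +i* angle th j.
have dgc i : cabs (dg i) <= c by rewrite cabs_imag.
have c0 : 0 < c by apply: lt_le_trans c1.
have Y1 : Y 0 1 [::] = 1.
  by have := Z_nil (lexx 0) T0 (lexx T); rewrite /Z tau0 tau1.
have [k1 H1] := lev_emb_bound p1 Z_nil Z_mul Z_bound Z_vanishing c1.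
have {}H1 i q n : cabs (lev dg i q n (emb (Y 0 1))) <= k1 / 8 ^+ n.
  have := H1 dg i q n 0 T dgc (lexx 0) T0 (lexx T).
  by rewrite /Z tau0 tau1.
(* 16 c = c 2 8: c bounds the weight of a letter, 2 is the number of letters, and 8 is the rate
   wanted for the series. *)
have c16 : 0 <= 16 * c by rewrite mulr_ge0 // ltW.
have [k2 H2] := radius_infinite_bound log_entire c16.
have {}H2 i q n : cabs (lev dg i q n (emb (tlog (Y 0 1)))) <= k2 / 8 ^+ n.
  apply: le_trans (cabs_lev _ _ _ _ c1 dgc) _.
  rewrite ler_pdivlMr ?exprn_gt0 //; apply: le_trans (H2 n).
  apply: (@le_trans _ _ (c ^+ n * (2%:R ^+ n * pnorm (@Num.norm R R) n (tlog (Y 0 1))) * 8 ^+ n)).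
    rewrite ler_wpM2r ?exprn_ge0 // ler_wpM2l ?exprn_ge0 ?(ltW c0) //.
    exact: (wsum_le_pnorm (normr_absolute_value R)).
  have -> : 16 * c = c * 2 * 8 by ring.
  by rewrite !exprMn le_eqVlt; apply/orP; left; apply/eqP; ring.
pose M i q := dev Z (angle th) 0 T i q.
have HM i q : csum (fun n => lev dg i q n (emb (Y 0 1))) (M i q).
  have := devP p1 Z_nil Z_mul Z_bound Z_vanishing c1 thc i q (lexx 0) T0 (lexx T).
  by rewrite /Z tau0 tau1.
have Lex i q := csum_geometric_ex (H2 i q).
pose L i q := sval (cid (Lex i q)).
have HL i q : csum (fun n => lev dg i q n (emb (tlog (Y 0 1)))) (L i q) := svalP (cid (Lex i q)).
have xT : x T - x 0 = 1 by rewrite /x tau0 tau1 gamma0 gamma1 subr0.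
have Ynseq n : Y 0 1 (nseq n 0) = n`!%:R^-1.
  have := Z_nseq p1 Z_nil Z_mul Z_bound Z_vanishing Z_exp Z_letter n (lexx 0) T0 (lexx T).
  by rewrite xT expr1n mul1r /Z tau0 tau1.
have prod (A1 A2 : tseries 2 R) k k' (U1 U2 : nat -> nat -> R[i]) i q :
    (forall i q n, cabs (lev dg i q n (emb A1)) <= k / 8 ^+ n) ->
    (forall i q n, cabs (lev dg i q n (emb A2)) <= k' / 8 ^+ n) ->
    (forall i q, csum (fun n => lev dg i q n (emb A1)) (U1 i q)) ->
    (forall i q, csum (fun n => lev dg i q n (emb A2)) (U2 i q)) ->
    csum (fun n => lev dg i q n (emb (tmul A1 A2)))
      (\sum_(l < q.+1) U1 i l * U2 (i + l)%N (q - l)%N).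
  move=> hA1 hA2 hU1 hU2.
  have -> : (fun n => lev dg i q n (emb (tmul A1 A2))) = (fun n => \sum_(l < q.+1)
      \sum_(k < n.+1) lev dg i l k (emb A1) * lev dg (i + l) (q - l) (n - k) (emb A2)).
    by apply/funext => n; rewrite exchange_big /= -lev_tmul emb_tmul.
  apply: csum_sum => l.
  exact: (csum_cauchy_product (u := fun n => lev dg i l n (emb A1))
    (v := fun n => lev dg (i + l) (q - l) n (emb A2)) (hA1 _ _) (hA2 _ _)).
apply: (@unitriangular_commutant_eq0 _ m.+1 M L dg) => //.
- move=> i q _; apply: csum_unique (prod _ _ _ _ _ _ i q H1 H2 HM HL) _.
  by rewrite tlog_comm //; exact: prod H2 H1 HL HM.
- move=> i; rewrite /M (dev0 p1 Z_nil Z_mul Z_bound Z_vanishing Z_exp Z_letter c1 thc) //.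
  by rewrite xT mulr1 cis_angle.
(* On the words 0^n the logarithm is nonzero only for n = 1, with value x_1 - x_0 = 1, so the
   diagonal of L is dg. *)
- move=> i; apply: csum_unique (HL i 0%N) _.
  have -> : dg i = \sum_(n < 2) lev dg i 0 n (emb (tlog (Y 0 1))).
    rewrite big_ord_recl big_ord1 !lev0 /emb !tlog_nseq //=.
    by rewrite mulr0 add0r mulr1.
  apply: csum_finite => n n2; rewrite lev0 /emb tlog_nseq //.
  by case: n n2 => [|[|n]] // _; rewrite /= mulr0.
move=> i q q0 iq; apply: contra (th_nd q0 iq) => /eqP[/eqP]; exact.
Qed.

End Logarithm.

End MainProof.

Theorem theorem6p5 (R : realType) (p : R) (X : R -> R -> tseries 2 R)
  (gamma : R -> 'rV[R]_2) (S : tseries 2 R) :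
  1 <= p ->
  rough_path (@Num.norm R R) p X ->
  weakly_geometric p X ->
  first_level X gamma ->
  gamma 0 = 0 ->
  gamma 1 0 0 = 1 ->
  is_signature (@Num.norm R R) p X S ->
  radius_of_convergence (@Num.norm R R) (tlog S) = +oo%E ->
  forall (m : nat) (a : 'I_m -> R[i]),
    (1 <= m)%N ->
    non_degenerate a ->
    (forall j, exists z : int, a j = 0 +i* (2 * pi * z%:~R)) ->
    forall c : R[i], is_S_coef p X gamma a c -> c = 0.
Proof.
move=> p1 _ Xgeo Xgamma gamma0 gamma1 [Y YX ->] rad [//|m] a _ nd az c.
move=> [B [_ [Bint [SB SBB ->] ->]]].
have thE : exists th : 'I_m.+1 -> R, (forall j, a j = 0 +i* th j) /\
    (forall j, exists z : int, th j = 2 * pi * z%:~R).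
  by exists (fun j => complex.Im (a j)); split=> j; have [z ->] := az j; last exists z.
have {az} [th [aE thz]] := thE.
have [V HV] := variation_bound (normr_absolute_value R) p1 (YX.1 (Num.truncn p)).
have V_incr s t : 0 <= s -> s < t -> t <= 1 -> t - s <= V t - V s.
  by move=> s0 st t1; have [] := HV s t s0 st t1.
have YV s t : 0 <= s -> s < t -> t <= 1 -> forall y, (0 < size y <= Num.truncn p)%N ->
    `|Y s t y| <= ((V t - V s) `^ p^-1) ^+ size y.
  by move=> s0 st t1; have [] := HV s t s0 st t1.
have [T [tau [T0 tau0 tau1 tauP tauV]]] := time_change V_incr.
(* A difference of angles is the sum of the th i over j <= i < j + r; non-degeneracy is applied to
   the closed range from j to j + r - 1. *)
have th_nd j r : (0 < r)%N -> (j + r <= m.+1)%N -> angle th j != angle th (j + r)%N.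
  move=> r0 jr; rewrite -subr_eq0 angleB //.
  have jm : (j < m.+1)%N by apply: leq_trans jr; rewrite -addn1 leq_add2l.
  have jrm : ((j + r).-1 < m.+1)%N by apply: leq_trans jr; rewrite prednK // addn_gt0 r0 orbT.
  have := nd (inord j) (inord (j + r).-1); rewrite !inordK //.
  rewrite -ltnS prednK ?addn_gt0 ?r0 ?orbT // -addn1 leq_add2l => /(_ r0).
  apply: contra => /eqP th0.
  rewrite (eq_bigl (fun i : 'I_m.+1 => (j <= i)%N && (i < j + r)%N)); last first.
    by move=> i; rewrite -[in RHS](@prednK (j + r)) // addn_gt0 r0 orbT.
  suff -> : \sum_(i < m.+1 | (j <= i)%N && (i < j + r)%N) a i =
      0 +i* \sum_(i < m.+1 | (j <= i)%N && (i < j + r)%N) th i by rewrite th0.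
  elim/big_rec2: _ => [|i y1 y2 _ ->] //; by rewrite aE; simpc.
apply: tlog_word_eq0.
  by have [SB1 _ _ _] := SBB.1 0%N; apply: SB1; rewrite /simplex /= lexx ler01.
move=> r r0 rm.
have := integral_hol p1 Xgeo Xgamma YX V_incr YV tauP tauV aE Bint SBB (j := 0) (r := r)
   (lexx 0) T0 (lexx T) rm.
rewrite tau0 tau1 => ->; rewrite /hol.
have g0 : gamma 0 0 0 = 0 by rewrite gamma0 mxE.
by rewrite (dev_eq0 p1 Xgeo Xgamma YX V_incr YV tauP tauV T0 tau0 tau1 g0 gamma1 rad thz th_nd) // mulr0 mul0r.
Qed.
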